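(* Let $f\colon I\to\mathbb{R}$ be a continuous function defined on an interval $I\subseteq\mathbb{R}$. The following conditions are equivalent: (i) $f$ is operator convex. (ii) For each natural number $n\ge 1$ the inequality $$f\left(\sum_{i=1}^n a_i^* x_i a_i\right)\le\sum_{i=1}^n a_i^* f(x_i)a_i$$ holds for every $n$-tuple $(x_1,\dots,x_n)$ of bounded self-adjoint operators on an arbitrary Hilbert space $\mathfrak{H}$ with spectra contained in $I$ and every $n$-tuple $(a_1,\dots,a_n)$ of bounded operators on $\mathfrak{H}$ with $\sum_{k=1}^n a_k^*a_k=\mathbf{1}$. (iii) $f(v^*xv)\le v^*f(x)v$ for each isometry $v$ on an infinite-dimensional Hilbert space $\mathfrak{H}$ and every bounded self-adjoint operator $x$ on $\mathfrak{H}$ with spectrum in $I$. (iv) $pf(pxp+s(\mathbf{1}-p))p\le pf(x)p$ for each (orthogonal) projection $p$ on an infinite-dimensional Hilbert space $\mathfrak{H}$, every bounded self-adjoint operator $x$ on $\mathfrak{H}$ with spectrum in $I$ and every $s\in I$.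
   Context: Hilbert spaces are complex; in (iii) and (iv), as in (ii), the Hilbert space is arbitrary subject to the stated condition. $\mathbf{1}$ is the identity operator, and $\le$ is the usual order on bounded self-adjoint operators ($a\le b$ iff $b-a$ is positive). An isometry $v$ on $\mathfrak{H}$ is a bounded operator on $\mathfrak{H}$ with $v^*v=\mathbf{1}$. For a bounded self-adjoint operator $x$ with spectrum in $I$, $f(x)$ is defined by the spectral theorem (continuous functional calculus): $f(x)=\int f(\lambda)\,dE_x(\lambda)$, where $E_x$ is the spectral measure of $x$. A continuous function $f\colon I\to\mathbb{R}$ is called operator convex if $f(\lambda x+(1-\lambda)y)\le\lambda f(x)+(1-\lambda)f(y)$ for each $\lambda\in[0,1]$ and every pair $x,y$ of bounded self-adjoint operators on an infinite-dimensional Hilbert space with spectra in $I$. *)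

(* Defs.v *)
From HB Require Import structures.
From mathcomp Require Import all_boot all_order all_algebra sesquilinear.
From mathcomp Require Import all_classical all_reals all_analysis.
From mathcomp.real_closed Require Import complex.

Set Implicit Arguments.
Unset Strict Implicit.
Unset Printing Implicit Defensive.

Import Order.TTheory GRing.Theory Num.Theory.
Import numFieldNormedType.Exports.

Local Open Scope classical_set_scope.
Local Open Scope ring_scope.
Local Open Scope complex_scope.

(* [inner] is linear in its first argument and conjugate-linear in the
   second one. *)
HB.mixin Record CompleteNormedModule_isHilbert (R : realType) H
    & CompleteNormedModule R[i] H := {
  inner : {dot H for @Num.conj R[i]};
  inner_norm : forall u : H, inner u u = `|u| ^+ 2
}.

#[short(type="hilbertType")]
HB.structure Definition Hilbert (R : realType) :=
  {H of CompleteNormedModule_isHilbert R H & CompleteNormedModule R[i] H}.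

Section Operators.
Context (R : realType) (H : hilbertType R).
Implicit Types (a b x y p v : H -> H) (u w xi : H).

Definition infinite_dimensional : Prop :=
  ~ exists (n : nat) (e : 'I_n -> H),
      forall u, exists c : 'I_n -> R[i], u = \sum_(i < n) c i *: e i.

Definition bounded_operator a : Prop :=
  linear a /\ exists M : R[i], forall u, `|a u| <= M * `|u|.

(* The set below is a singleton when [a] is bounded (Riesz representation). *)
Definition adjoint a : H -> H :=
  xget 0 [set b | bounded_operator b /\
                  forall u w, inner (a u) w = inner u (b w)].

Definition selfadjoint a : Prop := bounded_operator a /\ adjoint a = a.

Definition projection p : Prop := selfadjoint p /\ p \o p = p.

Definition isometric v : Prop := bounded_operator v /\ adjoint v \o v = id.

(* The order of [R[i]] makes a nonnegative complex number real. *)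
Definition positive_operator a : Prop := forall xi, 0 <= inner (a xi) xi.

Definition op_le a b : Prop := positive_operator (b - a).

Definition spectrum a : set R[i] :=
  [set l | ~ exists b, [/\ bounded_operator b,
                           (a - l *: id) \o b = id & b \o (a - l *: id) = id]].

Definition spectrum_in (I : set R) a : Prop :=
  spectrum a `<=` [set t%:C | t in I].

Definition real_spectrum a : set R := [set t | spectrum a t%:C].

Definition diag_measure (E : set R -> (H -> H)) (xi : H)
    (A : set (measurableTypeR R)) : \bar R :=
  (complex.Re (inner (E A xi) xi))%:E.

(* [y] is the integral of [f] over [D] with respect to [E], in the weak sense;
   the diagonal matrix coefficients determine [y] by polarization. *)
Definition is_spectral_integral (E : set R -> (H -> H)) (D : set R)
    (f : R -> R) y : Prop :=
  bounded_operator y /\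
  forall xi, inner (y xi) xi =
    (fine (\int[diag_measure E xi]_(t in (D : set (measurableTypeR R)))
             (f t)%:E)%E)%:C.

(* A spectral measure is only meaningful on Borel sets; its values on the other
   subsets of [R] are irrelevant. *)
Definition is_spectral_measure x (E : set R -> (H -> H)) : Prop :=
  [/\ forall A : set (measurableTypeR R), measurable A -> projection (E A),
      E set0 = 0 /\ E setT = id,
      forall A B : set (measurableTypeR R), measurable A -> measurable B ->
        E (A `&` B) = E A \o E B,
      forall xi, semi_sigma_additive (diag_measure E xi) &
      E (real_spectrum x) = id /\
      is_spectral_integral E (real_spectrum x) (fun t => t) x].

(* By the spectral theorem, the spectral measure of a self-adjoint [x] exists
   and is unique on Borel sets. *)
Definition spectral_measure x : set R -> (H -> H) :=
  xget (fun=> 0) [set E | is_spectral_measure x E].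

Definition fun_calc (f : R -> R) x : H -> H :=
  xget 0 [set y |
    is_spectral_integral (spectral_measure x) (real_spectrum x) f y].

End Operators.

Arguments infinite_dimensional {R} H.

Definition operator_convex (R : realType) (I : set R) (f : R -> R) : Prop :=
  forall (H : hilbertType R), infinite_dimensional H ->
  forall (l : R), 0 <= l <= 1 ->
  forall x y : H -> H, selfadjoint x -> selfadjoint y ->
    spectrum_in I x -> spectrum_in I y ->
    op_le (fun_calc f (l%:C *: x + (1 - l)%:C *: y))
          (l%:C *: fun_calc f x + (1 - l)%:C *: fun_calc f y).

(* Main.v *)
From HB Require Import structures.
Require Import Defs.
From mathcomp Require Import all_boot all_order all_algebra sesquilinear.
From mathcomp Require Import all_classical all_reals all_analysis.
From mathcomp Require Import measurable_realfun.
From mathcomp Require Import ring lra.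
From mathcomp.real_closed Require Import complex.

Set Implicit Arguments.
Unset Strict Implicit.
Unset Printing Implicit Defensive.

Import Order.TTheory GRing.Theory Num.Theory.
Import numFieldNormedType.Exports.

Local Open Scope classical_set_scope.
Local Open Scope ring_scope.
Local Open Scope complex_scope.

(** Let H be the given Hilbert space and l2 H the space of square summable
    sequences in H, which is infinite-dimensional as soon as H is not zero.
    Every implication is an instance of one principle, [fun_calc_intertwine]:
    if T x = y T with T bounded and x, y selfadjoint, then T f(x) = f(y) T.  In
    particular f commutes with direct sums, with conjugation by unitaries, and
    with restriction to a reducing subspace.

    (i) implies (ii) ([jensen]).  The map V u = (0, a_1 u, ..., a_n u, 0, ...) is
    an isometry whose range is orthogonal to coordinate 0, so some unitary
    involution U of l2 H exchanges (u, 0, 0, ...) and V u.  Put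
    X = diag(r, x_1, ..., x_n, r, r, ...) for some scalar r in I.  Then Z = U X U
    has c = a_1* x_1 a_1 + ... + a_n* x_n a_n as its entry (0, 0).  Let S be the
    sign change of coordinate 0 and Z' = S Z S.  In (Z + Z') / 2 the other
    entries of row and column 0 vanish, so f of this average acts on
    coordinate 0 as f(c).  Operator convexity, read off at (u, 0, 0, ...),
    bounds <f(c) u, u> by the average of two equal numbers, namely
    <f(X) V u, V u>, which is the sum of the <f(x_i) a_i u, a_i u>.

    (ii) implies (iii): take n = 1.

    (iii) implies (iv) ([isometry_corner]).  The map
    v(w_0, w_1, ...) = (p w_0, (1 - p) w_0, w_1, ...) is an isometry of l2 H and
    compresses X = diag(x, s, s, ...) to diag(p x p + s (1 - p), s, s, ...).  Apply
    (iii) to v and X, and evaluate at (p u, 0, 0, ...), which v fixes.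

    (iv) implies (i) ([corner_convex]).  With q = sqrt l and r = sqrt (1 - l), the
    map W u = (q u, r u, 0, ...) is an isometry that compresses
    X = diag(x, y, y, ...) to c = l x + (1 - l) y.  For p = W W* the corner
    Z = p X p + a (1 - p) satisfies Z W = W c, hence f(Z) W = W f(c), and (iv)
    evaluated at W u is the convexity inequality.

    The hypothesis on spectra is used through numerical ranges: for a selfadjoint
    operator on a nonzero space, the extreme values of <x u, u> on unit vectors
    belong to the spectrum ([inf_spectrum], [sup_spectrum]).  The spectrum is
    therefore inside the interval I exactly when the numerical range is inside a
    segment with end points in I ([op_in]), a condition visibly stable under
    convex combinations, compressions and direct sums.

    The intertwining principle holds for polynomials, hence for every f(x) that
    is a norm limit of polynomials in x converging to f uniformly on the
    spectrum ([calc]).  The real content of the first parts is that f(x),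
    which is an integral against a spectral measure, is such a limit
    ([fun_calc_calc]); this is the spectral theorem.  The bound p(x) >= c
    when p >= c on the spectrum ([rpoly_ge]) yields the continuous calculus.
    Ramps decreasing to the indicator of ]-oo, l] give a spectral family
    ([spec_fam]), the Stieltjes measures of its diagonal coefficients give a
    projection for each Borel set ([sprojP], [sprojM]), and a Riemann sum
    recovers x ([spec_integral_id]).  Thus a spectral measure exists, and for any
    spectral measure the integrals of polynomials, hence of uniform limits of
    polynomials, are those of the calculus ([poly_integral], [calc_integral]). *)

(** * Real inner product, norm and strong limits *)
Section Linear.
Context (K : pzRingType) (U V : lmodType K) (a : U -> V).
Hypothesis la : linear a.
Lemma linD u v : a (u + v) = a u + a v.
Proof. by have := la 1 u v; rewrite !scale1r. Qed.
Lemma lin0 : a 0 = 0.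
Proof. by apply: (addrI (a 0)); rewrite -linD !addr0. Qed.
Lemma linZ c u : a (c *: u) = c *: a u.
Proof. by have := la c u 0; rewrite !addr0 lin0 addr0. Qed.
Lemma linN u : a (- u) = - a u.
Proof. by rewrite -scaleN1r linZ scaleN1r. Qed.
Lemma linB u v : a (u - v) = a u - a v.
Proof. by rewrite linD linN. Qed.
Lemma lin_sum I r (P : pred I) (F : I -> U) :
  a (\sum_(i <- r | P i) F i) = \sum_(i <- r | P i) a (F i).
Proof. exact: (big_morph a linD lin0). Qed.
End Linear.

Lemma inv_nat_small (R : realType) (e : R) : 0 < e ->
  exists N, forall n, (N <= n)%N -> n.+1%:R^-1 <= e.
Proof.
move=> e0; have /cvgrPdist_le/(_ _ e0)[N _ hN] := @cvg_harmonic R.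
exists N => n /hN; rewrite sub0r normrN ger0_norm //.
by rewrite /harmonic /= invr_ge0.
Qed.

Section RealInner.
Context (R : realType) (H : hilbertType R).
Implicit Types (u v w : H) (t : R).

(** The real part alone carries the whole inner product, see [innerE], and keeps
    all estimates in the ordered field [R]. *)
Definition ip u v : R := complex.Re (inner u v).
Definition nm u : R := Num.sqrt (ip u u).

Lemma ReD (x y : R[i]) : complex.Re (x + y) = complex.Re x + complex.Re y.
Proof. by case: x y => [? ?] [? ?]. Qed.

Lemma ipDl u v w : ip (u + v) w = ip u w + ip v w.
Proof. by rewrite /ip linearDl ReD. Qed.

Lemma innerC u v : inner u v = (inner v u)^*%C.
Proof.
have := @hermitian_subproof _ _ _ _ (@inner R H) u v.
by rewrite expr0 mul1r.
Qed.

Lemma ipC u v : ip u v = ip v u.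
Proof. by rewrite /ip innerC; case: (inner v u). Qed.

Lemma ipZl t u w : ip (t%:C *: u) w = t * ip u w.
Proof.
rewrite /ip linearZl_LR /=; case: (inner u w) => a b /=.
by rewrite mul0r subr0.
Qed.

Lemma ip_i u w : ip ('i *: u) w = - complex.Im (inner u w).
Proof.
rewrite /ip linearZl_LR /=; case: (inner u w) => a b /=.
by rewrite mul0r mul1r sub0r.
Qed.

Lemma ip0l w : ip 0 w = 0.
Proof. by apply: (addrI (ip 0 w)); rewrite -ipDl !addr0. Qed.
Lemma ipNl u w : ip (- u) w = - ip u w.
Proof. by apply: (addrI (ip u w)); rewrite -ipDl !subrr ip0l. Qed.
Lemma ipBl u v w : ip (u - v) w = ip u w - ip v w.
Proof. by rewrite ipDl ipNl. Qed.
Lemma ipDr u v w : ip w (u + v) = ip w u + ip w v.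
Proof. by rewrite ipC ipDl !(ipC w). Qed.
Lemma ipZr t u w : ip w (t%:C *: u) = t * ip w u.
Proof. by rewrite ipC ipZl ipC. Qed.
Lemma ip0r w : ip w 0 = 0. Proof. by rewrite ipC ip0l. Qed.
Lemma ipNr u w : ip w (- u) = - ip w u.
Proof. by rewrite ipC ipNl ipC. Qed.
Lemma ipBr u v w : ip w (u - v) = ip w u - ip w v.
Proof. by rewrite ipDr ipNr. Qed.
Definition ipE := (ipDl, ipDr, ipNl, ipNr, ipZl, ipZr, ip0l, ip0r).

Lemma ip_suml I r (P : pred I) (F : I -> H) w :
  ip (\sum_(i <- r | P i) F i) w = \sum_(i <- r | P i) ip (F i) w.
Proof. by apply: (big_morph (ip^~ w)) => [? ?|]; rewrite ?ipDl ?ip0l. Qed.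

Lemma ip_sumr I r (P : pred I) (F : I -> H) w :
  ip w (\sum_(i <- r | P i) F i) = \sum_(i <- r | P i) ip w (F i).
Proof. by rewrite ipC ip_suml; apply: eq_bigr => i _; rewrite ipC. Qed.

Lemma innerE u w : inner u w = (ip u w) +i* (- ip ('i *: u) w).
Proof. by rewrite ip_i opprK /ip; case: (inner u w). Qed.

Lemma norm_real u : exists2 t : R, 0 <= t & `|u| = t%:C.
Proof.
have := normr_ge0 u; case: (`|u|) => a b; rewrite lecE /= => /andP[/eqP -> h].
by exists a.
Qed.

Lemma ip_norm u : ip u u = (complex.Re `|u|) ^+ 2.
Proof.
rewrite /ip inner_norm; have [t _ ->] := norm_real u.
by rewrite -rmorphXn.
Qed.

Lemma ip_ge0 u : 0 <= ip u u.
Proof. by rewrite ip_norm sqr_ge0. Qed.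

Lemma nm_ge0 u : 0 <= nm u. Proof. exact: sqrtr_ge0. Qed.
Lemma nm2 u : nm u ^+ 2 = ip u u.
Proof. by rewrite sqr_sqrtr // ip_ge0. Qed.

Lemma normE u : `|u| = (nm u)%:C.
Proof.
rewrite /nm ip_norm; have [t t0 ->] := norm_real u.
by rewrite sqrtr_sqr ger0_norm.
Qed.

Lemma nm_eq0 u : nm u = 0 -> u = 0.
Proof. by move=> h; apply: normr0_eq0; rewrite normE h. Qed.

Lemma ip_eq0 u : ip u u = 0 -> u = 0.
Proof. by move=> h; apply: nm_eq0; rewrite /nm h sqrtr0. Qed.

Lemma nm0 : nm 0 = 0. Proof. by rewrite /nm ip0l sqrtr0. Qed.

Lemma ip_inj u v : (forall w, ip u w = ip v w) -> u = v.
Proof.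
move=> h; apply/eqP; rewrite -subr_eq0; apply/eqP/ip_eq0.
by rewrite ipBl h subrr.
Qed.

(** The norm of <v,v> u - <u,v> v is nonnegative. *)
Lemma CS2 u v : ip u v ^+ 2 <= ip u u * ip v v.
Proof.
have [v0|v0] := eqVneq (ip v v) 0.
  by rewrite (ip_eq0 v0) ip0r ip0l mulr0 expr0n.
have vp : 0 < ip v v by rewrite lt_def v0 ip_ge0.
have := ip_ge0 ((ip v v)%:C *: u - (ip u v)%:C *: v).
rewrite !ipE (ipC v u).
move: (ip u u) (ip v v) (ip u v) vp => a b c bp h.
have : 0 <= b * (b * a - c ^+ 2) by nra.
by rewrite pmulr_rge0 // subr_ge0 mulrC.
Qed.

Lemma CS u v : `|ip u v| <= nm u * nm v.
Proof.
by rewrite -(@ler_pXn2r _ 2) ?nnegrE ?mulr_ge0 ?nm_ge0 // exprMn !nm2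
  real_normK ?num_real // CS2.
Qed.

Lemma nmD u v : nm (u + v) <= nm u + nm v.
Proof.
rewrite -(@ler_pXn2r _ 2) ?nnegrE ?addr_ge0 ?nm_ge0 // nm2 !ipE (ipC v u).
have := CS u v; rewrite ler_norml => /andP[_ h].
rewrite -!nm2; nra.
Qed.

Lemma nmZ c u : nm (c *: u) = complex.Re `|c| * nm u.
Proof.
apply: complexI; rewrite rmorphM /= -!normE normrZ; congr (_ * _).
Qed.

Lemma nmZr t u : nm (t%:C *: u) = `|t| * nm u.
Proof. by rewrite nmZ normc_def /= expr0n addr0 sqrtr_sqr. Qed.

Lemma nmN u : nm (- u) = nm u.
Proof. by rewrite /nm ipNl ipNr opprK. Qed.

Lemma nmC u v : nm (u - v) = nm (v - u).
Proof. by rewrite -nmN opprB. Qed.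

Lemma nm_tri v u w : nm (u - w) <= nm (u - v) + nm (v - w).
Proof. by rewrite (le_trans _ (nmD _ _)) // addrA subrK. Qed.

(** Convergence in norm, with the error measured in [R] instead of [R[i]]. *)
Definition slim (x : nat -> H) l := forall e : R, 0 < e ->
  exists N, forall n, (N <= n)%N -> nm (x n - l) <= e.

Lemma small_eq0 (x : R) : 0 <= x -> (forall e, 0 < e -> x <= e) -> x = 0.
Proof.
move=> x0 h; apply/eqP; rewrite eq_le x0 andbT; apply/ler_addgt0Pl => e /h.
by rewrite addr0.
Qed.

Lemma nm_small_eq u v : (forall e : R, 0 < e -> nm (u - v) <= e) -> u = v.
Proof.
move=> h; apply/eqP; rewrite -subr_eq0; apply/eqP/nm_eq0.
by apply: small_eq0 h; exact: nm_ge0.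
Qed.

Lemma slim_uniq x l l' : slim x l -> slim x l' -> l = l'.
Proof.
move=> h h'; apply: nm_small_eq => e e0.
have e2 : 0 < e / 2 by rewrite divr_gt0.
have [N hN] := h _ e2; have [N' hN'] := h' _ e2.
have := hN (maxn N N') (leq_maxl _ _); have := hN' (maxn N N') (leq_maxr _ _).
have := nm_tri (x (maxn N N')) l l'; rewrite (nmC l (x _)).
lra.
Qed.

Lemma slim_eventually x y l N :
  (forall n, (N <= n)%N -> x n = y n) -> slim x l -> slim y l.
Proof.
move=> h hx e /hx[M hM]; exists (maxn N M) => n; rewrite geq_max => /andP[h1 h2].
by rewrite -h // hM.
Qed.

Lemma slim_cst l : slim (fun=> l) l.
Proof. by move=> e e0; exists 0%N => n _; rewrite subrr nm0 ltW. Qed.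

Lemma slimD x y l k : slim x l -> slim y k -> slim (fun n => x n + y n) (l + k).
Proof.
move=> hx hy e e0; have e2 : 0 < e / 2 by rewrite divr_gt0.
have [N hN] := hx _ e2; have [M hM] := hy _ e2.
exists (maxn N M) => n; rewrite geq_max => /andP[h1 h2].
have := hN n h1; have := hM n h2; have := nmD (x n - l) (y n - k).
rewrite opprD addrACA; lra.
Qed.

Lemma slimZ c x l : slim x l -> slim (fun n => c *: x n) (c *: l).
Proof.
move=> hx e e0; set k := complex.Re `|c|.
have k0 : 0 <= k by rewrite /k normc_def /= sqrtr_ge0.
have [|N hN] := hx (e / (k + 1)); first by rewrite divr_gt0 // ltr_wpDl.
exists N => n /hN h; rewrite -scalerBr nmZ -/k.
apply: le_trans (ler_wpM2l k0 h) _; rewrite mulrCA ler_piMr ?(ltW e0) //.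
by rewrite ler_pdivrMr ?ltr_wpDl // mul1r lerDl.
Qed.

Lemma slim_ip x l w : slim x l -> (fun n => ip (x n) w) @ \oo --> ip l w.
Proof.
move=> hx; apply/cvgrPdist_le => e e0.
have [|N hN] := hx (e / (nm w + 1)).
  by rewrite divr_gt0 // ltr_wpDl ?nm_ge0.
exists N => // n /= /hN h; rewrite -ipBl.
apply: le_trans (CS _ _) _; rewrite nmC.
apply: le_trans (ler_wpM2r (nm_ge0 w) h) _.
rewrite -mulrA ler_piMr ?(ltW e0) // mulrC.
by rewrite ler_pdivrMr ?ltr_wpDl ?nm_ge0 // mul1r lerDl.
Qed.

Lemma slim_ipr x l w : slim x l -> (fun n => ip w (x n)) @ \oo --> ip w l.
Proof.
by move=> /(@slim_ip _ _ w); rewrite (ipC l); under eq_fun do rewrite ipC.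
Qed.

(** Completeness of the space, transported to sequences and real errors. *)
Lemma slim_cauchy x :
  (forall e : R, 0 < e -> exists N, forall n m, (N <= n)%N -> (N <= m)%N ->
     nm (x n - x m) <= e) -> exists l, slim x l.
Proof.
move=> hx.
have : cvg (x @ \oo).
  apply: cauchy_cvg; apply/cauchy_ballP => e e0.
  have [t t0 te] : exists2 t : R, 0 < t & e = t%:C.
    by move: e0; case: e => a b; rewrite ltcE /= => /andP[/eqP -> ?]; exists a.
  have [|N hN] := hx (t / 2); first by rewrite divr_gt0.
  near=> p; rewrite -ball_normE /= normE te ltcR.
  apply: (@le_lt_trans _ _ (t / 2)); last by rewrite ltr_pdivrMr // ltr_pMr // ltr1n.
  have [[n hn <-] [m hm <-]] : (x @` [set n | (N <= n)%N]) p.1 /\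
     (x @` [set n | (N <= n)%N]) p.2.
    near: p; exists (x @` [set n | (N <= n)%N], x @` [set n | (N <= n)%N]) => //=.
    by split; exists N => // n /= hn; exists n.
  exact: hN.
move=> /cvg_ex[l hl]; exists l => e e0.
have /cvgrPdist_le/(_ e%:C) := hl; rewrite ltcR e0 => /(_ isT)[N _ hN].
by exists N => n /hN; rewrite normE lecR nmC.
Unshelve. all: end_near.
Qed.

End RealInner.

(** * Bounded and symmetric operators; the Lax-Milgram theorem *)
Section Operators.
Context (R : realType).
Implicit Types (H L K : hilbertType R).

(** Boundedness with a real constant, and between two different spaces, as
    needed for the isometries from a space to its sequences. *)
Definition bop H L (a : H -> L) : Prop :=
  linear a /\ exists2 M : R, 0 <= M & forall u, nm (a u) <= M * nm u.

Definition sym H (a : H -> H) : Prop := forall u v, ip (a u) v = ip u (a v).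

Lemma bop_id H : bop (id : H -> H).
Proof. by split=> //; exists 1 => // u; rewrite mul1r. Qed.

Lemma bop0 H L : bop (0 : H -> L).
Proof.
split; first by move=> c u v; rewrite scaler0 addr0.
by exists 0 => // u; rewrite nm0 mul0r.
Qed.

Lemma bopD H L (a b : H -> L) : bop a -> bop b -> bop (a + b).
Proof.
move=> [la [M M0 hM]] [lb [N N0 hN]]; split.
  by move=> c u v; rewrite !fctE la lb scalerDr addrACA.
exists (M + N); first by rewrite addr_ge0.
by move=> u; rewrite (le_trans (nmD _ _)) // mulrDl lerD.
Qed.

Lemma bopZ H L c (a : H -> L) : bop a -> bop (c *: a).
Proof.
move=> [la [M M0 hM]]; split.
  by move=> k u v; rewrite !fctE la scalerDr !scalerA mulrC.
have k0 : 0 <= complex.Re `|c| by rewrite normc_def /= sqrtr_ge0.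
exists (complex.Re `|c| * M); first by rewrite mulr_ge0.
by move=> u; rewrite nmZ -mulrA ler_wpM2l.
Qed.

Lemma bopN H L (a : H -> L) : bop a -> bop (- a).
Proof. by rewrite -scaleN1r; exact: bopZ. Qed.

Lemma bopB H L (a b : H -> L) : bop a -> bop b -> bop (a - b).
Proof. by move=> ha hb; exact: bopD ha (bopN hb). Qed.

Lemma bop_comp H L K (a : L -> K) (b : H -> L) : bop a -> bop b -> bop (a \o b).
Proof.
move=> [la [M M0 hM]] [lb [N N0 hN]]; split.
  by move=> c u v; rewrite /= lb la.
exists (M * N); first by rewrite mulr_ge0.
by move=> u; rewrite (le_trans (hM _)) // -mulrA ler_wpM2l.
Qed.

Lemma bop_sum H L I r (P : pred I) (F : I -> H -> L) :
  (forall i, P i -> bop (F i)) -> bop (\sum_(i <- r | P i) F i).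
Proof. by move=> h; apply: big_ind => //; [exact: bop0|exact: bopD]. Qed.

Lemma fun_sumE (T : Type) (V : zmodType) I r (P : pred I) (F : I -> T -> V) u :
  (\sum_(i <- r | P i) F i) u = \sum_(i <- r | P i) F i u.
Proof. exact: (big_morph (fun f : T -> V => f u)). Qed.

Lemma bopP H (a : H -> H) : bounded_operator a <-> bop a.
Proof.
split=> [[la [M hM]]|[la [M M0 hM]]]; split=> //.
  exists `|complex.Re M|; first exact: normr_ge0.
  move=> u; have := hM u; rewrite !normE lecE => /andP[_].
  case: (M) => x y /= h; apply: le_trans h _; rewrite mulr0 subr0.
  by rewrite ler_wpM2r ?nm_ge0 // ler_norm.
by exists M%:C => u; rewrite !normE -rmorphM /= lecR.
Qed.

Lemma slim_op H L (a : H -> L) x l : bop a -> slim x l -> slim (a \o x) (a l).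
Proof.
move=> [la [M M0 hM]] hx e e0.
have [|N hN] := hx (e / (M + 1)); first by rewrite divr_gt0 // ltr_wpDl.
exists N => n /hN h; rewrite /= -(linB la); apply: le_trans (hM _) _.
apply: le_trans (ler_wpM2l M0 h) _; rewrite mulrCA ler_piMr ?(ltW e0) //.
by rewrite ler_pdivrMr ?ltr_wpDl // mul1r lerDl.
Qed.

(** A complex scalar moves across the real inner product by conjugation. *)
Lemma ipZC H c (u w : H) : ip (c *: u) w = ip u (c^*%C *: w).
Proof.
rewrite ipC [RHS]ipC [in RHS]/ip linearZl_LR /= [X in _ * X]innerC.
rewrite ipC /ip linearZl_LR /= innerC; case: c (inner w u) => a b [d e] /=.
by rewrite opprK mulrN mulNr opprK.
Qed.

Lemma ip_inner H L (a : H -> L) (b : L -> H) : linear a ->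
  (forall u w, ip (a u) w = ip u (b w)) ->
  forall u w, inner (a u) w = inner u (b w).
Proof. by move=> la h u w; rewrite !innerE h -(linZ la) h. Qed.

(** Minimize J u = <a u, u> - 2 phi u.  Coercivity bounds J below, and the
    parallelogram identity [par] makes a minimizing sequence Cauchy; the first
    variation of J vanishes at its limit.  With a = 1 this is the Riesz
    representation theorem, in general it inverts a coercive operator. *)
Lemma lax_milgram H (a : H -> H) (phi : H -> R) (M d K : R) :
  linear a -> sym a -> (forall u, nm (a u) <= M * nm u) -> 0 < d ->
  (forall u, d * ip u u <= ip (a u) u) ->
  (forall u v, phi (u + v) = phi u + phi v) ->
  (forall t u, phi (t%:C *: u) = t * phi u) ->
  (forall u, `|phi u| <= K * nm u) ->
  exists z, forall u, ip (a z) u = phi u.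
Proof.
move=> la sa bM d0 da phiD phiZ bK.
pose J u := ip (a u) u - 2 * phi u.
have Jlb u : - (K ^+ 2 / d) <= J u.
  rewrite /J; have := da u; have := bK u.
  rewrite -nm2 ler_norml => /andP[_ h1 h2].
  have : 0 <= d * (ip (a u) u - 2 * phi u) + K ^+ 2.
    have : d * (d * nm u ^+ 2) <= d * ip (a u) u by rewrite ler_wpM2l // ltW.
    have : d * phi u <= d * (K * nm u) by rewrite ler_wpM2l // ltW.
    by have := sqr_ge0 (d * nm u - K); nra.
  by move=> h; rewrite -mulNr ler_pdivrMr //; lra.
pose E := [set J u | u in [set: H]].
have hE : has_inf E.
  split; first by exists (J 0), 0.
  by exists (- (K ^+ 2 / d)) => _ [u _ <-].
pose m := inf E.
have mJ u : m <= J u by apply: ge_inf; [case: hE|exists u].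
have /choice[z hz] (n : nat) : exists z, J z < m + n.+1%:R^-1.
  have [|_ [u _ <-] h] := @inf_adherent _ _ n.+1%:R^-1 _ hE; last by exists u.
  by rewrite invr_gt0 ltr0n.
have JZ u v t : J (u + t%:C *: v) =
   J u + 2 * t * (ip (a u) v - phi v) + t ^+ 2 * ip (a v) v.
  rewrite /J phiD phiZ (linD la) (linZ la) !ipE (sa v u) (ipC v); ring.
have par u v : J ((2^-1)%:C *: (u + v)) =
    (J u + J v) / 2 - ip (a (u - v)) (u - v) / 4.
  rewrite /J phiZ phiD (linZ la) !(linD la) (linN la) !ipE (sa v u) (ipC v).
  by field.
have [l hl] : exists l, slim z l.
  apply: slim_cauchy => e e0.
  have [N hN] : exists N, forall n, (N <= n)%N -> n.+1%:R^-1 <= d * e ^+ 2 / 4.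
    have q0 : 0 < d * e ^+ 2 / 4 by rewrite !mulr_gt0 // invr_gt0.
    exact: inv_nat_small.
  exists N => n k hn hk.
  rewrite -(@ler_pXn2r _ 2) ?nnegrE ?nm_ge0 ?(ltW e0) // nm2.
  have := par (z n) (z k); have := mJ ((2^-1)%:C *: (z n + z k)).
  have := hz n; have := hz k; have := hN n hn; have := hN k hk.
  have := da (z n - z k).
  move: n.+1%:R^-1 k.+1%:R^-1 (J (z n)) (J (z k)) (J _) (ip _ _) (ip (z n - _) _).
  move=> r1 r2 j1 j2 j3 q1 q2 *.
  rewrite -(ler_pM2l d0); lra.
exists l => u.
have q0 : 0 <= ip (a u) u by apply: le_trans (da u); rewrite mulr_ge0 ?ip_ge0 // ltW.
set c := ip (a l) u - phi u.
(* J (z n + t u) is at least the infimum and J (z n) tends to it. *)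
have ht t : 0 <= 2 * t * c + t ^+ 2 * ip (a u) u.
  have : (fun n => n.+1%:R^-1 + 2 * t * (ip (a (z n)) u - phi u) +
            t ^+ 2 * ip (a u) u) @ \oo -->
         0 + 2 * t * c + t ^+ 2 * ip (a u) u.
    apply: cvgD; last exact: cvg_cst.
    apply: cvgD; first exact: cvg_harmonic.
    apply: cvgMr; apply: cvgB; last exact: cvg_cst.
    by under eq_fun do rewrite sa; rewrite sa; exact: slim_ip.
  rewrite add0r => hc; rewrite -(cvg_lim _ hc) //.
  apply: limr_ge; first exact: cvgP hc.
  apply: nearW => n /=; have := mJ (z n + t%:C *: u); rewrite JZ.
  have := hz n; move: (J _) n.+1%:R^-1 (2 * t * _) (t ^+ 2 * _) => *; lra.
apply/eqP; rewrite -subr_eq0 -/c; apply/eqP.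
set q := ip (a u) u in ht q0.
(* At this t the quadratic is a negative multiple of c ^ 2; the 1 in q + 1
   covers q = 0. *)
have := ht (- c / (q + 1)).
have -> : 2 * (- c / (q + 1)) * c + (- c / (q + 1)) ^+ 2 * q =
   - (c ^+ 2 * (q + 2) / (q + 1) ^+ 2) by field; lra.
rewrite oppr_ge0 => h.
have : c ^+ 2 * (q + 2) / (q + 1) ^+ 2 == 0.
  by rewrite eq_le h /= mulr_ge0 ?invr_ge0 ?sqr_ge0 // mulr_ge0 ?sqr_ge0 // ltW // ltr_wpDl.
rewrite !mulf_eq0 invr_eq0 !expf_eq0 /= => /orP[/orP[/eqP//|]|] /eqP; lra.
Qed.

Lemma riesz_adjoint H (a : H -> H) : bop a ->
  exists2 b, bop b & forall u w, ip (a u) w = ip u (b w).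
Proof.
move=> [la [M M0 hM]].
have /choice[b hb] w : exists z, forall u, ip z u = ip (a u) w.
  have [||||||||z hz] := @lax_milgram H id (fun u => ip (a u) w) 1 1 (M * nm w) => //.
  - by move=> u; rewrite mul1r.
  - by move=> u; rewrite mul1r.
  - by move=> u v; rewrite (linD la) ipDl.
  - by move=> t u; rewrite (linZ la) ipZl.
  - move=> u; rewrite (le_trans (CS _ _)) // mulrAC ler_wpM2r ?nm_ge0 //.
  by exists z.
have hb' u w : ip (a u) w = ip u (b w) by rewrite -hb ipC.
exists b => //; split.
  move=> c u v; apply: ip_inj => w.
  rewrite ipC -hb' ipDr ipDl; congr (_ + _); last by rewrite [RHS]ipC -hb'.
  by rewrite [RHS]ipZC [RHS]ipC -hb' (linZ la) ipZC conjcK.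
exists M => // u.
have [->|n0] := eqVneq (nm (b u)) 0; first by rewrite mulr_ge0 ?nm_ge0.
have np : 0 < nm (b u) by rewrite lt_def n0 nm_ge0.
rewrite -(ler_pM2l np) -expr2 nm2 -hb'.
rewrite (le_trans (ler_norm _)) // (le_trans (CS _ _)) //.
by rewrite mulrA ler_wpM2r ?nm_ge0 // mulrC.
Qed.
End Operators.

(** * Spectrum and numerical range of symmetric operators *)
Section Spectrum.
Context (R : realType).
Implicit Types (H L K : hilbertType R).

(** The real identity between [ip]s upgrades to the complex one by linearity, so
    the real Riesz argument gives the chosen adjoint. *)
Lemma adjointP H (a : H -> H) : bop a ->
  bop (adjoint a) /\ forall u w, ip (a u) w = ip u (adjoint a w).
Proof.
move=> ha; have [b hb hab] := riesz_adjoint ha.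
have : [set b | bounded_operator b /\
    forall u w, inner (a u) w = inner u (b w)] (adjoint a).
  apply: xgetPex; exists b; split; first exact/bopP.
  by apply: ip_inner => //; case: ha.
by move=> [/bopP h1 h2]; split=> // u w; rewrite /ip h2.
Qed.

Lemma adjoint_uniq H (a b : H -> H) : bop a ->
  (forall u w, ip (a u) w = ip u (b w)) -> adjoint a = b.
Proof.
move=> /adjointP[_ h] hb; apply/funext => w; apply: ip_inj => u.
by rewrite ipC -h hb ipC.
Qed.

Lemma selfadjointP H (a : H -> H) : selfadjoint a <-> bop a /\ sym a.
Proof.
split=> [[/bopP ha e]|[ha sa]].
  by split=> // u v; have [_ ->] := adjointP ha; rewrite e.
by split; [exact/bopP|exact: adjoint_uniq].
Qed.

(** [lax_milgram] solves a z = w; coercivity bounds the inverse. *)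
Lemma coercive_inv H (a : H -> H) (d : R) : bop a -> sym a -> 0 < d ->
  (forall u, d * ip u u <= ip (a u) u) ->
  exists b, [/\ bop b, forall u, a (b u) = u & forall u, b (a u) = u].
Proof.
move=> [la [M M0 hM]] sa d0 da.
have inj u : a u = 0 -> u = 0.
  move=> au; apply: ip_eq0; apply/eqP; rewrite eq_le ip_ge0 andbT.
  by rewrite -(ler_pM2l d0) mulr0 (le_trans (da u)) // au ip0l.
have /choice[b hb] w : exists z, a z = w.
  have [||||||||z hz] := @lax_milgram R H a (fun u => ip w u) M d (nm w) => //.
  - by move=> u v; rewrite ipDr.
  - by move=> t u; rewrite ipZr.
  - by move=> u; exact: CS.
  by exists z; exact: ip_inj.
have bK u : b (a u) = u.
  by apply/eqP; rewrite -subr_eq0; apply/eqP/inj; rewrite (linB la) hb subrr.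
exists b; split=> //; split.
  by move=> c u v; rewrite -[RHS]bK la !hb.
exists d^-1; first by rewrite invr_ge0 ltW.
move=> u; rewrite mulrC ler_pdivlMr // mulrC.
have [->|n0] := eqVneq (nm (b u)) 0; first by rewrite mulr0 nm_ge0.
have np : 0 < nm (b u) by rewrite lt_def n0 nm_ge0.
rewrite -(ler_pM2r np) -mulrA -expr2 nm2 (le_trans (da _)) // hb.
by rewrite (le_trans (ler_norm _)) // CS.
Qed.

(** The product a a* is coercive, with constant d ^ 2, because a commutes with
    a*; so a* c with c the inverse of a a* is a right inverse of a, and a left one
    by injectivity. *)
Lemma normal_inv H (a a' : H -> H) (d : R) : bop a -> bop a' ->
  (forall u w, ip (a u) w = ip u (a' w)) ->
  (forall u, a (a' u) = a' (a u)) -> 0 < d ->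
  (forall u, d * nm u <= nm (a u)) ->
  exists b, [/\ bop b, forall u, a (b u) = u & forall u, b (a u) = u].
Proof.
move=> ha ha' adj com d0 da.
have ca : bop (a \o a') by exact: bop_comp.
have sa : sym (a \o a').
  by move=> u v /=; rewrite com ipC -adj ipC adj com.
have [||c [bc c1 c2]] := @coercive_inv H (a \o a') (d ^+ 2) ca sa.
- by rewrite exprn_gt0.
- move=> u /=; rewrite com ipC -adj -!nm2 -exprMn.
  by rewrite ler_pXn2r // ?nnegrE ?nm_ge0 // mulr_ge0 ?nm_ge0 // ltW.
exists (a' \o c); split=> /=; first exact: bop_comp.
  by move=> u; exact: c1.
have inj u : a u = 0 -> u = 0.
  move=> h; apply: nm_eq0; apply/eqP; rewrite eq_le nm_ge0 andbT.
  by rewrite -(ler_pM2l d0) mulr0 (le_trans (da u)) // h nm0.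
move=> u; apply/eqP; rewrite -subr_eq0; apply/eqP/inj.
by case: ha => la _; rewrite (linB la); have /= -> := c1 (a u); rewrite subrr.
Qed.

Definition bnd_below H (x : H -> H) (l : R[i]) : Prop :=
  exists2 d : R, 0 < d & forall u, d * nm u <= nm (x u - l *: u).

Lemma notin_spectrum H (x : H -> H) l : bop x ->
  ~ spectrum x l -> bnd_below x l.
Proof.
move=> bx /contrapT[b [/bopP[lb [M M0 hM]] _ h]].
exists (M + 1)^-1; first by rewrite invr_gt0 ltr_wpDl.
move=> u; rewrite mulrC ler_pdivrMr ?ltr_wpDl //.
have /(congr1 (fun f => f u)) /= := h; rewrite !fctE /= => e.
rewrite -{1}e (le_trans (hM _)) // mulrC ler_wpM2l ?nm_ge0 //.
by rewrite lerDl.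
Qed.

Lemma sym_spectrum H (x : H -> H) l : bop x -> sym x ->
  bnd_below x l -> ~ spectrum x l.
Proof.
move=> bx sx [d d0 hd]; apply; have [lx _] := bx.
have bid := @bop_id R H.
have [|||||b [bb b1 b2]] :=
  @normal_inv H (x - l *: id) (x - l^*%C *: id) d _ _ _ _ d0.
- exact: bopB bx (bopZ _ bid).
- exact: bopB bx (bopZ _ bid).
- by move=> u w; rewrite !fctE !ipE sx -ipZC.
- move=> u; rewrite !fctE /= !(linB lx) !(linZ lx) !scalerBr !scalerA.
  rewrite (mulrC l).
  have E (A B C D : H) : A - B - (C - D) = A - C - (B - D).
    by rewrite !opprD !opprK !addrA (addrAC A).
  exact: E.
- by move=> u; rewrite !fctE; exact: hd.
by exists b; split; [exact/bopP|apply/funext => u; exact: b1|apply/funext => u; exact: b2].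
Qed.

Lemma ip_sym_i H (y : H -> H) u : linear y -> sym y -> ip (y u) ('i *: u) = 0.
Proof.
move=> ly sy; have e : ip ('i *: y u) u = ip (y u) ('i *: u).
  by rewrite -(linZ ly) sy ipC.
move: e; rewrite ipZC.
have -> : ('i : R[i])^*%C = - 'i by apply/eqP; rewrite eq_complex /= oppr0 !eqxx.
rewrite scaleNr ipNr => e; lra.
Qed.

(** For l = s + i t the operators x - s and i t contribute orthogonally:
    |(x - l) u|^2 = |(x - s) u|^2 + t^2 |u|^2, which bounds x - l below. *)
Lemma spectrum_real H (x : H -> H) l : bop x -> sym x ->
  spectrum x l -> l = (complex.Re l)%:C.
Proof.
move=> bx sx hl; apply/eqP; rewrite eq_complex /= eqxx /=; apply: contrapT.
move=> /negP n0; case: l hl n0 => s t /= hl n0.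
have t0 : 0 < `|t| by rewrite normr_gt0.
apply: (sym_spectrum bx sx) hl; exists `|t| => // u; have [lx _] := bx.
rewrite -(@ler_pXn2r _ 2) ?nnegrE ?mulr_ge0 ?nm_ge0 // exprMn !nm2.
have -> : s +i* t = s%:C + t%:C * 'i.
  by apply/eqP; rewrite eq_complex /= !(mulr0, mul0r, mulr1, addr0, subr0, add0r) !eqxx.
rewrite scalerDl -scalerA opprD addrA.
have := @ip_sym_i H (x - s%:C *: id) u.
rewrite !fctE => h; set w := x u - _; have {}h : ip w ('i *: u) = 0.
  apply: h; first by case: (bopB bx (bopZ s%:C (@bop_id R H))).
  by move=> a b; rewrite ?fctE /= !ipE sx.
move: w h => w h; rewrite !ipE (ipC _ w) h.
have -> : ip ('i *: u) ('i *: u) = ip u u.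
  rewrite ipZC scalerA.
  suff -> : ('i : R[i])^*%C * 'i = 1 by rewrite scale1r.
  by apply/eqP; rewrite eq_complex /= !(mulr0, mul0r, mulr1, addr0, subr0, add0r, mulN1r, mulNr, opprK) ?sub0r ?opprK ?oppr0 !eqxx.
rewrite real_normK ?num_real //; have := ip_ge0 w; nra.
Qed.

Definition bnd H (a b : R) (x : H -> H) : Prop :=
  forall u, a * ip u u <= ip (x u) u <= b * ip u u.

Lemma below_bnd_below H (x : H -> H) t d : 0 < d ->
  (forall u, d * ip u u <= `|ip (x u - t%:C *: u) u|) -> bnd_below x t%:C.
Proof.
move=> d0 h; exists d => // u.
have [->|n0] := eqVneq (nm u) 0; first by rewrite mulr0 nm_ge0.
have np : 0 < nm u by rewrite lt_def n0 nm_ge0.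
by rewrite -(ler_pM2r np) -mulrA -expr2 nm2 (le_trans (h u)) // CS.
Qed.

Lemma bnd_spectrum H (x : H -> H) a b t : bop x -> sym x -> bnd a b x ->
  spectrum x t%:C -> a <= t <= b.
Proof.
move=> bx sx hab; apply: contraPP => /negP; rewrite negb_and -!ltNge => h.
apply: sym_spectrum => //; case/orP: h => h.
  apply: (@below_bnd_below _ _ _ (a - t)); first by rewrite subr_gt0.
  move=> u; rewrite (le_trans _ (ler_norm _)) // !ipE mulrBl lerD2r.
  by case/andP: (hab u).
apply: (@below_bnd_below _ _ _ (t - b)); first by rewrite subr_gt0.
move=> u; rewrite -normrN (le_trans _ (ler_norm _)) // !ipE opprB mulrBl lerD2l.
by rewrite lerN2; case/andP: (hab u).
Qed.

Lemma bnd_spectrum_in H (x : H -> H) (I : set R) a b : bop x -> sym x ->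
  is_interval I -> I a -> I b -> bnd a b x -> spectrum_in I x.
Proof.
move=> bx sx hI Ia Ib hab l hl; exists (complex.Re l); last first.
  by rewrite -(spectrum_real bx sx hl).
apply: (hI a b) => //; apply: (bnd_spectrum bx sx hab).
by rewrite -(spectrum_real bx sx hl).
Qed.

Lemma bop_bnd H (x : H -> H) : bop x -> exists2 M, 0 < M & bnd (- M) M x.
Proof.
move=> [_ [M M0 hM]]; exists (M + 1); first by rewrite ltr_wpDl.
move=> u; rewrite mulNr -ler_norml (le_trans (CS _ _)) // -nm2 expr2 mulrA.
by rewrite ler_wpM2r ?nm_ge0 // (le_trans (hM u)) // ler_wpM2r ?nm_ge0 // lerDl.
Qed.

(** Expand 0 <= <y v, v> at v = K u - y u and use <y v, v> <= K |v|^2 at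
    v = y u. *)
Lemma pos_sq H (y : H -> H) (K : R) : linear y -> sym y -> 0 < K ->
  bnd 0 K y -> forall u, ip (y u) (y u) <= K * ip (y u) u.
Proof.
move=> ly sy K0 h u; rewrite -(ler_pM2l K0).
have /andP[+ _] := h (K%:C *: u - y u).
have /andP[_] := h (y u); rewrite (linB ly) (linZ ly) !ipE.
rewrite (sy (y u) u); set p := ip (y u) u; set q := ip (y u) (y u); set r := ip _ _.
nra.
Qed.

(** Let m be the infimum of <x u, u> over unit vectors.  If m were outside the
    spectrum, y = x - m would be bounded below by some d, and [pos_sq] would
    turn d |u| <= |y u| into d ^ 2 / K |u|^2 <= <y u, u>, so that m would
    not be the infimum. *)
Lemma inf_spectrum H (x : H -> H) : bop x -> sym x -> (exists u : H, u <> 0) ->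
  exists2 m, real_spectrum x m & forall u, m * ip u u <= ip (x u) u.
Proof.
move=> bx sx [u0 n0].
have [M M0 hM] := bop_bnd bx; have [lx _] := bx.
pose E := [set ip (x u) u | u in [set u | ip u u = 1]].
have scal u : u <> 0 -> exists2 v, ip v v = 1 & ip (x u) u = ip (x v) v * ip u u.
  move=> un; exists ((nm u)^-1%:C *: u).
    rewrite !ipE mulrA -nm2 -invfM -expr2 mulVf // expf_eq0 /=.
    by apply/eqP => /nm_eq0.
  rewrite (linZ lx) !ipE -nm2; field.
  by apply/eqP => /nm_eq0.
have hE : has_inf E.
  split; first by have [v v1 _] := scal _ n0; exists (ip (x v) v), v.
  by exists (- M) => _ [u /= u1 <-]; have /andP[+ _] := hM u; rewrite u1 mulr1.
pose m := inf E.
have hm u : m * ip u u <= ip (x u) u.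
  have [->|/eqP un] := eqVneq u 0; first by rewrite !ip0r mulr0.
  have [v v1 ->] := scal _ un; rewrite ler_wpM2r ?ip_ge0 //.
  by apply: ge_inf; [case: hE|exists v].
exists m => //; apply: contrapT => /(notin_spectrum bx)[d d0 hd].
pose y := x - m%:C *: id.
have by_ : bop y by exact: bopB bx (bopZ _ (@bop_id R H)).
have sy : sym y by move=> u v; rewrite ?fctE /= !ipE sx.
have [K K0 hK] := bop_bnd by_.
have y0K : bnd 0 K y.
  move=> u; have /andP[_ ->] := hK u; rewrite andbT mul0r ?fctE !ipE subr_ge0.
  exact: hm.
have hy u : d ^+ 2 / K * ip u u <= ip (y u) u.
  rewrite mulrAC ler_pdivrMr // [leRHS]mulrC.
  apply: le_trans (pos_sq (proj1 by_) sy K0 y0K u).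
  rewrite -!nm2 -exprMn ler_pXn2r ?nnegrE ?mulr_ge0 ?nm_ge0 ?(ltW d0) //.
suff : m + d ^+ 2 / K <= m by rewrite gerDl leNgt divr_gt0 // exprn_gt0.
apply: lb_le_inf; first by case: hE.
move=> _ [u /= u1 <-]; have := hy u; rewrite ?fctE /= !ipE u1; lra.
Qed.

Lemma sup_spectrum H (x : H -> H) : bop x -> sym x -> (exists u : H, u <> 0) ->
  exists2 m, real_spectrum x m & forall u, ip (x u) u <= m * ip u u.
Proof.
move=> bx sx n0; have [|m hm h] := @inf_spectrum H (- x) (bopN bx) _ n0.
  by move=> u v; rewrite ?fctE /= ipNl ipNr sx.
exists (- m); last by move=> u; have := h u; rewrite ?fctE /= ipNl; lra.
apply: contrapT => /(notin_spectrum bx)[d d0 hd].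
apply: (sym_spectrum (bopN bx)) hm; first by move=> u v; rewrite ?fctE /= ipNl ipNr sx.
exists d => // u; rewrite (le_trans (hd u)) //.
have -> : (- x) u - m%:C *: u = - (x u - (- m)%:C *: u).
  by rewrite rmorphN /= scaleNr opprK opprD.
by rewrite nmN.
Qed.

(** The extreme points of the numerical range are spectral values. *)
Lemma spectrum_in_bnd H (x : H -> H) (I : set R) : bop x -> sym x ->
  (exists u : H, u <> 0) -> spectrum_in I x ->
  exists a b, [/\ I a, I b & bnd a b x].
Proof.
move=> bx sx n0 hI.
have sI t : real_spectrum x t -> I t by move=> /hI[s Is [<-]].
have [a /sI Ia ha] := inf_spectrum bx sx n0.
have [b /sI Ib hb] := sup_spectrum bx sx n0.
by exists a, b; split=> // u; rewrite ha hb.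
Qed.

(** Polarization at u and the multiple of y u that has the norm of u. *)
Lemma num_radius H (y : H -> H) (e : R) : linear y -> sym y ->
  (forall u, `|ip (y u) u| <= e * ip u u) -> forall u, nm (y u) <= e * nm u.
Proof.
move=> ly sy h u.
have e4 p q : 4 * ip (y p) q <= 2 * e * (ip p p + ip q q).
  have := h (p + q); have := h (p - q); rewrite !ler_norml.
  rewrite !(linD ly) (linN ly) !ipE (sy q p) (ipC q (y p)) (ipC q p).
  move=> /andP[h1 h2] /andP[h3 h4]; lra.
have [y0|n0] := eqVneq (nm (y u)) 0.
  have [u0|un0] := eqVneq (nm u) 0; first by rewrite y0 u0 mulr0.
  have up : 0 < nm u by rewrite lt_def un0 nm_ge0.
  rewrite y0 mulr_ge0 ?nm_ge0 //; have := h u; rewrite (nm_eq0 y0) ip0l normr0.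
  by rewrite pmulr_lge0 // -nm2 exprn_gt0.
have np : 0 < nm (y u) by rewrite lt_def n0 nm_ge0.
have up : 0 < nm u.
  rewrite lt_def nm_ge0 andbT; apply/eqP => /nm_eq0 u0.
  by move: n0; rewrite u0 (lin0 ly) nm0 eqxx.
have := e4 u ((nm u / nm (y u))%:C *: y u); rewrite !ipE -!nm2.
have -> : nm u / nm (y u) * nm (y u) ^+ 2 = nm u * nm (y u) by field.
have -> : nm u / nm (y u) * (nm u * nm (y u)) = nm u ^+ 2 by field.
move=> h4; rewrite -(ler_pM2l up); nra.
Qed.

End Spectrum.

(** * Weierstrass approximation by Bernstein polynomials *)
Section Weierstrass.
Context (R : realType).
Implicit Types (f : R -> R) (g h : nat -> R) (p : {poly R}).

(** The Bernstein polynomial of degree n of the samples g 0, ..., g n, by the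
    Pascal recurrence; positivity and the action on quadratics, all that the
    approximation theorem uses, follow by induction. *)
Fixpoint bern n (g : nat -> R) : {poly R} :=
  if n is n'.+1 then 'X * bern n' (fun k => g k.+1) + (1 - 'X) * bern n' g
  else (g 0%N)%:P.

Lemma bernS n g t : (bern n.+1 g).[t] =
  t * (bern n (fun k => g k.+1)).[t] + (1 - t) * (bern n g).[t].
Proof. by rewrite /= !hornerE. Qed.

Lemma bern_le n g h t : 0 <= t <= 1 -> (forall k, (k <= n)%N -> g k <= h k) ->
  (bern n g).[t] <= (bern n h).[t].
Proof.
move=> /andP[t0 t1]; elim: n g h => [|n IH] g h gh.
  by rewrite /= !hornerE gh.
rewrite !bernS lerD // ler_wpM2l ?subr_ge0 // IH // => k hk; apply: gh => //.
exact: leqW.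
Qed.

(** The first two moments of the binomial distribution. *)
Lemma bern_quad n (a b c t : R) :
  (bern n (fun k => a + b * k%:R + c * k%:R ^+ 2)).[t] =
  a + b * (n%:R * t) + c * (n%:R * t * (1 - t) + (n%:R * t) ^+ 2).
Proof.
elim: n a b c => [|n IH] a b c.
  by rewrite /= hornerC mulr0n !(expr0n, mul0r, mulr0, addr0).
rewrite bernS IH.
have -> : (fun k : nat => a + b * k.+1%:R + c * k.+1%:R ^+ 2) =
  (fun k => (a + b + c) + (b + 2 * c) * k%:R + c * k%:R ^+ 2).
  by apply/funext => k; rewrite -natr1; ring.
rewrite IH -natr1; ring.
Qed.

(** Uniform continuity in the form used with [bern_quad]: far from the diagonal,
    the quadratic term dominates the bounded function f s - f t. *)
Lemma quad_modulus f : {within `[0, 1]%classic, continuous f} -> forall e : R, 0 < e ->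
  exists2 C, 0 <= C & forall s t : R, 0 <= s <= 1 -> 0 <= t <= 1 ->
    `|f s - f t| <= e + C * (s - t) ^+ 2.
Proof.
move=> cf e e0.
have loc (x : R) (d : R) : 0 <= x <= 1 -> 0 < d -> exists2 r : R, 0 < r &
    forall y : R, 0 <= y <= 1 -> `|x - y| < r -> `|f x - f y| <= d.
  move=> x01 d0.
  have /subspace_continuousP/(_ x) := cf; rewrite /= in_itv /= => /(_ x01).
  move=> /cvgrPdist_le/(_ _ d0)[r /= r0 hr]; exists r => // y y01 xy.
  by apply: hr => //=; rewrite ?in_itv.
have cpt := @segment_compact R 0 1; have nc := (compact_near_coveringP _).1 cpt.
have [M hM] : exists M : R, forall s, 0 <= s <= 1 -> `|f s| <= M.
  have := nc _ \oo (fun n (s : R) => 0 <= s <= 1 -> `|f s| <= n%:R) _.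
  move=> []; last first.
    move=> N _ /(_ N (leqnn _)) h; exists N%:R => s s01; exact: h.
  move=> x; rewrite /= in_itv /= => x01; have [r r0 hr] := loc _ _ x01 ltr01.
  near=> y n => /= y01.
  have : `|f x - f y| <= 1.
    by apply: hr => //; near: y; exists r.
  have : `|f x| + 1 <= n%:R by near: n; exact: nbhs_infty_ger.
  have := ler_distD (f x) 0 (f y); rewrite !sub0r !normrN; lra.
have M0 : 0 <= M by rewrite (le_trans _ (hM 0 _)) // lexx ler01.
have := nc _ \oo (fun n (s : R) => 0 <= s <= 1 -> forall t, 0 <= t <= 1 ->
  `|f s - f t| <= e + n%:R * (s - t) ^+ 2) _.
move=> []; last first.
  move=> N _ /(_ N (leqnn _)) h; exists N%:R; first exact: ler0n.
  by move=> s t s01 t01; apply: h => //=; rewrite ?in_itv.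
move=> x; rewrite /= in_itv /= => x01.
have [|r r0 hr] := loc _ (e / 2) x01; first by rewrite divr_gt0.
near=> s n => /= s01 t t01.
have sx : `|x - s| < r / 2 by near: s; exists (r / 2) => //=; rewrite divr_gt0.
have hn : 2 * M / (r / 2) ^+ 2 <= n%:R by near: n; exact: nbhs_infty_ger.
have fs := hr s s01; have [xt|xt] := ltP `|x - t| r.
  have {}fs : `|f x - f s| <= e / 2 by apply: fs; lra.
  have := hr t t01 xt; have := ler_distD (f x) (f s) (f t).
  rewrite (distrC (f s) (f x)); have : 0 <= n%:R * (s - t) ^+ 2 by rewrite mulr_ge0 ?ler0n ?sqr_ge0.
  by lra.
have st : r / 2 <= `|s - t|.
  by have := ler_distD s x t; lra.
have : (r / 2) ^+ 2 <= (s - t) ^+ 2.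
  by rewrite -[leRHS]real_normK ?num_real // ler_pXn2r // nnegrE // ltW // divr_gt0.
move=> st2.
have : 2 * M <= n%:R * (s - t) ^+ 2.
  have q0 : 0 < (r / 2) ^+ 2 by rewrite exprn_gt0 // divr_gt0.
  move: hn; rewrite ler_pdivrMr // => /le_trans; apply.
  by rewrite ler_wpM2l ?ler0n.
have := ler_normB (f s) (f t); have := hM s s01; have := hM t t01; lra.
Unshelve. all: by end_near.
Qed.

(** By [quad_modulus] the samples of f lie between two quadratics around f t,
    whose Bernstein polynomials at t differ from f t by at most
    e / 2 + C t (1 - t) / (n + 1). *)
Lemma weierstrass01 f : {within `[0, 1]%classic, continuous f} ->
  forall e : R, 0 < e ->
  exists p, forall t, 0 <= t <= 1 -> `|f t - p.[t]| <= e.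
Proof.
move=> cf e e0; have e2 : 0 < e / 2 by rewrite divr_gt0.
have [C C0 hC] := quad_modulus cf e2.
have [n hn] : exists n : nat, C * n.+1%:R^-1 <= e / 2.
  have [|n hn] := @inv_nat_small R (e / 2 / (C + 1)).
    by rewrite !divr_gt0 // ltr_wpDl.
  exists n; apply: le_trans (ler_wpM2l C0 (hn n (leqnn n))) _.
  rewrite mulrCA ler_piMr ?(ltW e2) //.
  by rewrite ler_pdivrMr ?ltr_wpDl // mul1r lerDl.
exists (bern n.+1 (fun k => f (k%:R / n.+1%:R))) => t t01.
have n0 : 0 < n.+1%:R :> R by rewrite ltr0n.
have q k : (k <= n.+1)%N ->
   `|f (k%:R / n.+1%:R) - f t| <= e / 2 + C * (k%:R / n.+1%:R - t) ^+ 2.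
  move=> kn; apply: hC => //; rewrite divr_ge0 ?ler0n //=.
  by rewrite ler_pdivrMr // mul1r ler_nat.
have tt : C * (t * (1 - t) / n.+1%:R) <= e / 2.
  apply: le_trans hn; apply: ler_wpM2l => //; rewrite -[leRHS]mul1r.
  by apply: ler_wpM2r; [rewrite invr_ge0 ltW|nra].
(* Hiding n.+1%:R keeps field from normalizing it. *)
have [N EN] : exists N : R, N = n.+1%:R by eexists.
rewrite -!EN in n0 q tt *.
rewrite ler_norml; apply/andP; split.
  have : (bern n.+1 (fun k => f (k%:R / N))).[t] <=
    (bern n.+1 (fun k => (f t + e / 2 + C * t ^+ 2) + (- 2 * C * t / N) * k%:R
       + (C / N ^+ 2) * k%:R ^+ 2)).[t].
    apply: bern_le => // k /q; rewrite ler_norml => /andP[_].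
    move=> /= h; have E : e / 2 + C * (k%:R / N - t) ^+ 2 = 
      e / 2 + C * t ^+ 2 + - 2 * C * t / N * k%:R + C / N ^+ 2 * k%:R ^+ 2.
      by field; rewrite gt_eqF.
    by move: h; rewrite E; lra.
  rewrite bern_quad -EN; have -> : f t + e / 2 + C * t ^+ 2 + - 2 * C * t / N * (N * t) +
    C / N ^+ 2 * (N * t * (1 - t) + (N * t) ^+ 2) = f t + e / 2 + C * (t * (1 - t) / N).
    by field; rewrite gt_eqF.
  lra.
have : (bern n.+1 (fun k => (f t - e / 2 - C * t ^+ 2) + (2 * C * t / N) * k%:R
       + (- C / N ^+ 2) * k%:R ^+ 2)).[t] <= (bern n.+1 (fun k => f (k%:R / N))).[t].
  apply: bern_le => // k /q; rewrite ler_norml => /andP[+ _].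
  move=> /= h; have E : e / 2 + C * (k%:R / N - t) ^+ 2 = 
    e / 2 + C * t ^+ 2 - 2 * C * t / N * k%:R + C / N ^+ 2 * k%:R ^+ 2.
    by field; rewrite gt_eqF.
  by move: h; rewrite E; lra.
rewrite bern_quad -EN; have -> : f t - e / 2 - C * t ^+ 2 + 2 * C * t / N * (N * t) +
  - C / N ^+ 2 * (N * t * (1 - t) + (N * t) ^+ 2) = f t - e / 2 - C * (t * (1 - t) / N).
  by field; rewrite gt_eqF.
lra.
Qed.

Lemma weierstrass f (a b : R) : a < b -> {within `[a, b]%classic, continuous f} ->
  forall e : R, 0 < e ->
  exists p, forall t, a <= t <= b -> `|f t - p.[t]| <= e.
Proof.
move=> ab cf e e0; have ba : 0 < b - a by rewrite subr_gt0.
have [|p hp] := @weierstrass01 (fun s => f (a + (b - a) * s)) _ e e0.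
  apply/subspace_continuousP => x; rewrite /= in_itv /= => x01.
  have /subspace_continuousP/(_ (a + (b - a) * x)) := cf.
  rewrite /= in_itv /= => h; apply/cvgrPdist_le => d d0.
  have /h/cvgrPdist_le/(_ _ d0)[r /= r0 hr] : a <= a + (b - a) * x <= b by nra.
  exists (r / (b - a)); first by rewrite /= divr_gt0.
  move=> y /= xy; rewrite in_itv /= => y01; apply: hr => /=.
    have -> : a + (b - a) * x - (a + (b - a) * y) = (b - a) * (x - y) by ring.
    by rewrite normrM gtr0_norm // mulrC -ltr_pdivlMr.
  by rewrite in_itv /=; nra.
exists (p \Po ((b - a)^-1 *: ('X - a%:P))) => t /andP[ta tb].
rewrite horner_comp !hornerE.
have := hp ((b - a)^-1 * (t - a)); rewrite mulrA divff ?gt_eqF // mul1r.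
rewrite (addrC a) subrK; apply.
apply/andP; split; first by rewrite mulr_ge0 ?invr_ge0 ?subr_ge0 ?(ltW ab).
by rewrite mulrC ler_pdivrMr // mul1r lerD2r.
Qed.

Lemma weierstrass_le f (a b : R) : a <= b -> {within `[a, b]%classic, continuous f} ->
  forall e : R, 0 < e ->
  exists p, forall t, a <= t <= b -> `|f t - p.[t]| <= e.
Proof.
rewrite le_eqVlt => /predU1P[<-|ab] cf e e0; last exact: weierstrass.
exists (f a)%:P => t /le_anti <-.
by rewrite hornerC subrr normr0 ltW.
Qed.

End Weierstrass.

(** * Polynomial and continuous functional calculus *)
Section PolyOperator.
Context (R : realType).
Implicit Types (H L : hilbertType R) (p q : {poly R[i]}).

(** Operators are mere functions, which form no algebra over which polynomials
    could be evaluated. *)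
Definition opoly H p (x : H -> H) : H -> H :=
  fun u => \sum_(i < size p) p`_i *: iter i x u.

(** Any bound on the degree may replace it in the defining sum. *)
Lemma opoly_wide H p (x : H -> H) n u : (size p <= n)%N ->
  opoly p x u = \sum_(i < n) p`_i *: iter i x u.
Proof.
move=> h; rewrite /opoly (big_ord_widen n (fun i => p`_i *: iter i x u)) //.
rewrite big_mkcond /=; apply: eq_bigr => i _; case: ltnP => // hi.
by rewrite nth_default // scale0r.
Qed.

Lemma opolyD H p q (x : H -> H) u : opoly (p + q) x u = opoly p x u + opoly q x u.
Proof.
pose n := maxn (size p) (size q).
rewrite (@opoly_wide H (p + q) x n) ?size_polyD //.
rewrite (@opoly_wide H p x n) ?leq_maxl // (@opoly_wide H q x n) ?leq_maxr //.
by rewrite -big_split /=; apply: eq_bigr => i _; rewrite coefD scalerDl.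
Qed.

Lemma opolyC H c (x : H -> H) u : opoly c%:P x u = c *: u.
Proof.
rewrite (@opoly_wide H c%:P x 1) ?size_polyC ?leq_b1 //.
by rewrite big_ord1 coefC eqxx.
Qed.

Lemma opolyZ H c p (x : H -> H) u : opoly (c *: p) x u = c *: opoly p x u.
Proof.
rewrite (@opoly_wide H (c *: p) x (size p)) ?size_scale_leq // scaler_sumr.
by apply: eq_bigr => i _; rewrite coefZ scalerA.
Qed.

Lemma opolyMX H p (x : H -> H) u : opoly (p * 'X) x u = opoly p x (x u).
Proof.
rewrite (@opoly_wide H (p * 'X) x (size p).+1); last first.
  by rewrite (leq_trans (size_polyMleq _ _)) // size_polyX addn2.
rewrite big_ord_recl coefMX /= scale0r add0r /opoly.
by apply: eq_bigr => i _; rewrite coefMX /= -iterSr.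
Qed.

Lemma opolyMXaddC H p c (x : H -> H) u :
  opoly (p * 'X + c%:P) x u = opoly p x (x u) + c *: u.
Proof. by rewrite opolyD opolyMX opolyC. Qed.

Lemma opoly0 H (x : H -> H) u : opoly 0 x u = 0.
Proof. by rewrite -[0 : {poly _}]/(0%:P) opolyC scale0r. Qed.

Lemma opolyN H p (x : H -> H) u : opoly (- p) x u = - opoly p x u.
Proof. by rewrite -scaleN1r opolyZ scaleN1r. Qed.

Lemma opolyX H (x : H -> H) u : opoly 'X x u = x u.
Proof. by rewrite -['X]mul1r opolyMX -[1]/(1%:P) opolyC scale1r. Qed.

Lemma opoly_inter H L (T : H -> L) (x : H -> H) (y : L -> L) p u :
  linear T -> (forall v, T (x v) = y (T v)) -> T (opoly p x u) = opoly p y (T u).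
Proof.
move=> lT h; elim/poly_ind: p u => [|p c IH] u; first by rewrite !opoly0 (lin0 lT).
by rewrite !opolyMXaddC (linD lT) (linZ lT) IH h.
Qed.

Lemma opoly_comm H (x : H -> H) p u : linear x -> x (opoly p x u) = opoly p x (x u).
Proof. by move=> lx; exact: opoly_inter. Qed.

Lemma opolyM H p q (x : H -> H) u : linear x ->
  opoly (p * q) x u = opoly p x (opoly q x u).
Proof.
move=> lx; elim/poly_ind: p u => [|p c IH] u; first by rewrite mul0r !opoly0.
rewrite mulrDl mulrAC opolyD opolyMX IH opolyMXaddC opoly_comm //; congr (_ + _).
by rewrite mul_polyC opolyZ.
Qed.

Lemma opoly_bop H p (x : H -> H) : bop x -> bop (opoly p x).
Proof.
move=> bx; elim/poly_ind: p => [|p c IH].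
  by have -> : opoly 0 x = 0 :> (H -> H); [apply/funext => u; rewrite opoly0|exact: bop0].
have -> : opoly (p * 'X + c%:P) x = (opoly p x \o x) + c *: id.
  by apply/funext => u; rewrite opolyMXaddC.
by apply: bopD; [exact: bop_comp|apply: bopZ; exact: bop_id].
Qed.

Definition rpoly H (p : {poly R}) (x : H -> H) : H -> H :=
  opoly (map_poly (real_complex R) p) x.

Lemma rpoly_bop H (p : {poly R}) (x : H -> H) : bop x -> bop (rpoly p x).
Proof. exact: opoly_bop. Qed.

Lemma rpolyMXaddC H (p : {poly R}) c (x : H -> H) u :
  rpoly (p * 'X + c%:P) x u = rpoly p x (x u) + c%:C *: u.
Proof. by rewrite /rpoly rmorphD rmorphM /= map_polyX map_polyC opolyMXaddC. Qed.

Lemma rpoly0 H (x : H -> H) u : rpoly 0 x u = 0.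
Proof. by rewrite /rpoly rmorph0 opoly0. Qed.

Lemma rpolyC H c (x : H -> H) u : rpoly c%:P x u = c%:C *: u.
Proof. by rewrite /rpoly map_polyC opolyC. Qed.

Lemma rpolyX H (x : H -> H) u : rpoly 'X x u = x u.
Proof. by rewrite /rpoly map_polyX opolyX. Qed.

Lemma rpolyB H (p q : {poly R}) (x : H -> H) u :
  rpoly (p - q) x u = rpoly p x u - rpoly q x u.
Proof. by rewrite /rpoly rmorphB opolyD opolyN. Qed.

Lemma rpolyD H (p q : {poly R}) (x : H -> H) u :
  rpoly (p + q) x u = rpoly p x u + rpoly q x u.
Proof. by rewrite /rpoly rmorphD opolyD. Qed.

Lemma rpolyM H (p q : {poly R}) (x : H -> H) u : linear x ->
  rpoly (p * q) x u = rpoly p x (rpoly q x u).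
Proof. by move=> lx; rewrite /rpoly rmorphM opolyM. Qed.

Lemma rpoly_lin H (p : {poly R}) (x : H -> H) : linear x -> linear (rpoly p x).
Proof.
move=> lx; elim/poly_ind: p => [|p c IH] k u v; first by rewrite !rpoly0 scaler0 addr0.
by rewrite !rpolyMXaddC lx IH !scalerDr !scalerA mulrC addrACA.
Qed.

Lemma rpoly_sym H (p : {poly R}) (x : H -> H) : linear x -> sym x -> sym (rpoly p x).
Proof.
move=> lx sx; elim/poly_ind: p => [|p c IH] u v.
  by rewrite !rpoly0 ip0l ip0r.
rewrite !rpolyMXaddC !ipE IH sx; congr (ip _ _ + _).
exact: opoly_comm.
Qed.

(** Bounds from below multiply along a factorization. *)
Lemma bnd_below_prod H (x : H -> H) (r : seq R[i]) : linear x ->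
  (forall z, z \in r -> bnd_below x z) ->
  exists2 d : R, 0 < d & forall u, d * nm u <= nm (opoly (\prod_(z <- r) ('X - z%:P)) x u).
Proof.
move=> lx; elim: r => [|z r IH] h.
  exists 1 => // u; rewrite big_nil -[1 : {poly _}]/(1%:P) opolyC scale1r mul1r //.
have [|d d0 hd] := IH; first by move=> w hw; apply: h; rewrite inE hw orbT.
have [|c c0 hc] := h z; first by rewrite inE eqxx.
exists (c * d); first exact: mulr_gt0.
move=> u; rewrite big_cons opolyM //.
set w := opoly _ x u.
have -> : opoly ('X - z%:P) x w = x w - z *: w.
  by rewrite opolyD opolyX opolyN opolyC.
rewrite (le_trans _ (hc w)) // -mulrA ler_wpM2l ?(ltW c0) //.
Qed.

(** The least spectral value m of p(x) is a value of p on the spectrum of x: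
    otherwise all factors x - z in the factorization of p(x) - m over the
    complex numbers are bounded below, hence so is p(x) - m. *)
Lemma rpoly_ge H (x : H -> H) (p : {poly R}) (c : R) : bop x -> sym x ->
  (forall t, real_spectrum x t -> c <= p.[t]) ->
  forall u, c * ip u u <= ip (rpoly p x u) u.
Proof.
move=> bx sx hc; have [lx _] := bx.
have [n0|triv] := pselect (exists u : H, u <> 0); last first.
  move=> u; have -> : u = 0 by apply: contrapT => h; apply: triv; exists u.
  by rewrite !ip0r mulr0.
have by_ := rpoly_bop p bx; have sy := rpoly_sym p lx sx.
have [m hm mle] := inf_spectrum by_ sy n0.
suff cm : c <= m.
  by move=> u; rewrite (le_trans _ (mle u)) // ler_wpM2r ?ip_ge0.
have [t0 ht0 _] := inf_spectrum bx sx n0.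
apply: contrapT => /negP; rewrite -ltNge => mc.
pose q := map_poly (real_complex R) p - m%:C%:P.
have qE (t : R) : q.[t%:C] = (p.[t] - m)%:C.
  by rewrite /q hornerD hornerN hornerC horner_map /= rmorphB.
have q0 : q != 0.
  apply/eqP => e; have := qE t0; rewrite e horner0 => /esym/eqP.
  rewrite (_ : 0 = 0%:C) // (inj_eq (@complexI _)) subr_eq0 => /eqP pm.
  by have := hc _ ht0; rewrite pm leNgt mc.
have [r hr] := closed_field_poly_normal q.
have [z hz|d d0 hd] := @bnd_below_prod H x r lx.
  apply: (notin_spectrum bx) => sz.
  have ze := spectrum_real bx sx sz; rewrite ze in sz hz.
  have : q.[(complex.Re z)%:C] = 0.
    by rewrite hr hornerZ; apply/eqP; rewrite mulf_eq0 -[_.[_] == 0]/(root _ _) root_prod_XsubC hz orbT.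
  rewrite qE => /eqP; rewrite (_ : 0 = 0%:C) // (inj_eq (@complexI _)) subr_eq0 => /eqP pm.
  by have := hc _ sz; rewrite pm leNgt mc.
apply: (sym_spectrum by_ sy) hm.
have lq0 : 0 < complex.Re `|lead_coef q|.
  by rewrite -ltcR RRe_real ?normr_real // normr_gt0 lead_coef_eq0.
exists (complex.Re `|lead_coef q| * d); first exact: mulr_gt0.
move=> u; have -> : rpoly p x u - m%:C *: u = opoly q x u.
  by rewrite /q opolyD opolyN opolyC.
by rewrite [X in opoly X _ _]hr opolyZ nmZ -mulrA ler_wpM2l ?(ltW lq0).
Qed.

Lemma rpoly_norm H (x : H -> H) (p : {poly R}) (c : R) : bop x -> sym x ->
  (forall t, real_spectrum x t -> `|p.[t]| <= c) ->
  forall u, nm (rpoly p x u) <= c * nm u.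
Proof.
move=> bx sx hc; have [lx _] := bx.
apply: num_radius; [by case: (rpoly_bop p bx)|exact: rpoly_sym|].
move=> u; rewrite ler_norml -mulNr; apply/andP; split.
  by apply: rpoly_ge => // t /hc; rewrite ler_norml => /andP[].
rewrite -lerN2 -mulNr -ipNl; have := @rpoly_ge H x (- p) (- c) bx sx.
rewrite /rpoly rmorphN => h; rewrite -opolyN; apply: h => t /hc.
by rewrite hornerN ler_norml lerN2 => /andP[].
Qed.

(** y is f(x): one polynomial approximates f on the spectrum and y in norm,
    within the same error. *)
Definition calc H (x : H -> H) (f : R -> R) (y : H -> H) : Prop :=
  [/\ bop y, sym y & forall e : R, 0 < e -> exists2 p : {poly R},
     forall t, real_spectrum x t -> `|f t - p.[t]| <= e &
     forall u, nm (y u - rpoly p x u) <= e * nm u].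

Lemma calc_poly H (x : H -> H) (p : {poly R}) : bop x -> sym x ->
  calc x (fun t => p.[t]) (rpoly p x).
Proof.
move=> bx sx; split; [exact: rpoly_bop|by apply: rpoly_sym => //; case: bx|].
move=> e e0; exists p => [t _|u]; first by rewrite subrr normr0 ltW.
by rewrite subrr nm0 mulr_ge0 ?nm_ge0 // ltW.
Qed.

Lemma calcD H (x : H -> H) f g y z : calc x f y -> calc x g z ->
  calc x (fun t => f t + g t) (y + z).
Proof.
move=> [by_ sy hy] [bz sz hz]; split; first exact: bopD.
  by move=> u v; rewrite ?fctE /= !ipE sy sz.
move=> e e0; have e2 : 0 < e / 2 by rewrite divr_gt0.
have [p hp1 hp2] := hy _ e2; have [q hq1 hq2] := hz _ e2.
exists (p + q) => [t ht|u].
  rewrite hornerD opprD addrACA (le_trans (ler_normD _ _)) //.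
  by have := hp1 t ht; have := hq1 t ht; lra.
rewrite rpolyD ?fctE opprD addrACA (le_trans (nmD _ _)) //.
by have := hp2 u; have := hq2 u; lra.
Qed.

Lemma calcZ H (x : H -> H) (c : R) f y : calc x f y ->
  calc x (fun t => c * f t) (c%:C *: y).
Proof.
move=> [by_ sy hy]; split; first exact: bopZ.
  by move=> u v; rewrite ?fctE /= !ipE sy.
move=> e e0; have [|p hp1 hp2] := hy (e / (`|c| + 1)).
  by rewrite divr_gt0 // ltr_wpDl.
have ce : `|c| * (e / (`|c| + 1)) <= e.
  rewrite mulrCA ler_piMr ?(ltW e0) // ler_pdivrMr ?ltr_wpDl //.
  by rewrite mul1r lerDl.
exists (c *: p) => [t ht|u].
  rewrite hornerZ -mulrBr normrM; apply: le_trans ce.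
  by rewrite ler_wpM2l // hp1.
have -> : rpoly (c *: p) x u = c%:C *: rpoly p x u.
  by rewrite -mul_polyC /rpoly rmorphM /= map_polyC /= mul_polyC opolyZ.
rewrite ?fctE -scalerBr nmZr (le_trans (ler_wpM2l (normr_ge0 _) (hp2 u))) //.
by rewrite mulrA ler_wpM2r // nm_ge0.
Qed.

Lemma calcB H (x : H -> H) f g y z : calc x f y -> calc x g z ->
  calc x (fun t => f t - g t) (y - z).
Proof.
move=> hy hz; have := calcD hy (calcZ (-1) hz).
have -> : (fun t => f t + -1 * g t) = (fun t => f t - g t).
  by apply/funext => t; rewrite mulN1r.
by rewrite rmorphN /= scaleN1r.
Qed.

Lemma calc_ge H (x : H -> H) f y (c : R) : bop x -> sym x -> calc x f y ->
  (forall t, real_spectrum x t -> c <= f t) ->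
  forall u, c * ip u u <= ip (y u) u.
Proof.
move=> bx sx [_ _ hy] hc u; apply/ler_addgt0Pl => e e0.
have [|p hp1 hp2] := hy (e / (2 * (ip u u + 1))).
  by rewrite divr_gt0 // mulr_gt0 // ltr_wpDl ?ip_ge0.
set d := e / _ in hp1 hp2.
have := @rpoly_ge H x p (c - d) bx sx.
move=> /(_ _ u) h.
have {}h : (c - d) * ip u u <= ip (rpoly p x u) u.
  by apply: h => t ht; have := hc t ht; have := hp1 t ht; rewrite ler_norml; lra.
have := CS (y u - rpoly p x u) u; rewrite ipBl ler_norml => /andP[h1 _].
have h2 : nm (y u - rpoly p x u) * nm u <= d * ip u u.
  by rewrite -nm2 expr2 mulrA ler_wpM2r ?nm_ge0.
have h3 : 2 * (d * ip u u) <= e.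
  have s0 : 0 < ip u u + 1 by rewrite ltr_wpDl ?ip_ge0.
  have -> : 2 * (d * ip u u) = e * (ip u u / (ip u u + 1)).
    by rewrite /d; field; rewrite gt_eqF.
  by rewrite ler_piMr ?(ltW e0) // ler_pdivrMr // mul1r lerDl.
lra.
Qed.

Lemma calc_le H (x : H -> H) f g y z : bop x -> sym x ->
  calc x f y -> calc x g z ->
  (forall t, real_spectrum x t -> f t <= g t) ->
  forall u, ip (y u) u <= ip (z u) u.
Proof.
move=> bx sx hy hz fg u; have := @calc_ge H x _ _ 0 bx sx (calcB hz hy).
by move=> /(_ _ u); rewrite mul0r ?fctE ipBl subr_ge0; apply => t /fg; rewrite subr_ge0.
Qed.

Lemma calc_norm H (x : H -> H) f y (c : R) : bop x -> sym x -> calc x f y ->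
  (forall t, real_spectrum x t -> `|f t| <= c) ->
  forall u, nm (y u) <= c * nm u.
Proof.
move=> bx sx hy hc; have [[ly _] sy _] := hy.
apply: num_radius => // u; rewrite ler_norml -mulNr; apply/andP; split.
  by apply: (calc_ge bx sx hy) => t /hc; rewrite ler_norml => /andP[].
rewrite -lerN2 -mulNr -ipNl.
have := calcZ (-1) hy; rewrite rmorphN /= scaleN1r => hN.
have := calc_ge (c := - c) bx sx hN; apply => t /hc.
by rewrite mulN1r lerN2 ler_norml => /andP[].
Qed.

Lemma calc_eq H (x : H -> H) f g y z : bop x -> sym x ->
  calc x f y -> calc x g z ->
  (forall t, real_spectrum x t -> f t = g t) -> y = z.
Proof.
move=> bx sx hy hz fg; apply/funext => u.
apply/eqP; rewrite -subr_eq0; apply/eqP/nm_eq0/eqP.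
rewrite eq_le nm_ge0 andbT -(mul0r (nm u)).
by apply: (calc_norm bx sx (calcB hy hz)) => t /fg ->; rewrite subrr normr0.
Qed.

(** The factors approximated by p and q commute in the limit since p(x) and
    q(x) do; this makes the product symmetric. *)
Lemma calcM H (x : H -> H) f g y z (M : R) : bop x -> sym x ->
  (forall t, real_spectrum x t -> `|f t| <= M) ->
  (forall t, real_spectrum x t -> `|g t| <= M) ->
  calc x f y -> calc x g z -> calc x (fun t => f t * g t) (y \o z).
Proof.
move=> bx sx fM gM hy hz; have [lx _] := bx.
have [by_ sy ay] := hy; have [bz sz az] := hz.
pose M' := `|M| + 1; have M1 : 0 < M' by rewrite ltr_wpDl.
have MM' : M <= M' by rewrite /M' (le_trans (ler_norm _)) // lerDl.
have appr e : 0 < e -> exists p q : {poly R}, 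
    [/\ forall t, real_spectrum x t -> `|f t * g t - (p * q).[t]| <= e,
        forall u, nm (y (z u) - rpoly p x (rpoly q x u)) <= e * nm u &
        forall u, nm (z (y u) - rpoly q x (rpoly p x u)) <= e * nm u].
  move=> e0; pose d := Num.min 1 (e / (2 * M' + 1)).
  have m0 : 0 < 2 * M' + 1 by rewrite ltr_wpDl // mulr_ge0 // ltW.
  have d0 : 0 < d by rewrite lt_min ltr01 divr_gt0.
  have d1 : d <= 1 by rewrite ge_min lexx.
  have de : (2 * M' + 1) * d <= e.
    by rewrite mulrC -ler_pdivlMr // ge_min lexx orbT.
  have [p hp1 hp2] := ay _ d0; have [q hq1 hq2] := az _ d0.
  have pB t : real_spectrum x t -> `|p.[t]| <= M' + d.
    move=> ht; have := hp1 t ht; have := fM t ht.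
    rewrite !ler_norml => /andP[? ?] /andP[? ?]; lra.
  have qB t : real_spectrum x t -> `|q.[t]| <= M' + d.
    move=> ht; have := hq1 t ht; have := gM t ht.
    rewrite !ler_norml => /andP[? ?] /andP[? ?]; lra.
  have sc : M' * d + d * (M' + d) <= e by apply: le_trans de; nra.
  have prodn (a b : H -> H) (pa pb : {poly R}) : bop a ->
     (forall u, nm (a u) <= M' * nm u) ->
     (forall u, nm (a u - rpoly pa x u) <= d * nm u) ->
     (forall u, nm (b u - rpoly pb x u) <= d * nm u) ->
     (forall t, real_spectrum x t -> `|pb.[t]| <= M' + d) ->
     forall u, nm (a (b u) - rpoly pa x (rpoly pb x u)) <= e * nm u.
    move=> [la _] aM ha hb pbM u; rewrite (le_trans (nm_tri (a (rpoly pb x u)) _ _)) //.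
    have h1 : nm (a (b u) - a (rpoly pb x u)) <= M' * d * nm u.
      rewrite -(linB la) (le_trans (aM _)) // -mulrA ler_wpM2l ?(ltW M1) //.
    have h2 : nm (a (rpoly pb x u) - rpoly pa x (rpoly pb x u)) <= d * (M' + d) * nm u.
      rewrite (le_trans (ha _)) // -mulrA ler_wpM2l ?(ltW d0) //.
      exact: rpoly_norm.
    by apply: le_trans (lerD h1 h2) _; rewrite -mulrDl ler_wpM2r ?nm_ge0.
  have yM u : nm (y u) <= M' * nm u.
    by apply: (calc_norm bx sx hy) => t /fM /le_trans; apply.
  have zM u : nm (z u) <= M' * nm u.
    by apply: (calc_norm bx sx hz) => t /gM /le_trans; apply.
  exists p, q; split; [move=> t ht|exact: prodn|exact: prodn].
  have -> : f t * g t - (p * q).[t] = f t * (g t - q.[t]) + (f t - p.[t]) * q.[t].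
    rewrite hornerM; ring.
  rewrite (le_trans (ler_normD _ _)) // !normrM; apply: le_trans sc; rewrite lerD //.
    by rewrite ler_pM // ?hq1 // (le_trans (fM t ht)).
  by rewrite ler_pM // ?hp1 // qB.
split; first exact: bop_comp.
  have com u : y (z u) = z (y u).
    apply: nm_small_eq => e e0.
    have [|p [q [_ h1 h2]]] := appr (e / (2 * (nm u + 1))).
      by rewrite divr_gt0 // mulr_gt0 // ltr_wpDl ?nm_ge0.
    rewrite (le_trans (nm_tri (rpoly p x (rpoly q x u)) _ _)) //.
    have -> : rpoly p x (rpoly q x u) = rpoly q x (rpoly p x u).
      by rewrite -!rpolyM // mulrC.
    rewrite [X in _ + X]nmC -!rpolyM // mulrC rpolyM //.
    have := h2 u; have := h1 u.
    have -> : rpoly p x (rpoly q x u) = rpoly q x (rpoly p x u).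
      by rewrite -!rpolyM // mulrC.
    have s0 : 0 < nm u + 1 by rewrite ltr_wpDl ?nm_ge0.
    have : 2 * (e / (2 * (nm u + 1)) * nm u) <= e.
      have -> : 2 * (e / (2 * (nm u + 1)) * nm u) = e * (nm u / (nm u + 1)).
        by field; rewrite gt_eqF.
      by rewrite ler_piMr ?(ltW e0) // ler_pdivrMr // mul1r lerDl.
    lra.
  by move=> u v /=; rewrite sy sz com.
move=> e /appr[p [q [h1 h2 _]]]; exists (p * q) => // u.
rewrite rpolyM //; exact: h2.
Qed.

(** By [rpoly_norm], polynomials converging uniformly to f on a segment that
    contains the spectrum give a Cauchy sequence of operators. *)
Lemma calc_exists H (x : H -> H) f (a b : R) : bop x -> sym x -> a <= b ->
  bnd a b x -> {within `[a, b]%classic, continuous f} -> exists y, calc x f y.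
Proof.
move=> bx sx ab xab cf; have [lx _] := bx.
have /choice[p hp] (n : nat) : exists p : {poly R},
    forall t, a <= t <= b -> `|f t - p.[t]| <= n.+1%:R^-1.
  by apply: weierstrass_le; rewrite // invr_gt0 ltr0n.
have sp t : real_spectrum x t -> a <= t <= b by exact: bnd_spectrum.
have dn (n m : nat) u :
    nm (rpoly (p n) x u - rpoly (p m) x u) <= (n.+1%:R^-1 + m.+1%:R^-1) * nm u.
  rewrite -rpolyB; apply: rpoly_norm => // t /sp ht.
  rewrite hornerD hornerN.
  have := hp n t ht; have := hp m t ht.
  have := ler_distD (f t) (p n).[t] (p m).[t]; rewrite (distrC _ (f t)).
  by move: n.+1%:R^-1 m.+1%:R^-1 => q1 q2; lra.
have /choice[y hy] u : exists l, slim (fun n => rpoly (p n) x u) l.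
  apply: slim_cauchy => e e0.
  have s0 : 0 < nm u + 1 by rewrite ltr_wpDl ?nm_ge0.
  have [|N hN] := @inv_nat_small R (e / (2 * (nm u + 1))).
    by rewrite divr_gt0 // mulr_gt0.
  exists N => n m hn hm; apply: le_trans (dn n m u) _.
  have := hN n hn; have := hN m hm => h1 h2.
  apply: (@le_trans _ _ (e / (nm u + 1) * nm u)).
    rewrite ler_wpM2r ?nm_ge0 //; apply: le_trans (lerD h2 h1) _.
    have -> // : e / (2 * (nm u + 1)) + e / (2 * (nm u + 1)) = e / (nm u + 1).
    by field; rewrite gt_eqF.
  by rewrite mulrAC ler_pdivrMr // ler_wpM2l ?(ltW e0) // lerDl.
have yn n u : nm (y u - rpoly (p n) x u) <= n.+1%:R^-1 * nm u.
  apply/ler_addgt0Pl => e e0.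
  have s0 : 0 < nm u + 1 by rewrite ltr_wpDl ?nm_ge0.
  have e2 : 0 < e / 2 by rewrite divr_gt0.
  have [N hN] := hy u _ e2.
  have [|K hK] := @inv_nat_small R (e / 2 / (nm u + 1)); first by rewrite !divr_gt0.
  pose k := maxn N K; have := hN k (leq_maxl _ _); have := hK k (leq_maxr _ _).
  rewrite ler_pdivlMr // => h1 h2; have := dn k n u.
  have := nm_tri (rpoly (p k) x u) (y u) (rpoly (p n) x u).
  have : 0 <= k.+1%:R^-1 :> R by rewrite invr_ge0.
  rewrite (nmC (y u) (rpoly (p k) x u)); have := nm_ge0 u.
  move: h1 h2; move: n.+1%:R^-1 k.+1%:R^-1 => q1 q2; nra.
have ly : linear y.
  move=> c u v; apply: slim_uniq (hy _) _.
  have lp n : linear (rpoly (p n) x) by case: (rpoly_bop (p n) bx).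
  have -> : (fun n => rpoly (p n) x (c *: u + v)) =
    (fun n => c *: rpoly (p n) x u + rpoly (p n) x v).
    by apply/funext => n; rewrite lp.
  exact: slimD (slimZ _ (hy u)) (hy v).
exists y; split.
- split => //; have [lp [M M0 hM]] := rpoly_bop (p 0%N) bx.
  exists (M + 1); first by rewrite addr_ge0.
  move=> u; rewrite mulrDl mul1r; have := yn 0%N u; have := hM u.
  rewrite invr1 mul1r; have := nmD (y u - rpoly (p 0%N) x u) (rpoly (p 0%N) x u).
  rewrite subrK; lra.
- move=> u v; apply: (cvg_unique _ (slim_ip (w := v) (hy u))) => //.
  have -> : (fun n => ip (rpoly (p n) x u) v) = (fun n => ip u (rpoly (p n) x v)).
    by apply/funext => n; rewrite rpoly_sym.
  exact: slim_ipr.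
- move=> e e0; have [N hN] := inv_nat_small e0; exists (p N).
    by move=> t /sp ht; rewrite (le_trans (hp N t ht)) // hN.
  by move=> u; rewrite (le_trans (yn N u)) // ler_wpM2r ?nm_ge0 // hN.
Qed.

End PolyOperator.

(** * The spectral family *)
Section StrongLimits.
Context (R : realType).
Implicit Types (H : hilbertType R).

Lemma qf_inj H (y z : H -> H) : linear y -> linear z -> sym y -> sym z ->
  (forall u, ip (y u) u = ip (z u) u) -> y = z.
Proof.
move=> ly lz sy sz h; apply/funext => u; apply/eqP; rewrite -subr_eq0.
apply/eqP/nm_eq0/eqP; rewrite eq_le nm_ge0 andbT -(mul0r (nm u)).
apply: (@num_radius R H (fun u => y u - z u)).
- by move=> c v w; rewrite ly lz scalerBr opprD addrACA.
- by move=> v w; rewrite ipBl ipBr sy sz.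
- by move=> v; rewrite ipBl h subrr normr0 mul0r.
Qed.

(** A bounded increasing sequence of symmetric operators converges strongly:
    [pos_sq] bounds |T_m u - T_n u|^2 by the increment of <T_n u, u>. *)
Lemma monotone_slim H (T : nat -> H -> H) (u : H) :
  (forall n, linear (T n)) -> (forall n, sym (T n)) ->
  (forall n m, (n <= m)%N -> bnd 0 1 (T m - T n)) ->
  exists l, slim (T^~ u) l.
Proof.
move=> lT sT hT; pose a n := ip (T n u) u.
have D n m : (n <= m)%N -> nm (T m u - T n u) ^+ 2 <= a m - a n.
  move=> nm_; rewrite nm2 /a -ipBl -[leRHS]mul1r.
  apply: (@pos_sq R H (T m - T n)) => //; last exact: hT.
    by move=> c v w; rewrite !fctE lT lT scalerBr opprD addrACA.
  by move=> v w; rewrite ?fctE /= !ipE !sT.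
have a0 m : a m - a 0%N <= ip u u.
  have /andP[_] := hT 0%N m (leq0n _) u.
  by rewrite ?fctE /= ipBl mul1r.
pose E := range a.
have hE : has_sup E.
  split; first by exists (a 0%N), 0%N.
  by exists (ip u u + a 0%N) => _ [n _ <-]; rewrite -lerBlDr.
apply: slim_cauchy => e e0.
have [|_ [N _ <-] hN] := @sup_adherent _ E (e ^+ 2) _ hE; first by rewrite exprn_gt0.
have close n m : (N <= n)%N -> (n <= m)%N -> nm (T m u - T n u) <= e.
  move=> Nn nm_; rewrite -(@ler_pXn2r _ 2) ?nnegrE ?nm_ge0 ?(ltW e0) //.
  rewrite (le_trans (D n m nm_)) //.
  have : a m <= sup E by apply: ub_le_sup; [case: hE|exists m].
  have := D N n Nn; have := sqr_ge0 (nm (T n u - T N u)); lra.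
exists N => n m Nn Nm; have [nm_|/ltnW mn] := leqP n m; last exact: close.
by rewrite nmC; exact: close.
Qed.

Lemma slim_le_nm H (x : nat -> H) l c : slim x l -> (forall n, nm (x n) <= c) -> nm l <= c.
Proof.
move=> hx hc; apply/ler_addgt0Pl => e /hx[N /(_ N (leqnn _)) h].
have := nm_tri (x N) l 0; rewrite !subr0 (nmC l); have := hc N; lra.
Qed.

Lemma strong_lim H (T : nat -> H -> H) (S : H -> H) (K : R) :
  (forall n, bop (T n)) -> (forall n, sym (T n)) ->
  (forall n u, nm (T n u) <= K * nm u) -> (forall u, slim (T^~ u) (S u)) ->
  bop S /\ sym S.
Proof.
move=> bT sT KT hS; split; last first.
  move=> u v; apply: (cvg_unique _ (slim_ip (w := v) (hS u))) => //.
  have -> : (fun n => ip (T n u) v) = (fun n => ip u (T n v)).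
    by apply/funext => n; rewrite sT.
  exact: slim_ipr.
split.
  move=> c u v; apply: slim_uniq (hS _) _.
  have -> : (fun n => T n (c *: u + v)) = (fun n => c *: T n u + T n v).
    by apply/funext => n; case: (bT n) => ->.
  exact: slimD (slimZ _ (hS u)) (hS v).
exists `|K| => // u; apply: slim_le_nm (hS u) _ => n.
by rewrite (le_trans (KT n u)) // ler_wpM2r ?nm_ge0 ?ler_norm.
Qed.

End StrongLimits.

Section Ramp.
Context (R : realType).
Implicit Types (a b t : R).

(** The continuous ramp that is 1 up to a, 0 from b on, and affine between. *)
Definition rmp a b t : R := Num.max 0 (Num.min 1 ((b - t) / (b - a))).

Lemma rmp01 a b t : 0 <= rmp a b t <= 1.
Proof. by rewrite /rmp le_max lexx /= ge_max ler01 ge_min lexx. Qed.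

Lemma rmp1 a b t : a < b -> t <= a -> rmp a b t = 1.
Proof.
move=> ab ta; rewrite /rmp min_l; first by rewrite max_r.
by rewrite ler_pdivlMr ?subr_gt0 // mul1r; lra.
Qed.

Lemma rmp0 a b t : a < b -> b <= t -> rmp a b t = 0.
Proof.
move=> ab ta; rewrite /rmp max_l // ge_min; apply/orP; right.
by rewrite pmulr_lle0 ?invr_gt0 ?subr_gt0 // subr_le0.
Qed.

Lemma rmp_mid a b t : a < b -> a <= t <= b -> rmp a b t = (b - t) / (b - a).
Proof.
move=> ab /andP[ta tb]; have ba : 0 < b - a by rewrite subr_gt0.
rewrite /rmp min_r; last by rewrite ler_pdivrMr // mul1r; lra.
by rewrite max_r // divr_ge0 ?subr_ge0 // ltW.
Qed.

Lemma rmp_lip a b s t : a < b -> `|rmp a b s - rmp a b t| <= `|s - t| / (b - a).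
Proof.
move=> ab; have ba : 0 < b - a by rewrite subr_gt0.
rewrite ler_pdivlMr // -[X in _ * X](gtr0_norm ba) -normrM mulrBl.
have C r : [\/ r <= a /\ rmp a b r * (b - a) = b - a, 
            a <= r <= b /\ rmp a b r * (b - a) = b - r |
            b <= r /\ rmp a b r * (b - a) = 0].
  have [ra|ar] := leP r a; first by constructor 1; rewrite rmp1 // mul1r.
  have [rb|br] := leP r b.
    constructor 2; rewrite rmp_mid ?(ltW ar) // mulfVK // gt_eqF //.
  by constructor 3; rewrite rmp0 ?ltW // mul0r.
have := ler_norm (s - t); have := ler_norm (t - s); rewrite distrC ler_norml.
case: (C s) => -[+ ->]; case: (C t) => -[+ ->];
  do ?[move=> /andP[? ?]|move=> ?]; apply/andP; split; lra.
Qed.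

Lemma rmp_cont a b (A : set R) : a < b -> {within A, continuous (rmp a b)}.
Proof.
move=> ab; apply: continuous_subspaceT => s; apply/cvgrPdist_le => e e0.
have ba : 0 < b - a by rewrite subr_gt0.
exists (e * (b - a)); first by rewrite /= mulr_gt0.
move=> t /= st; rewrite (le_trans (rmp_lip _ _ ab)) // ler_pdivrMr // ltW //.
Qed.
End Ramp.

Section SpectralFamily.
Context (R : realType) (H : hilbertType R) (x : H -> H).
Hypothesis hx : bop x /\ sym x.
Let bx := proj1 hx.
Let sx := proj2 hx.
Implicit Types (a b l m t : R) (u : H).

Lemma rmp_calc a b : a < b -> exists y, calc x (rmp a b) y.
Proof.
move=> ab; have [M M0 hM] := bop_bnd bx.
apply: (@calc_exists R H x _ (- M) M bx sx _ hM); first by lra.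
exact: rmp_cont.
Qed.

Definition hinv n : R := n.+1%:R^-1.

Lemma hinv_gt0 n : 0 < hinv n. Proof. by rewrite invr_gt0 ltr0n. Qed.
Lemma hinvS n : hinv n.+1 < hinv n.
Proof. by rewrite ltf_pV2 ?posrE ?ltr0n // ltr_nat. Qed.
Lemma hinv_le (n m : nat) : (n <= m)%N -> hinv m <= hinv n.
Proof. by move=> nm_; rewrite lef_pV2 ?posrE ?ltr0n // ler_nat. Qed.

Lemma ramp_lt l n : l + hinv n.+1 < l + hinv n.
Proof. by rewrite ltrD2l hinvS. Qed.

(** As n grows these ramps decrease to the indicator of ]-oo, l].  Consecutive
    ones occupy adjacent segments, so each is 1 wherever a later one is not 0:
    products of ramps are again ramps, see [rmpM]. *)
Definition ramp l n := rmp (l + hinv n.+1) (l + hinv n).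
Definition rampop l n : H -> H := xget 0 [set y | calc x (ramp l n) y].

Lemma rampopP l n : calc x (ramp l n) (rampop l n).
Proof.
have [y hy] := rmp_calc (ramp_lt l n).
exact: (@xgetPex _ 0 [set z | calc x (ramp l n) z] (ex_intro _ y hy)).
Qed.

Lemma rampop_bop l n : bop (rampop l n). Proof. by case: (rampopP l n). Qed.
Lemma rampop_sym l n : sym (rampop l n). Proof. by case: (rampopP l n). Qed.
Lemma calc_rmp_bnd a b y u : calc x (rmp a b) y -> 0 <= ip (y u) u <= ip u u.
Proof.
move=> hy; apply/andP; split.
  have := @calc_ge R H x _ _ 0 bx sx hy; rewrite -[X in X <= _](mul0r (ip u u)).
  by apply=> t _; case/andP: (rmp01 a b t).
have h1 := calc_poly 1 bx sx.
have -> : ip u u = ip (rpoly 1 x u) u by rewrite -[1]/(1%:P) rpolyC scale1r.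
by apply: (calc_le bx sx hy h1) => t _; rewrite hornerC; case/andP: (rmp01 a b t).
Qed.

Lemma rmp_le a b a' b' t : a < b -> a' < b' -> b <= a' -> rmp a b t <= rmp a' b' t.
Proof.
move=> ab ab' ba; have [tb|bt] := leP t b.
  by rewrite [leRHS]rmp1 ?(le_trans tb) //; case/andP: (rmp01 a b t).
rewrite [leLHS]rmp0 //; last exact: ltW.
by case/andP: (rmp01 a' b' t).
Qed.

Lemma rmpM a b a' b' t : a < b -> a' < b' -> b <= a' ->
  rmp a b t * rmp a' b' t = rmp a b t.
Proof.
move=> ab ab' ba; have [tb|bt] := leP t b.
  by rewrite [X in _ * X]rmp1 ?(le_trans tb) // mulr1.
by rewrite rmp0 ?ltW // mul0r.
Qed.

Lemma ramp_le l (n m : nat) t : (n <= m)%N -> ramp l m t <= ramp l n t.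
Proof.
rewrite leq_eqVlt => /predU1P[->//|nm_].
by apply: rmp_le; rewrite ?ramp_lt // lerD2l hinv_le.
Qed.

(** Stated for the opposites, as [monotone_slim] asks for an increasing
    sequence. *)
Lemma rampop_mono l (n m : nat) : (n <= m)%N -> bnd 0 1 (- rampop l m - - rampop l n).
Proof.
move=> nm_ u; rewrite ?fctE opprK addrC !ipE.
have := calc_le bx sx (rampopP l m) (rampopP l n) (fun t _ => ramp_le l t nm_) u.
have /andP[h0 _] := calc_rmp_bnd u (rampopP l m).
have /andP[_ h1] := calc_rmp_bnd u (rampopP l n).
by move=> h; lra.
Qed.

Lemma spec_fam_ex l : exists P : H -> H, forall u, slim ((rampop l)^~ u) (P u).
Proof.
have /choice[P hP] u : exists k, slim ((rampop l)^~ u) k.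
  have [|||k hk] := @monotone_slim R H (fun n => - rampop l n) u.
  - by move=> n; case: (bopN (rampop_bop l n)).
  - by move=> n v w; rewrite ?fctE /= ipNl ipNr rampop_sym.
  - by move=> n m; exact: rampop_mono.
  exists (- k); have := slimZ (-1) hk; rewrite scaleN1r.
  by apply: (slim_eventually (N := 0%N)) => n _; rewrite ?fctE scaleN1r opprK.
by exists P.
Qed.

(** The spectral projection of the half-line ]-oo, l]. *)
Definition spec_fam l : H -> H := projT1 (cid (spec_fam_ex l)).

Lemma spec_famP l u : slim ((rampop l)^~ u) (spec_fam l u).
Proof. exact: (projT2 (cid (spec_fam_ex l))). Qed.

Lemma rampop_nm l n u : nm (rampop l n u) <= 1 * nm u.
Proof.
apply: (calc_norm bx sx (rampopP l n)) => t _.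
by have /andP[h0 h1] := rmp01 (l + hinv n.+1) (l + hinv n) t; rewrite ger0_norm.
Qed.

Lemma spec_fam_bop_sym l : bop (spec_fam l) /\ sym (spec_fam l).
Proof.
exact: (strong_lim (rampop_bop l) (rampop_sym l) (@rampop_nm l) (@spec_famP l)).
Qed.
Lemma spec_fam_bop l : bop (spec_fam l). Proof. by case: (spec_fam_bop_sym l). Qed.
Lemma spec_fam_sym l : sym (spec_fam l). Proof. by case: (spec_fam_bop_sym l). Qed.
Lemma spec_fam_lin l : linear (spec_fam l). Proof. by case: (spec_fam_bop l). Qed.

Lemma spec_fam_uniq l u v N : (forall n, (N <= n)%N -> rampop l n u = v) ->
  spec_fam l u = v.
Proof.
move=> h; apply: slim_uniq (spec_famP l u) _.
by apply: (slim_eventually (N := N)) (slim_cst v) => n /h.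
Qed.

Lemma hinv_small e : 0 < e -> exists N, forall n, (N <= n)%N -> hinv n <= e.
Proof. exact: inv_nat_small. Qed.

Lemma rampopM a b a' n y u : a < b -> a' + hinv n <= a -> calc x (rmp a b) y ->
  rampop a' n (y u) = rampop a' n u.
Proof.
move=> ab h hy; have b1 c d t : real_spectrum x t -> `|rmp c d t| <= 1.
  by move=> _; have /andP[h0 h1] := rmp01 c d t; rewrite ger0_norm.
have hM := calcM bx sx (b1 _ _) (b1 _ _) (rampopP a' n) hy.
rewrite -[LHS]/((rampop a' n \o y) u).
congr (_ u); apply: (calc_eq bx sx hM (rampopP a' n)) => t _.
by apply: rmpM => //; exact: ramp_lt.
Qed.

(** A ramp at l that has become narrow enough absorbs any given ramp at m. *)
Lemma spec_famM l m u : l <= m -> spec_fam l (spec_fam m u) = spec_fam l u.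
Proof.
move=> lm; have step n : spec_fam l (rampop m n u) = spec_fam l u.
  have [N hN] := hinv_small (hinv_gt0 n.+1).
  apply: slim_uniq (spec_famP l _) _.
  apply: (slim_eventually (N := N)) (spec_famP l u) => k /hN hk.
  apply/esym; apply: (rampopM _ (ramp_lt m n) _ (rampopP m n)).
  by rewrite lerD.
apply: slim_uniq (slim_op (spec_fam_bop l) (spec_famP m u)) _.
by apply: (slim_eventually (N := 0%N)) (slim_cst _) => n _ /=; rewrite step.
Qed.

Lemma spec_famMr l m u : l <= m -> spec_fam m (spec_fam l u) = spec_fam l u.
Proof.
move=> lm; apply: ip_inj => w.
by rewrite !spec_fam_sym spec_famM.
Qed.

Lemma spec_fam_min l m u : spec_fam l (spec_fam m u) = spec_fam (Num.min l m) u.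
Proof.
have [lm|ml] := leP l m; first exact: spec_famM.
by apply: spec_famMr; exact: ltW.
Qed.

Lemma spec_fam_below a b l y u : l < a -> a < b -> calc x (rmp a b) y ->
  ip (spec_fam l u) u <= ip (y u) u.
Proof.
move=> la ab hy; have [|N hN] := @hinv_small (a - l); first by rewrite subr_gt0.
have hc := slim_ip (w := u) (spec_famP l u).
rewrite -(cvg_lim _ hc) //; apply: limr_le; first exact: cvgP hc.
exists N => // n /= /hN hn; apply: (calc_le bx sx (rampopP l n) hy) => t _.
by apply: rmp_le; rewrite ?ramp_lt //; lra.
Qed.

Lemma spec_fam_above a b y u : a < b -> calc x (rmp a b) y ->
  ip (y u) u <= ip (spec_fam b u) u.
Proof.
move=> ab hy.
have hc := slim_ip (w := u) (spec_famP b u).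
rewrite -(cvg_lim _ hc) //; apply: limr_ge; first exact: cvgP hc.
apply: nearW => n /=; apply: (calc_le bx sx hy (rampopP b n)) => t _.
by apply: rmp_le; rewrite ?ramp_lt // lerDl ltW // hinv_gt0.
Qed.

(** In a gap of the spectrum, late ramps at l and at m agree on the spectrum. *)
Lemma spec_fam_gap l m g : l < m -> m < g ->
  (forall t, real_spectrum x t -> ~ (l < t < g)) -> spec_fam l = spec_fam m.
Proof.
move=> lm mg gap; apply/funext => u.
have [|N hN] := @hinv_small (g - m); first by rewrite subr_gt0.
apply: slim_uniq (spec_famP l u) _.
apply: (slim_eventually (N := N)) (spec_famP m u) => n /hN hn.
congr (_ u); apply: (calc_eq bx sx (rampopP m n) (rampopP l n)) => t /gap /negP.
have p0 := hinv_gt0 n; have p1 := hinv_gt0 n.+1; have pl := ramp_lt l n; have pm := ramp_lt m n.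
rewrite negb_and -!leNgt => /orP[tl|gt].
  by rewrite /ramp !rmp1 //; lra.
by rewrite /ramp !rmp0 //; lra.
Qed.

Lemma spec_fam0 M l : bnd (- M) M x -> l < - M -> spec_fam l = 0.
Proof.
move=> hM lM; apply/funext => u.
have [|N hN] := @hinv_small (- M - l); first by lra.
apply: (spec_fam_uniq (N := N)) => n /hN hn.
have h0 := calc_poly 0 bx sx.
have -> : rampop l n = rpoly 0 x.
  apply: (calc_eq bx sx (rampopP l n) h0) => t /(bnd_spectrum bx sx hM)/andP[tM _].
  by rewrite horner0 /ramp rmp0 ?ramp_lt //; lra.
by rewrite rpoly0.
Qed.

Lemma spec_fam1 M l : bnd (- M) M x -> M <= l -> spec_fam l = id.
Proof.
move=> hM lM; apply/funext => u.
apply: (spec_fam_uniq (N := 0%N)) => n _.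
have h1 := calc_poly 1 bx sx.
have -> : rampop l n = rpoly 1 x.
  apply: (calc_eq bx sx (rampopP l n) h1) => t /(bnd_spectrum bx sx hM)/andP[_ tM].
  have := hinv_gt0 n.+1.
  by rewrite hornerC /ramp => ?; rewrite rmp1 ?ramp_lt //; lra.
by rewrite -[1]/(1%:P) rpolyC scale1r.
Qed.

Definition specF (u : H) (l : R) : R := ip (spec_fam l u) u.

Lemma specF_diff u l m : l <= m ->
  specF u m - specF u l = ip (spec_fam m u - spec_fam l u) (spec_fam m u - spec_fam l u).
Proof.
move=> lm; rewrite /specF !ipE !spec_fam_sym.
rewrite (spec_famMr _ lm) (spec_famM _ lm) !(spec_famM _ (lexx _)); ring.
Qed.

Lemma specF_nd u : {homo specF u : l m / l <= m}.
Proof. by move=> l m lm; rewrite -subr_ge0 specF_diff // ip_ge0. Qed.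

(** The ramp of index N at l dominates the spectral projection at every point
    below l + 1 / (N + 2), and approaches the one at l. *)
Lemma specF_rc u : right_continuous (specF u).
Proof.
move=> l; apply/cvgrPdist_le => e e0.
have /cvgrPdist_le/(_ _ e0)[N _ /(_ N (leqnn _))/= hN] := slim_ip (w := u) (spec_famP l u).
exists (hinv N.+1); first exact: hinv_gt0.
move=> m /= lm0 lm; rewrite distrC ger0_norm; last first.
  by rewrite subr_ge0 specF_nd // ltW.
have : specF u m <= ip (rampop l N u) u.
  apply: (spec_fam_below _ _ (ramp_lt l N) (rampopP l N)).
  by move: lm0; rewrite distrC gtr0_norm ?subr_gt0 //; lra.
by move: hN; rewrite ler_norml /specF => /andP[? ?] ?; lra.
Qed.

HB.instance Definition _ (u : H) :=
  isCumulative.Build R _ R (specF u) (@specF_nd u) (@specF_rc u).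

End SpectralFamily.

(** * The spectral measure *)
Section SpectralMeasure.
Context (R : realType) (H : hilbertType R) (x : H -> H).
Hypothesis hx : bop x /\ sym x.
Let bx := proj1 hx.
Let sx := proj2 hx.
Implicit Types (a b l t : R) (u : H).
Local Notation TR := (measurableTypeR R).

Definition smeas u : {measure set TR -> \bar R} :=
  lebesgue_stieltjes_measure (specF hx u).

(** The Stieltjes measure gives ]a, b] the increment of [specF]; the next
    lemmas let b, then -a, tend to infinity. *)
Lemma smeas_oc u a b : a <= b ->
  smeas u `]a, b]%classic = (specF hx u b - specF hx u a)%:E.
Proof.
move=> ab; rewrite /smeas /= /lebesgue_stieltjes_measure /measure_extension.
rewrite measurable_mu_extE /=; last exact: is_ocitv.
by rewrite wlength_itv_bnd.
Qed.

Lemma specF_far u : exists N : nat, forall l,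
  (N%:R <= l -> specF hx u l = ip u u) /\ (l <= - N%:R -> specF hx u l = 0).
Proof.
have [M M0 hM] := bop_bnd bx.
exists (Num.bound M).+1 => l; have hb : M < (Num.bound M).+1%:R.
  rewrite -natr1 ltr_wpDr // archi_boundP // ltW //.
split=> hl; rewrite /specF.
  by rewrite (spec_fam1 hx hM) //; lra.
by rewrite (spec_fam0 hx hM) ?ip0l //; lra.
Qed.

Lemma smeas_oy u a : smeas u `]a, +oo[%classic = (ip u u - specF hx u a)%:E.
Proof.
rewrite itv_bndy_bigcup_BRight.
have h := @nondecreasing_cvg_mu _ _ _ (smeas u)
  (fun n => `]a, a + n%:R]%classic).
apply: (cvg_unique _ (h _ _ _)) => //.
- exact: bigcup_measurable.
- move=> n m nm_; apply/subsetPset; apply: subset_itvl.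
  by rewrite bnd_simp lerD2l ler_nat.
- have [N hN] := specF_far u.
  apply: cvg_near_cst; exists (N + Num.bound `|a|)%N => // n /= hn.
  rewrite smeas_oc ?lerDl //; congr (_ - _)%:E.
  apply: (hN _).1; have : (N + Num.bound `|a|)%:R <= n%:R :> R by rewrite ler_nat.
  have := archi_boundP (normr_ge0 a); rewrite natrD; have := ler_normr (- a) `|a|.
  have := ler_norm (- a); rewrite normrN; lra.
Qed.

Lemma smeas_T u : smeas u setT = (ip u u)%:E.
Proof.
rewrite -(bigcup_itvT false false).
have h := @nondecreasing_cvg_mu _ _ _ (smeas u)
  (fun n => `]- n%:R, n%:R]%classic).
apply: (cvg_unique _ (h _ _ _)) => //.
- exact: bigcup_measurable.
- move=> n m nm_; apply/subsetPset; apply: subset_itv.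
    by rewrite bnd_simp lerN2 ler_nat.
  by rewrite bnd_simp ler_nat.
- have [N hN] := specF_far u.
  apply: cvg_near_cst; exists N => // n /= hn.
  rewrite smeas_oc ?ge0_cp // (hN _).1 ?ler_nat // (hN _).2 ?subr0 //.
  by rewrite lerN2 ler_nat.
Qed.

Lemma smeas_le u (A : set TR) : measurable A -> (smeas u A <= (ip u u)%:E)%E.
Proof. by move=> mA; rewrite -smeas_T le_measure ?inE. Qed.

(** e is the operator whose diagonal coefficients are the masses of A, that is,
    the future spectral projection of A. *)
Definition represents (A : set TR) (e : H -> H) : Prop :=
  [/\ bop e, sym e & forall u, smeas u A = (ip (e u) u)%:E].

Lemma represents_uniq A e e' : represents A e -> represents A e' -> e = e'.
Proof.
move=> [[le _] se he] [[le' _] se' he']; apply: qf_inj => // u.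
by apply: EFin_inj; rewrite -he he'.
Qed.

Lemma represents_T : represents setT id.
Proof. by split; [exact: bop_id| |exact: smeas_T]. Qed.

Lemma represents_oy a : represents `]a, +oo[%classic (id - spec_fam hx a).
Proof.
split; first exact: bopB (@bop_id _ _) (spec_fam_bop _ _).
  by move=> u v; rewrite ?fctE /= !ipE spec_fam_sym.
by move=> u; rewrite smeas_oy ?fctE /= ipBl.
Qed.

Lemma represents_C A e : measurable A -> represents A e -> represents (~` A) (id - e).
Proof.
move=> mA [be se he]; split; first exact: bopB (@bop_id _ _) be.
  by move=> u v; rewrite ?fctE /= !ipE se.
move=> u; rewrite ?fctE /= ipBl EFinB -he -smeas_T.
rewrite -setTD measureD ?setTI //.
by rewrite (le_lt_trans (smeas_le _ _)) // ltry.
Qed.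

Lemma represents_D A B e f : measurable A -> measurable B -> A `<=` B ->
  represents A e -> represents B f -> represents (B `\` A) (f - e).
Proof.
move=> mA mB AB [be se he] [bf sf hf]; split; first exact: bopB.
  by move=> u v; rewrite ?fctE /= !ipE se sf.
move=> u; rewrite ?fctE /= ipBl EFinB -he -hf measureD //.
  by rewrite setIC (setIidl AB).
by rewrite (le_lt_trans (smeas_le _ _)) // ltry.
Qed.

(** The partial sums increase and are bounded by 1, so they converge strongly. *)
Lemma represents_bigcup (F : (set TR)^nat) (e : nat -> H -> H) :
  (forall n, measurable (F n)) -> trivIset setT F ->
  (forall n, represents (F n) (e n)) ->
  exists2 f, represents (\bigcup_n F n) f &
    forall u, slim (fun n => \sum_(i < n) e i u) (f u).
Proof.
move=> mF tF he; pose T n := \sum_(i < n) e i.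
have TE n u : T n u = \sum_(i < n) e i u by rewrite /T fun_sumE.
have bT n : bop (T n) by apply: bop_sum => i _; case: (he i).
have lT n : linear (T n) by case: (bT n).
have sT n : sym (T n).
  move=> u v; rewrite !TE ip_suml ip_sumr; apply: eq_bigr => i _.
  by case: (he i) => _ ->.
have mTE n u : (\sum_(0 <= i < n) smeas u (F i))%E = (ip (T n u) u)%:E.
  rewrite TE ip_suml -sumEFin big_mkord; apply: eq_bigr => i _.
  by case: (he i) => _ _ ->.
have mU : measurable (\bigcup_n F n) by exact: bigcup_measurable.
have cT u : (fun n => (ip (T n u) u)%:E) @ \oo --> smeas u (\bigcup_n F n).
  have := @measure_semi_sigma_additive _ _ _ (smeas u) F mF tF mU.
  by under eq_fun do rewrite mTE.
have finU u : smeas u (\bigcup_n F n) \is a fin_num.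
  by rewrite ge0_fin_numE // (le_lt_trans (smeas_le _ _)) // ltry.
have Tmono u n m : (n <= m)%N -> ip (T n u) u <= ip (T m u) u.
  move=> nm_; rewrite -lee_fin -!mTE (big_cat_nat (leq0n n) nm_) //=.
  by rewrite leeDl // sume_ge0.
have Tle u n : ip (T n u) u <= ip u u.
  rewrite -lee_fin -mTE; apply: le_trans (smeas_le u mU).
  rewrite -(cvg_lim _ (cT u)) // mTE; apply: lime_ge; first exact: cvgP (cT u).
  by exists n => // m /= nm_; rewrite lee_fin Tmono.
have T0 u n : 0 <= ip (T n u) u by rewrite -lee_fin -mTE sume_ge0.
have /choice[f hf] u : exists k, slim (T^~ u) k.
  apply: monotone_slim => // n m nm_ v; rewrite ?fctE /= ipBl mul0r mul1r.
  have := Tmono v n m nm_; have := Tle v m; have := T0 v n; lra.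
have nmT n u : nm (T n u) <= 1 * nm u.
  apply: num_radius => // v; rewrite ger0_norm // mul1r; exact: Tle.
have [bf sf] := strong_lim bT sT nmT hf.
exists f; last first.
  by move=> u; apply: (slim_eventually (N := 0%N)) (hf u) => n _; rewrite TE.
split=> // u.
apply: (cvg_unique _ (cT u)) => //.
by apply/cvg_EFin; [exact: nearW|exact: slim_ip].
Qed.

Lemma TR_measurable : (@measurable _ TR) = <<s @measurable_realfun.RGenOInfty.G R >>.
Proof. exact: measurable_realfun.RGenOInfty.measurableE. Qed.

Lemma GOInfty_setI : setI_closed (@measurable_realfun.RGenOInfty.G R).
Proof.
move=> _ _ [a ->] [b ->]; exists (Num.max a b).
apply/seteqP; split=> t /=; rewrite !in_itv /= !andbT gt_max.
  by move=> [-> ->].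
by move=> /andP.
Qed.

(** Dynkin induction from the half-lines ]a, +oo[, stable under intersection. *)
Lemma TR_induction (P : set TR -> Prop) :
  P setT -> (forall a, P `]a, +oo[%classic) ->
  (forall A, measurable A -> P A -> P (~` A)) ->
  (forall F : (set TR)^nat, (forall n, measurable (F n)) -> trivIset setT F ->
     (forall n, P (F n)) -> P (\bigcup_n F n)) ->
  forall A, measurable A -> P A.
Proof.
move=> PT PG PC PU A; rewrite TR_measurable.
apply: (dynkin_induction TR_measurable GOInfty_setI) => //.
by move=> _ [a ->].
Qed.

Lemma represents_ex A : measurable A -> exists e, represents A e.
Proof.
move: A; apply: TR_induction.
- by exists id; exact: represents_T.
- by move=> a; exists (id - spec_fam hx a); exact: represents_oy.
- by move=> A mA [e he]; exists (id - e); exact: represents_C.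
- move=> F mF tF /choice[e he].
  by have [f hf _] := represents_bigcup mF tF he; exists f.
Qed.

Definition sproj (A : set R) : H -> H := xget 0 [set e | measurable (A : set TR) /\ represents A e].

Lemma sprojP (A : set TR) : measurable A -> represents A (sproj A).
Proof.
move=> mA; have [e he] := represents_ex mA.
by have [] := @xgetPex _ 0 [set e | measurable (A : set TR) /\ represents A e]
   (ex_intro _ e (conj mA he)).
Qed.

Lemma sproj_eq (A : set TR) e : measurable A -> represents A e -> sproj A = e.
Proof. by move=> mA he; exact: represents_uniq (sprojP mA) he. Qed.

Lemma sproj_bigcup (F : (set TR)^nat) u :
  (forall n, measurable (F n)) -> trivIset setT F ->
  slim (fun n => \sum_(i < n) sproj (F i) u) (sproj (\bigcup_n F n) u).
Proof.
move=> mF tF; have [f hf h] := represents_bigcup mF tF (fun n => sprojP (mF n)).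
by rewrite (sproj_eq _ hf) //; exact: bigcup_measurable.
Qed.

Lemma sprojT : sproj setT = id.
Proof. exact: sproj_eq represents_T. Qed.

Lemma sprojC (A : set TR) : measurable A -> sproj (~` A) = id - sproj A.
Proof.
move=> mA; apply: sproj_eq; first exact: measurableC.
exact: represents_C (sprojP mA).
Qed.

Lemma sproj_oy a : sproj `]a, +oo[%classic = id - spec_fam hx a.
Proof. by apply: sproj_eq => //; exact: represents_oy. Qed.

Lemma sprojDI (A B : set TR) u : measurable A -> measurable B ->
  sproj (~` A `&` B) u = sproj B u - sproj (A `&` B) u.
Proof.
move=> mA mB; have mI : measurable (A `&` B) by exact: measurableI.
have -> : ~` A `&` B = B `\` (A `&` B).
  by rewrite setDIr setDv setU0 setDE setIC.
rewrite (sproj_eq _ (represents_D mI mB _ (sprojP mI) (sprojP mB))) //.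
  exact: measurableD.
Qed.

Lemma sproj_bigcupI (F : (set TR)^nat) (B : set TR) u :
  (forall n, measurable (F n)) -> measurable B -> trivIset setT F ->
  slim (fun n => \sum_(i < n) sproj (F i `&` B) u) (sproj ((\bigcup_n F n) `&` B) u).
Proof.
move=> mF mB tF; rewrite setI_bigcupl; apply: sproj_bigcup.
  by move=> n; exact: measurableI.
by apply: trivIset_setIr.
Qed.

(** Two inductions on Borel sets, first in A with B a half-line, then in B.  On
    two half-lines the claim is the multiplicativity of the spectral family. *)
Lemma sprojM (A B : set TR) u : measurable A -> measurable B ->
  sproj (A `&` B) u = sproj A (sproj B u).
Proof.
have step1 b (A' : set TR) v : measurable A' ->
    sproj (A' `&` `]b, +oo[%classic) v = sproj A' (sproj `]b, +oo[%classic v).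
  set B' := `]b, +oo[%classic; have mB : measurable (B' : set TR) by exact: measurable_itv.
  move=> mA; move: A' mA v; apply: TR_induction.
  - by move=> v; rewrite setTI sprojT.
  - move=> a v; have -> : `]a, +oo[ `&` B' = `]Num.max a b, +oo[%classic.
      rewrite /B'; apply/seteqP; split=> t /=; rewrite !in_itv /= !andbT gt_max; first by move=> [? ?]; apply/andP.
      by move=> /andP.
    rewrite !sproj_oy ?fctE /=; have ls := spec_fam_lin hx.
    rewrite (linB (ls a)) opprB spec_fam_min; case: (leP a b) => ab.
      by rewrite subrr addr0.
    by rewrite addrA subrK.
  - move=> C mC IH v; rewrite sprojDI // sprojC // IH.
    by rewrite ?fctE.
  - move=> F mF tF IH v.
    apply: slim_uniq (sproj_bigcupI v mF mB tF) _.
    apply: (slim_eventually (N := 0%N)) (sproj_bigcup (sproj B' v) mF tF) => n _.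
    by apply: eq_bigr => i _; rewrite IH.
move=> mA mB; move: B mB u; apply: TR_induction.
- by move=> v; rewrite setIT sprojT.
- by move=> b v; exact: step1.
- move=> C mC IH v; rewrite setIC sprojDI // setIC IH sprojC // ?fctE /=.
  have [[lA _] _ _] := sprojP mA; by rewrite (linB lA).
- move=> F mF tF IH v; rewrite setIC.
  apply: slim_uniq (sproj_bigcupI v mF mA tF) _.
  have [bA _ _] := sprojP mA.
  apply: (slim_eventually (N := 0%N)) (slim_op bA (sproj_bigcup v mF tF)) => n _ /=.
  rewrite (lin_sum (proj1 bA)); apply: eq_bigr => i _.
  by rewrite setIC IH.
Qed.

Lemma sproj_proj (A : set TR) : measurable A -> projection (sproj A).
Proof.
move=> mA; have [bA sA _] := sprojP mA; split; first exact/selfadjointP.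
by apply/funext => u /=; rewrite -sprojM // setIid.
Qed.

Lemma diag_smeas (A : set TR) u : measurable A ->
  diag_measure sproj u A = smeas u A.
Proof. by move=> /sprojP[_ _ ->]. Qed.

Lemma sproj_additive u : semi_sigma_additive (diag_measure sproj u).
Proof.
move=> F mF tF mU; rewrite diag_smeas //.
under eq_fun => n do under eq_bigr => i _ do rewrite diag_smeas //.
exact: measure_semi_sigma_additive.
Qed.

End SpectralMeasure.

(** * Support of the spectral measure and recovery of the operator *)
Lemma telescope_ord (V : zmodType) (f : nat -> V) n :
  \sum_(k < n) (f k - f k.+1) = f 0%N - f n.
Proof.
elim: n => [|n IH]; first by rewrite big_ord0 subrr.
by rewrite big_ord_recr /= IH addrA subrK.
Qed.

Section IntegralApprox.
Context (R : realType).
Local Notation TR := (measurableTypeR R).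
Context (m : {measure set TR -> \bar R}) (D : set TR).
Hypothesis mD : measurable D.
Hypothesis fin : (m setT < +oo)%E.

Lemma fin_meas (A : set TR) : measurable A -> (m A < +oo)%E.
Proof. by move=> mA; apply: le_lt_trans fin; rewrite le_measure ?inE. Qed.

Lemma bounded_integrable (g : TR -> R) (K : R) : measurable_fun D g ->
  (forall t, D t -> `|g t| <= K) -> m.-integrable D (EFin \o g).
Proof.
move=> mg hK; apply: measurable_bounded_integrable => //; first exact: fin_meas.
exists K; split; first exact: num_real.
by move=> L KL t Dt /=; exact: le_trans (hK t Dt) (ltW KL).
Qed.

Definition stepf n (c : nat -> R) (A : nat -> set TR) (t : TR) : R :=
  \sum_(k < n) c k * \1_(A k) t.

Lemma stepf_measurable n c A : (forall k, measurable (A k)) ->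
  measurable_fun D (stepf n c A).
Proof.
move=> mA; apply: measurable_sum => k; apply: measurable_funM => //.
Qed.

Lemma stepf_bound n c A t : `|stepf n c A t| <= \sum_(k < n) `|c k|.
Proof.
rewrite (le_trans (ler_norm_sum _ _ _)) //; apply: ler_sum => k _.
rewrite normrM ler_piMr // indicE; case: (t \in _); by rewrite ?normr1 ?normr0.
Qed.

Lemma stepf_integral n c A : (forall k, measurable (A k)) ->
  \int[m]_(t in D) stepf n c A t = \sum_(k < n) c k * fine (m (A k `&` D)).
Proof.
move=> mA; elim: n => [|n IH].
  rewrite big_ord0; under eq_Rintegral do rewrite /stepf big_ord0.
  by rewrite Rintegral_cst // mul0r.
rewrite big_ord_recr /= -IH.
have -> : stepf n.+1 c A = (fun t => stepf n c A t + c n * \1_(A n) t).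
  by apply/funext => t; rewrite /stepf big_ord_recr.
have mi k : measurable_fun D (\1_(A k) : TR -> R) by exact: measurable_indic.
rewrite RintegralD //.
- congr (_ + _); rewrite RintegralZl //; first by rewrite /Rintegral integral_indic.
  apply: (@bounded_integrable _ 1) => // t _.
  by rewrite indicE; case: (t \in _); rewrite ?normr1 ?normr0.
- apply: bounded_integrable; first exact: stepf_measurable.
  by move=> t _; exact: stepf_bound.
- apply: (@bounded_integrable (fun t => c n * \1_(A n) t) `|c n|).
    exact: measurable_funM.
  move=> t _; rewrite normrM ler_piMr // indicE.
  by case: (t \in _); rewrite ?normr1 ?normr0.
Qed.

(** Integrals against the finite measure m are only estimated through step
    functions uniformly close to the integrand. *)
Lemma integral_step_approx n c A (g : TR -> R) (e : R) :
  (forall k, measurable (A k)) -> measurable_fun D g ->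
  (forall t, D t -> `|g t - stepf n c A t| <= e) ->
  `|\int[m]_(t in D) g t - \sum_(k < n) c k * fine (m (A k `&` D))| <= e * fine (m D).
Proof.
move=> mA mg he; rewrite -stepf_integral //.
have ms := stepf_measurable n c mA.
have is_ : m.-integrable D (EFin \o stepf n c A).
  by apply: bounded_integrable ms _ => t _; exact: stepf_bound.
have ig : m.-integrable D (EFin \o g).
  apply: (@bounded_integrable _ (e + \sum_(k < n) `|c k|)) => // t Dt.
  have := he t Dt; have := stepf_bound n c A t.
  have := ler_normD (g t - stepf n c A t) (stepf n c A t); rewrite subrK; lra.
rewrite -RintegralB //.
have mB : measurable_fun D (fun t => g t - stepf n c A t) by exact: measurable_funB.
have iB : m.-integrable D (EFin \o (fun t => g t - stepf n c A t)).
  exact: bounded_integrable he.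
rewrite (le_trans (le_normr_Rintegral _ iB)) // -Rintegral_cst //.
apply: le_Rintegral => //.
  apply: (@bounded_integrable (fun t => `|g t - stepf n c A t|) e).
    exact: measurableT_comp.
  by move=> t Dt; rewrite normr_id he.
by apply: (@bounded_integrable (fun=> e) `|e|).
Qed.

End IntegralApprox.

Section Support.
Context (R : realType) (H : hilbertType R) (x : H -> H).
Hypothesis hx : bop x /\ sym x.
Let bx := proj1 hx.
Let sx := proj2 hx.
Local Notation TR := (measurableTypeR R).
Implicit Types (a b l t : R) (u : H).

Lemma resolvent_open l : ~ real_spectrum x l -> exists2 d : R, 0 < d &
  forall t, `|t - l| < d -> ~ real_spectrum x t.
Proof.
move=> /(notin_spectrum bx)[d d0 hd]; exists (d / 2); first by rewrite divr_gt0.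
move=> t tl; apply: (sym_spectrum bx sx); exists (d / 2); first by rewrite divr_gt0.
move=> u; have := hd u; have := nm_tri (x u - t%:C *: u) (x u - l%:C *: u) 0.
have -> : x u - l%:C *: u - (x u - t%:C *: u) = (t - l)%:C *: u.
  by rewrite opprB addrC addrA subrK rmorphB /= scalerBl.
rewrite !subr0 nmZr; have : `|t - l| * nm u <= d / 2 * nm u.
  by rewrite ler_wpM2r ?nm_ge0 // ltW.
lra.
Qed.

Lemma real_spectrum_measurable : measurable (real_spectrum x : set TR).
Proof.
apply: closed_measurable; rewrite -openC.
rewrite openE => l /= /resolvent_open[d d0 hd].
by exists d => //= t /= ht; apply: hd; rewrite distrC.
Qed.

(** Each point outside the spectrum lies in an interval with rational end points
    inside a gap, which has mass zero by [spec_fam_gap]; these intervals are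
    countably many. *)
Lemma smeas_spectrumC u : smeas hx u (~` real_spectrum x) = 0%E.
Proof.
pose Q (q : rat * rat) : set TR := 
  if `[< (ratr q.1 : R) <= ratr q.2 /\ spec_fam hx (ratr q.1) = spec_fam hx (ratr q.2) >]
  then `](ratr q.1 : R), ratr q.2]%classic else set0.
have Q0 q : smeas hx u (Q q) = 0%E.
  rewrite /Q; case: asboolP => [[q12 e]|_]; last exact: measure0.
  by rewrite smeas_oc // /specF e subrr.
have mQ q : measurable (Q q).
  by rewrite /Q; case: asboolP => _; [exact: measurable_itv|exact: measurable0].
pose G n := odflt set0 (omap Q (unpickle n)).
have GE q : G (pickle q) = Q q by rewrite /G pickleK.
have : (smeas hx u).-negligible (\bigcup_n G n).
  apply: negligible_bigcup => n; rewrite /G; case: unpickle => [q|] /=; last exact: negligible_set0.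
  by exists (Q q); split; [exact: mQ|exact: Q0|].
move=> neg; apply/eqP; rewrite eq_le measure_ge0 andbT.
have mS := real_spectrum_measurable.
have [N [mN N0 hN]] := neg.
rewrite -N0 le_measure ?inE //; first exact: measurableC.
move=> l /= /resolvent_open[d d0 hd]; apply: hN.
have [|q1 /itvP h1] := @rat_in_itvoo R (l - d / 2) l; first by rewrite ltrBlDr ltrDl divr_gt0.
have [|q2 /itvP h2] := @rat_in_itvoo R l (l + d / 2); first by rewrite ltrDl divr_gt0.
have l1 : ratr q1 < l by rewrite h1.
have l2 : l < ratr q2 by rewrite h2.
have l3 : l - d / 2 < ratr q1 by rewrite h1.
have l4 : ratr q2 < l + d / 2 by rewrite h2.
exists (pickle (q1, q2)); first exact: I.
rewrite GE /Q; case: asboolP => [_|].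
  by apply/andP; rewrite bnd_simp; split=> //; exact: ltW.
move=> nh; exfalso; apply: nh; split; first by rewrite ltW // (lt_trans l1).
apply: (spec_fam_gap hx (g := l + d)); [by lra|by lra|].
by move=> t ht /andP[t1 t2]; apply: (hd t) ht; rewrite ltr_norml; apply/andP; split; lra.
Qed.

Lemma sproj_spectrum : sproj hx (real_spectrum x) = id.
Proof.
have mS := real_spectrum_measurable.
have mC := measurableC mS.
have h0 : represents hx (~` real_spectrum x) 0.
  split; first exact: bop0.
    by move=> u v; rewrite ip0l ip0r.
  by move=> u; rewrite smeas_spectrumC ip0l.
by rewrite -[X in sproj _ X]setCK sprojC // (sproj_eq mC h0) subr0.
Qed.

Lemma smeas_spectrumI u (A : set TR) : measurable A ->
  smeas hx u (A `&` real_spectrum x) = smeas hx u A.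
Proof.
move=> mA; have mS := real_spectrum_measurable.
have [_ _ ->] := sprojP hx (measurableI _ _ mA mS).
by rewrite sprojM // sproj_spectrum; have [_ _ ->] := sprojP hx mA.
Qed.

Let abs_sandwich (i p q r s : R) : p <= s -> s <= r -> p <= q -> q <= r ->
  `|i - q - (i - s)| <= r - p.
Proof. by move=> *; rewrite ler_norml; apply/andP; split; lra. Qed.

Let telescope2 (p q r : R) : r - p = - ((p + q) - (q + r)).
Proof. ring. Qed.

Let telescope2_le (i p q r s : R) : 0 <= p -> 0 <= q -> r <= i -> s <= i ->
  - ((p + q) - (r + s)) <= 2 * i.
Proof. by move=> *; lra. Qed.

(** Adjacent ramps of width h, turned upside down and weighted by h, add up to
    the identity. *)
Lemma rmp_sum a h t N : 0 < h -> a <= t ->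
  \sum_(k < N) h * (1 - rmp (a + k%:R * h) (a + k.+1%:R * h) t) =
  Num.min t (a + N%:R * h) - a.
Proof.
move=> h0 ta; elim: N => [|N IH].
  by rewrite big_ord0 mul0r addr0 min_r // subrr.
rewrite big_ord_recr /= IH.
have st : a + N%:R * h < a + N.+1%:R * h by rewrite ltrD2l ltr_pM2r // ltr_nat.
have sd : a + N.+1%:R * h - (a + N%:R * h) = h by rewrite -natr1; ring.
have [t1|t1] := leP t (a + N%:R * h).
  rewrite rmp1 // subrr mulr0 addr0 min_l // (le_trans t1) // ltW //.
have [t2|t2] := leP t (a + N.+1%:R * h).
  rewrite rmp_mid ?(ltW t1) // sd mulrBr mulr1 mulrCA divff ?gt_eqF // mulr1.
  by rewrite -natr1; ring.
by rewrite rmp0 ?(ltW t2) // subr0 mulr1 -natr1; ring.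
Qed.

(** Cut [-M, M] into N steps of width h.  By [rmp_sum], x is a sum of N ramp
    operators; the integral is within h of the same sum with step functions
    instead of ramps.  A ramp lies between the indicators at its two ends, so
    the two sums differ by a telescoping series, of total at most 2 h |u|^2. *)
Lemma spec_integral_id u : ip (x u) u = \int[smeas hx u]_(t in real_spectrum x) t.
Proof.
have mS := real_spectrum_measurable.
have [M M0 hM] := bop_bnd bx.
have fin : (smeas hx u setT < +oo)%E by rewrite smeas_T ltry.
apply/eqP; rewrite -subr_eq0 -normr_eq0; apply/eqP/small_eq0 => // e e0.
have u1 : 0 < ip u u + 1 by rewrite ltr_wpDl // ip_ge0.
have [N0 hN0] : exists N0 : nat, 8 * M * N0.+1%:R^-1 * ip u u <= e.
  have [|N0 /(_ N0 (leqnn _)) hN0] := @inv_nat_small R (e / (8 * M * (ip u u + 1))).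
    by rewrite divr_gt0 // !mulr_gt0.
  exists N0; move: hN0; rewrite ler_pdivlMr ?mulr_gt0 // => hN0.
  apply: le_trans hN0; move: N0.+1%:R^-1 (invr_ge0 (N0.+1%:R : R)) => q.
  rewrite ler0n => q0; have -> : 8 * M * q * ip u u = q * (8 * M * ip u u) by ring.
  by rewrite ler_wpM2l // ler_wpM2l ?lerDl // mulr_ge0 ?(ltW M0).
pose N := N0.+1; pose h := 2 * M / N%:R.
have h0 : 0 < h by rewrite !mulr_gt0 // invr_gt0 ltr0n.
have Nh : N%:R * h = 2 * M by rewrite mulrC mulfVK // pnatr_eq0.
pose t_ (k : R) := - M + k * h.
have tS (k : nat) : t_ k%:R < t_ k.+1%:R by rewrite ltrD2l ltr_pM2r // ltr_nat.
have /choice[y hy] (k : nat) : exists y, calc x (rmp (t_ k%:R) (t_ k.+1%:R)) y.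
  exact: rmp_calc.
have xE : ip (x u) u = - M * ip u u + \sum_(k < N) h * (ip u u - ip (y k u) u).
  have cs n : calc x (fun t => - M + \sum_(k < n) h * (1 - rmp (t_ k%:R) (t_ k.+1%:R) t))
      ((- M)%:C *: id + \sum_(k < n) h%:C *: (id - y k)).
    elim: n => [|n IH].
      rewrite big_ord0 addr0; have := calc_poly (- M)%:P bx sx.
      have -> : rpoly (- M)%:P x = (- M)%:C *: id by apply/funext => v; rewrite rpolyC.
      by congr calc; apply/funext => t; rewrite big_ord0 addr0 hornerC.
    rewrite big_ord_recr addrA /=.
    have c1 : calc x (fun=> 1) id.
      have := calc_poly 1%:P bx sx.
      have -> : rpoly 1%:P x = id by apply/funext => v; rewrite rpolyC scale1r.
      by congr calc; apply/funext => t; rewrite hornerC.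
    have := calcD IH (calcZ h (calcB c1 (hy n))).
    by congr calc; apply/funext => t; rewrite big_ord_recr /= addrA.
  have hX := calc_poly 'X bx sx.
  have -> : x = (- M)%:C *: id + \sum_(k < N) h%:C *: (id - y k).
    have -> : x = rpoly 'X x by apply/funext => v; rewrite rpolyX.
    apply: (calc_eq bx sx hX (cs N)) => t /(bnd_spectrum bx sx hM)/andP[t1 t2].
    rewrite hornerX rmp_sum // Nh min_l; last by lra.
    ring.
  rewrite ?fctE fun_sumE ipDl ipZl ip_suml; congr (_ + _).
  by apply: eq_bigr => k _; rewrite ?fctE ipZl ipBl.
pose F := specF hx u.
(* The function stepf N.+1 c A is -M plus h for each grid point below t. *)
pose A (k : nat) : set TR := if k is k'.+1 then `]t_ k'%:R, +oo[%classic else setT.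
pose c (k : nat) : R := if k is _.+1 then h else - M.
have mA k : measurable (A k) by case: k => [|k]; [exact: measurableT|exact: measurable_itv].
have gs : measurable_fun (real_spectrum x : set TR) (id : TR -> R).
  exact: measurable_id.
have sE t : stepf N.+1 c A t = - M + \sum_(k < N) h * (t_ k%:R < t)%R%:R.
  rewrite /stepf big_ord_recl /= indicE in_setT mulr1; congr (_ + _).
  apply: eq_bigr => k _; congr (_ * _); rewrite /= indicE.
  by rewrite mem_setE in_itv /= andbT.
have app t : real_spectrum x t -> `|t - stepf N.+1 c A t| <= h.
  move=> /(bnd_spectrum bx sx hM)/andP[t1 t2]; rewrite sE.
  have tE : t = - M + \sum_(k < N) h * (1 - rmp (t_ k%:R) (t_ k.+1%:R) t).
    by rewrite rmp_sum // Nh min_l; lra.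
  have up : \sum_(k < N) h * (1 - rmp (t_ k%:R) (t_ k.+1%:R) t) <=
     \sum_(k < N) h * (t_ k%:R < t)%R%:R.
    apply: ler_sum => k _; rewrite ler_wpM2l ?(ltW h0) //.
    case: ltP => tk; rewrite ?mulr1n ?mulr0n; last by rewrite rmp1 // subrr.
    by have /andP[? _] := rmp01 (t_ k%:R) (t_ k.+1%:R) t; lra.
  have low : \sum_(k < N) h * (t_ k.+1%:R < t)%R%:R <=
    \sum_(k < N) h * (1 - rmp (t_ k%:R) (t_ k.+1%:R) t).
    apply: ler_sum => k _; rewrite ler_wpM2l ?(ltW h0) //.
    case: ltP => tk; rewrite ?mulr1n ?mulr0n; first by rewrite rmp0 ?subr0 // ltW.
    by have /andP[_ ?] := rmp01 (t_ k%:R) (t_ k.+1%:R) t; lra.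
  have tel : \sum_(k < N) h * (t_ k%:R < t)%R%:R - \sum_(k < N) h * (t_ k.+1%:R < t)%R%:R <= h.
    rewrite -sumrB; under eq_bigr do rewrite -mulrBr.
    rewrite -mulr_sumr (telescope_ord (fun k => (t_ k%:R < t)%R%:R)) ler_piMr ?(ltW h0) //.
    have b01 (b : bool) : 0 <= (b%:R : R) <= 1 by case: b; rewrite ?ler01 ?lexx.
    have := b01 (t_ 0%:R < t)%R; have := b01 (t_ N%:R < t)%R.
    by move=> /andP[? ?] /andP[? ?]; lra.
  rewrite ler_norml; apply/andP; split; lra.
have := integral_step_approx mS fin mA gs app.
have smE (B : set TR) : measurable B -> fine (smeas hx u (B `&` real_spectrum x)) = fine (smeas hx u B).
  by move=> mB; rewrite smeas_spectrumI.
rewrite big_ord_recl smE //= smeas_T -[X in smeas _ _ X]setTI smE // smeas_T /=.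
have -> : \sum_(k < N) c (bump 0 k) * fine (smeas hx u (A (bump 0 k) `&` real_spectrum x)) =
   \sum_(k < N) h * (ip u u - F (t_ k%:R)).
  by apply: eq_bigr => k _; rewrite smE //= smeas_oy.
set J := Rintegral _ _ _ => hJ.
have dif : `|\sum_(k < N) h * (ip u u - F (t_ k%:R)) - \sum_(k < N) h * (ip u u - ip (y k u) u)|
    <= 2 * h * ip u u.
  rewrite -sumrB (le_trans (ler_norm_sum _ _ _)) //.
  apply: (@le_trans _ _ (\sum_(k < N) h * (F (t_ k.+1%:R) - F (t_ (k%:R - 1))))).
    apply: ler_sum => k _; rewrite -mulrBr normrM gtr0_norm // ler_wpM2l ?(ltW h0) //.
    have lo : F (t_ (k%:R - 1)) <= ip (y k u) u.
      apply: (@spec_fam_below _ _ _ hx _ _ _ _ u _ (tS k) (hy k)).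
      by rewrite ltrD2l ltr_pM2r // gtrBl.
    have hi : ip (y k u) u <= F (t_ k.+1%:R) by exact: (@spec_fam_above _ _ _ hx _ _ _ u (tS k) (hy k)).
    have m1 : F (t_ (k%:R - 1)) <= F (t_ k%:R).
      by apply: specF_nd; rewrite lerD2l ler_pM2r // gerBl.
    have m2 : F (t_ k%:R) <= F (t_ k.+1%:R) by apply: specF_nd; rewrite ltW.
    exact: abs_sandwich.
  have F01 s : 0 <= F s <= ip u u.
    have h1 : (smeas hx u `]s, +oo[%classic <= (ip u u)%:E)%E by exact: smeas_le.
    have h2 : (0 <= smeas hx u `]s, +oo[%classic)%E by exact: measure_ge0.
    rewrite smeas_oy lee_fin in h1; rewrite smeas_oy lee_fin in h2.
    by apply/andP; split; [move: h1|move: h2]; rewrite /F; lra.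
  have -> : 2 * h * ip u u = h * (2 * ip u u) by ring.
  rewrite -mulr_sumr ler_wpM2l ?(ltW h0) //.
  have -> : \sum_(k < N) (F (t_ k.+1%:R) - F (t_ (k%:R - 1))) =
    - \sum_(k < N) ((F (t_ (k%:R - 1)) + F (t_ k%:R)) - (F (t_ (k.+1%:R - 1)) + F (t_ k.+1%:R))).
    rewrite -sumrN; apply: eq_bigr => k _.
    have -> : k.+1%:R - 1 = k%:R :> R by rewrite -natr1 addrK.
    exact: telescope2.
  rewrite (telescope_ord (fun k => F (t_ (k%:R - 1)) + F (t_ k%:R))).
  have Fge s : 0 <= F s by case/andP: (F01 s).
  have Fle s : F s <= ip u u by case/andP: (F01 s).
  exact: telescope2_le.
rewrite xE; apply: le_trans hN0.
have hE : h * ip u u = 2 * M * N%:R^-1 * ip u u by [].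
have -> : 8 * M * N0.+1%:R^-1 * ip u u = 4 * (h * ip u u) by rewrite hE /N; ring.
have hu0 : 0 <= h * ip u u by rewrite mulr_ge0 ?ip_ge0 // ltW.
move: hJ dif; rewrite !ler_norml -mulrA => /andP[? ?] /andP[? ?]; apply/andP; split; lra.
Qed.

End Support.

(** * Any spectral measure computes the continuous functional calculus *)
Section Diagonal.
Import HBNNSimple.
Context (R : realType).
Implicit Types (H : hilbertType R).
Local Notation TR := (measurableTypeR R).

Lemma sym_inner H (y : H -> H) u : linear y -> sym y -> inner (y u) u = (ip (y u) u)%:C.
Proof.
move=> ly sy; rewrite innerE; apply/eqP; rewrite eq_complex /= eqxx /=.
by rewrite -(linZ ly) sy ipC ip_sym_i // oppr0.
Qed.

(** Complex polarization: with w = y - z, both w and i w have zero form, so they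
    are antisymmetric for [ip]; antisymmetry of w at i u makes i w symmetric as
    well, hence zero. *)
Lemma inner_diag_inj H (y z : H -> H) : linear y -> linear z ->
  (forall u, inner (y u) u = inner (z u) u) -> y = z.
Proof.
move=> ly lz h; apply/funext => u0.
have [w wE] : exists w : H -> H, forall u, w u = y u - z u by exists (y - z).
have lw : linear w by move=> c u v; rewrite !wE ly lz scalerBr opprD addrACA.
have h1 u : ip (w u) u = 0 by rewrite wE ipBl /ip h subrr.
have h2 u : ip ('i *: w u) u = 0.
  rewrite wE scalerBr ipBl !ip_i h; lra.
have p1 u v : ip (w u) v + ip (w v) u = 0.
  have := h1 (u + v); rewrite (linD lw) !ipE !h1; lra.
have p2 u v : ip ('i *: w u) v + ip ('i *: w v) u = 0.
  have := h2 (u + v); rewrite (linD lw) scalerDr !ipE !h2; lra.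
apply/eqP; rewrite -subr_eq0; apply/eqP; rewrite -wE.
have iw : 'i *: w u0 = 0.
  apply: ip_inj => v; rewrite ip0l.
  have := p1 v ('i *: u0); rewrite (linZ lw).
  have -> : ip (w v) ('i *: u0) = - ip ('i *: w v) u0.
    rewrite ipZC -[X in _ = X]ipNr -scaleNr; congr (ip _ (_ *: _)).
    by apply/eqP; rewrite eq_complex /= oppr0 opprK !eqxx.
  have := p2 v u0; lra.
have -> : w u0 = (- 'i) *: ('i *: w u0).
  by rewrite scalerA mulNr -expr2 sqr_i opprK scale1r.
by rewrite iw scaler0.
Qed.

(** Integrals only see measurable sets, whereas the function attached to an
    arbitrary spectral measure is unconstrained on the other ones. *)
Lemma integral_eq_on_measurable (mu mu' : set TR -> \bar R) (D : set TR) (f : TR -> \bar R) :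
  (forall A, measurable A -> mu A = mu' A) ->
  (\int[mu]_(t in D) f t = \int[mu']_(t in D) f t)%E.
Proof.
move=> h; rewrite /integral.
have e (g : {nnsfun TR >-> R}) : sintegral mu g = sintegral mu' g.
  by rewrite /sintegral; apply: eq_fsbigr => r _; rewrite h.
by congr (ereal_sup _ - ereal_sup _)%E; apply: eq_imagel => g _; exact: e.
Qed.

End Diagonal.

Section Existence.
Context (R : realType) (H : hilbertType R) (x : H -> H).
Hypothesis hx : bop x /\ sym x.
Local Notation TR := (measurableTypeR R).

Lemma sproj_spectral : is_spectral_measure x (sproj hx).
Proof.
split.
- exact: sproj_proj.
- split; last exact: sprojT.
  apply: sproj_eq; first exact: measurable0.
  split; [exact: bop0|by move=> u v; rewrite ip0l ip0r|].
  by move=> u; rewrite measure0 ip0l.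
- by move=> A B mA mB; apply/funext => u; exact: sprojM.
- exact: sproj_additive.
- split; first exact: sproj_spectrum.
  split; first by apply/bopP; case: hx.
  move=> u; have [[lx _] sx] := hx; rewrite sym_inner // (spec_integral_id hx).
  congr (_%:C); congr fine; apply: integral_eq_on_measurable => A mA.
  by rewrite diag_smeas.
Qed.
End Existence.

Section Perturbation.
Context (R : realType).
Implicit Types (H : hilbertType R) (p : {poly R}).

Lemma rpoly_eigen H (y : H -> H) p t v : linear y -> y v = t%:C *: v ->
  rpoly p y v = p.[t]%:C *: v.
Proof.
move=> ly yv; elim/poly_ind: p => [|p c IH]; first by rewrite rpoly0 horner0 scale0r.
rewrite rpolyMXaddC yv.
by rewrite (linZ (rpoly_lin p ly)) IH hornerMXaddC rmorphD rmorphM /= scalerDl !scalerA mulrC.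
Qed.

(** On operators of norm at most K a polynomial is Lipschitz, as p(x) x - p(y) y
    is p(x) x - p(y) x plus p(y) (x - y).  The bound B is carried along for the
    induction, here and for scalars in [horner_lip]. *)
Lemma rpoly_lip H p (K : R) : 0 <= K -> exists B C : R, [/\ 0 <= B, 0 <= C &
  forall (x y : H -> H) (h : R), linear x -> linear y -> 0 <= h ->
   (forall u, nm (x u) <= K * nm u) -> (forall u, nm (y u) <= K * nm u) ->
   (forall u, nm (x u - y u) <= h * nm u) ->
   forall u, nm (rpoly p y u) <= B * nm u /\
     nm (rpoly p x u - rpoly p y u) <= C * h * nm u].
Proof.
move=> K0; elim/poly_ind: p => [|p c [B [C [B0 C0 IH]]]].
  exists 0, 0; split=> // x y h lx ly h0 hx hy hxy u.
  by rewrite !rpoly0 subrr nm0 !mul0r.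
exists (B * K + `|c|), (C * K + B); split; rewrite ?addr_ge0 ?mulr_ge0 //.
move=> x y h lx ly h0 hx hy hxy u.
have := IH x y h lx ly h0 hx hy hxy => IH'.
rewrite !rpolyMXaddC; split.
  rewrite (le_trans (nmD _ _)) // nmZr mulrDl lerD2r.
  apply: le_trans (proj1 (IH' _)) _; rewrite -mulrA ler_wpM2l //.
have lp := rpoly_lin p ly.
rewrite opprD addrACA subrr addr0 (le_trans (nm_tri (rpoly p y (x u)) _ _)) //.
rewrite -(linB lp) (_ : _ * nm u = C * h * (K * nm u) + B * (h * nm u)); last by ring.
apply: lerD.
  apply: le_trans (proj2 (IH' _)) _; rewrite ler_wpM2l ?mulr_ge0 //.
by apply: le_trans (proj1 (IH' _)) _; rewrite ler_wpM2l.
Qed.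

Lemma horner_lip p (K : R) : 0 <= K -> exists B C : R, [/\ 0 <= B, 0 <= C &
  forall s t, `|s| <= K -> `|t| <= K ->
    `|p.[t]| <= B /\ `|p.[s] - p.[t]| <= C * `|s - t|].
Proof.
move=> K0; elim/poly_ind: p => [|p c [B [C [B0 C0 IH]]]].
  by exists 0, 0; split=> // s t _ _; rewrite !horner0 subrr normr0 mul0r.
exists (B * K + `|c|), (C * K + B); split; rewrite ?addr_ge0 ?mulr_ge0 //.
move=> s t hs ht; have [h1 h2] := IH s t hs ht; rewrite !hornerMXaddC; split.
  by rewrite (le_trans (ler_normD _ _)) // lerD2r normrM ler_pM.
have -> : p.[s] * s + c - (p.[t] * t + c) = (p.[s] - p.[t]) * s + p.[t] * (s - t) by ring.
rewrite (le_trans (ler_normD _ _)) // !normrM mulrDl.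
have -> : C * K * `|s - t| = C * `|s - t| * K by ring.
by rewrite lerD // ?ler_pM // ler_wpM2r.
Qed.

Lemma grid_index (a h t : R) N : 0 < h -> a <= t -> t < a + N%:R * h ->
  exists2 k, (k < N)%N & a + k%:R * h <= t < a + k.+1%:R * h.
Proof.
move=> h0 ta; elim: N => [|N IH] tb; first by rewrite mul0r addr0 ltNge ta in tb.
have [tN|tN] := ltP t (a + N%:R * h).
  by have [k kN hk] := IH tN; exists k => //; exact: ltnW.
by exists N => //; rewrite tN.
Qed.

End Perturbation.

Section AnySpectralMeasure.
Context (R : realType) (H : hilbertType R) (x : H -> H) (E : set R -> (H -> H)).
Hypothesis hx : bop x /\ sym x.
Hypothesis hE : is_spectral_measure x E.
Let bx := proj1 hx.
Let sx := proj2 hx.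
Local Notation TR := (measurableTypeR R).
Implicit Types (A B : set TR) (u v : H).
Local Notation S := (real_spectrum x).

Let E_proj A : measurable A -> [/\ bop (E A), sym (E A) & forall u, E A (E A u) = E A u].
Proof.
case: hE => h _ _ _ _ /h[/selfadjointP[bA sA] e]; split=> // u.
by have := congr1 (fun f => f u) e.
Qed.

Let E_mul A B u : measurable A -> measurable B -> E (A `&` B) u = E A (E B u).
Proof. by case: hE => _ _ h _ _ mA mB; rewrite h. Qed.

Lemma diag_ip A u : diag_measure E u A = (ip (E A u) u)%:E.
Proof. by []. Qed.

Lemma E_ip A u : measurable A -> ip (E A u) u = ip (E A u) (E A u).
Proof. by move=> /E_proj[_ sA iA]; rewrite -[in LHS]iA sA. Qed.

(** Setting the value to 0 off the Borel sets makes it a measure in the sense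
    of a nonnegative total function.  The proof [h] is a parameter so that
    instances can be attached to the definition. *)
Definition dmeas (h : is_spectral_measure x E) u (A : set TR) : \bar R :=
  if `[< measurable A >] then diag_measure E u A else 0%E.

Let dmeasE u A : measurable A -> dmeas hE u A = (ip (E A u) u)%:E.
Proof. by move=> mA; rewrite /dmeas; case: asboolP. Qed.

Let dmeas0 u : dmeas hE u set0 = 0%E.
Proof.
rewrite dmeasE; last exact: measurable0.
by case: hE => _ [-> _] _ _ _; rewrite ip0l.
Qed.

Let dmeas_ge0 u A : (0 <= dmeas hE u A)%E.
Proof.
rewrite /dmeas; case: asboolP => // mA.
by rewrite diag_ip lee_fin E_ip // ip_ge0.
Qed.

Let dmeas_sigma u : semi_sigma_additive (dmeas hE u).
Proof.
move=> F mF tF mU; rewrite dmeasE //.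
under eq_fun => n do under eq_bigr => i _ do rewrite dmeasE //.
by case: hE => _ _ _ h _; exact: h.
Qed.

HB.instance Definition _ u :=
  isMeasure.Build _ _ _ (dmeas hE u) (dmeas0 u) (dmeas_ge0 u) (@dmeas_sigma u).

Let dmu u : {measure set TR -> \bar R} := dmeas hE u.

Lemma dmuT u : dmu u setT = (ip u u)%:E.
Proof.
rewrite /dmu /= dmeasE; last exact: measurableT.
by case: hE => _ [_ ->] _ _ _.
Qed.

Let dmu_fin u : (dmu u setT < +oo)%E. Proof. by rewrite dmuT ltry. Qed.

Let mS : measurable (S : set TR). Proof. exact: real_spectrum_measurable hx. Qed.

Lemma dmuS u A : measurable A -> fine (dmu u (A `&` S)) = ip (E A u) u.
Proof.
move=> mA; rewrite /dmu /= dmeasE; last exact: measurableI.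
by rewrite E_mul //; case: hE => _ _ _ _ [-> _].
Qed.

Lemma dmuSS u : fine (dmu u S) = ip u u.
Proof.
by rewrite -[S]setTI dmuS; [case: hE => _ [_ ->] | exact: measurableT].
Qed.

Lemma dmu_integral u (f : R -> R) :
  \int[dmu u]_(t in (S : set TR)) f t =
  fine (\int[diag_measure E u]_(t in (S : set TR)) (f t)%:E)%E.
Proof.
rewrite /Rintegral; congr fine; apply: integral_eq_on_measurable => A mA.
by rewrite /dmu /= dmeasE.
Qed.

Lemma id_integral u : ip (x u) u = \int[dmu u]_(t in (S : set TR)) t.
Proof.
rewrite dmu_integral; case: hE => _ _ _ _ [_ [_ h]].
by rewrite /ip h.
Qed.

(** Approximate x by xN, the sum of t_k E(A_k) over a partition of the segment
    into cells A_k of length h.  Its eigenspaces are explicit, so p(xN) is the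
    sum of p(t_k) E(A_k), a Riemann sum for the integral of p; and xN is within
    h of x in norm. *)
Section Partition.
Context (a b : R) (N : nat).
Hypothesis xab : bnd a b x.
Hypothesis ab : a < b.
Let h : R := (b - a) / N.+1%:R.
Let t_ (k : nat) : R := a + k%:R * h.
(* Cells k <= N + 1 are used: the last one starts at b. *)
Let A (k : nat) : set TR := `[t_ k, t_ k.+1[%classic.

Let h0 : 0 < h. Proof. by rewrite divr_gt0 ?subr_gt0. Qed.

Let mA k : measurable (A k). Proof. exact: measurable_itv. Qed.

Let A_index t k : A k t -> t_ k <= t < t_ k.+1.
Proof. by rewrite /A /= in_itv. Qed.

Let A_uniq t j k : A j t -> A k t -> j = k.
Proof.
move=> /A_index/andP[j1 j2] /A_index/andP[k1 k2].
have lt (i l : nat) : t_ i < t_ l.+1 -> (i <= l)%N.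
  by rewrite ltrD2l ltr_pM2r // ltr_nat ltnS.
by apply/eqP; rewrite eqn_leq !lt // ?(le_lt_trans j1) // (le_lt_trans k1).
Qed.

Let S_cell t : S t -> exists2 k, (k < N.+2)%N & A k t.
Proof.
move=> /(bnd_spectrum bx sx xab)/andP[ta tb].
have [|k kN hk] := @grid_index R a h t N.+2 h0 ta.
  rewrite (le_lt_trans tb) // -natr1 mulrDl mul1r addrA.
  have -> : a + N.+1%:R * h = b by rewrite /h mulrC mulfVK ?pnatr_eq0 // addrC subrK.
  by rewrite ltrDl.
by exists k => //; rewrite /A /= in_itv.
Qed.

Let step_val (g : R -> R) t k : (k < N.+2)%N -> A k t ->
  stepf N.+2 (fun j => g (t_ j)) A t = g (t_ k).
Proof.
move=> kN kA; rewrite /stepf (bigD1 (Ordinal kN)) //= big1 ?addr0.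
  by rewrite indicE mem_set // mulr1.
move=> j jk; rewrite indicE memNset ?mulr0 // => jA.
by move/eqP: jk; apply; apply/val_inj => /=; exact: A_uniq jA kA.
Qed.

Let step_approx (g : R -> R) (e : R) u : measurable_fun (S : set TR) (g : TR -> R) ->
  (forall s t, S t -> `|t - s| <= h -> a <= s <= t -> `|g t - g s| <= e) ->
  `|\int[dmu u]_(t in (S : set TR)) g t - \sum_(k < N.+2) g (t_ k) * ip (E (A k) u) u|
    <= e * ip u u.
Proof.
move=> mg hg.
have := @integral_step_approx R (dmu u) S mS (dmu_fin u) N.+2 (fun j => g (t_ j)) A g e mA mg.
rewrite dmuSS; under eq_bigr do rewrite dmuS //.
apply=> t St; have [k kN kA] := S_cell St; rewrite (step_val g kN kA).
have /andP[k1 k2] := A_index kA.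
apply: hg => //; first rewrite ger0_norm ?subr_ge0 //.
  by rewrite lerBlDl; move: k2; rewrite /t_ -natr1 mulrDl mul1r addrA => /ltW.
by rewrite k1 andbT lerDl mulr_ge0 // ltW.
Qed.

Let xN : H -> H := \sum_(k < N.+2) (t_ k)%:C *: E (A k).

Let xNE u : xN u = \sum_(k < N.+2) (t_ k)%:C *: E (A k) u.
Proof. by rewrite /xN fun_sumE. Qed.

Let xN_bop : bop xN.
Proof. by apply: bop_sum => k _; apply: bopZ; case: (E_proj (mA k)). Qed.

Let xN_sym : sym xN.
Proof.
move=> u v; rewrite !xNE ip_suml ip_sumr; apply: eq_bigr => k _.
by rewrite ipZl ipZr; case: (E_proj (mA k)) => _ ->.
Qed.

Let xN_close u : nm (x u - xN u) <= h * nm u.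
Proof.
have [lN _] := xN_bop; have [lx _] := bx.
apply: (@num_radius R H (x - xN)).
- by case: (bopB bx xN_bop).
- by move=> v w; rewrite ?fctE /= ipBl ipBr sx xN_sym.
move=> v; rewrite ?fctE /= ipBl id_integral xNE ip_suml.
under eq_bigr do rewrite ipZl.
apply: (@step_approx id h v); first exact: measurable_id.
by move=> s t _ ts _.
Qed.

Let E_sum u : \sum_(k < N.+2) E (A k) u = u.
Proof.
have bs : bop (\sum_(k < N.+2) E (A k)).
  by apply: bop_sum => k _; case: (E_proj (mA k)).
have : \sum_(k < N.+2) E (A k) = id; last first.
  by move=> /(congr1 (fun f => f u)); rewrite fun_sumE.
apply: qf_inj => //; first by case: bs.
  move=> v w; rewrite !fun_sumE ip_suml ip_sumr; apply: eq_bigr => k _.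
  by case: (E_proj (mA k)) => _ ->.
move=> v; have := @step_approx (fun=> 1) 0 v.
rewrite Rintegral_cst // mul1r dmuSS mul0r => h1.
have {h1} : `|ip v v - \sum_(k < N.+2) 1 * ip (E (A k) v) v| <= 0.
  by apply: h1 => [|s t _ _ _]; [exact: measurable_cst|rewrite subrr normr0].
rewrite normr_le0 subr_eq0 => /eqP ->.
by rewrite fun_sumE ip_suml; apply: eq_bigr => k _; rewrite mul1r.
Qed.

Let xN_eigen u (j : 'I_N.+2) : xN (E (A j) u) = (t_ j)%:C *: E (A j) u.
Proof.
rewrite xNE (bigD1 j) //= big1 ?addr0; first by case: (E_proj (mA j)) => _ _ ->.
move=> k kj; rewrite -E_mul // (_ : A k `&` A j = set0).
  by case: hE => _ [-> _] _ _ _; rewrite scaler0.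
rewrite -subset0 => t [tk tj]; move/eqP: kj; apply; apply/val_inj.
exact: A_uniq tk tj.
Qed.

Let rpoly_xN p u : ip (rpoly p xN u) u = \sum_(k < N.+2) p.[t_ k] * ip (E (A k) u) u.
Proof.
have [lp _] := rpoly_bop p xN_bop; have [lN _] := xN_bop.
rewrite -{1}(E_sum u) (lin_sum lp) ip_suml; apply: eq_bigr => k _.
by rewrite (rpoly_eigen _ lN (xN_eigen u k)) ipZl.
Qed.

(** The Lipschitz constants C and L must not depend on N, so they are
    parameters here and are fixed in [poly_integral] before N is. *)
Lemma poly_integral_close (p : {poly R}) u (K C L : R) :
  (forall v, nm (x v) <= K * nm v) ->
  (forall (y : H -> H) r, linear y -> 0 <= r -> (forall v, nm (y v) <= (K + (b - a)) * nm v) ->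
    (forall v, nm (x v - y v) <= r * nm v) ->
    forall v, nm (rpoly p x v - rpoly p y v) <= C * r * nm v) ->
  (forall s t, a <= s <= b -> a <= t <= b -> `|p.[s] - p.[t]| <= L * `|s - t|) ->
  0 <= L ->
  `|\int[dmu u]_(t in (S : set TR)) p.[t] - ip (rpoly p x u) u| <= (C + L) * h * ip u u.
Proof.
move=> xK hC hL L0.
have hba : h <= b - a.
  by rewrite /h ler_pdivrMr ?ltr0n // ler_peMr ?ler1n // ltW // subr_gt0.
have mp : measurable_fun (S : set TR) (fun t : TR => p.[t]).
  apply: (@measurable_funTS _ _ TR); apply: continuous_measurable_fun.
  exact: continuous_horner.
have i1 := @step_approx (fun t => p.[t]) (L * h) u mp.
have {i1} i1 : `|\int[dmu u]_(t in (S : set TR)) p.[t] - ip (rpoly p xN u) u| <= L * h * ip u u.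
  rewrite rpoly_xN; apply: i1 => s t /(bnd_spectrum bx sx xab)/andP[t1 t2] ts /andP[s1 s2].
  rewrite (le_trans (hL _ _ _ _)) ?t1 ?t2 ?s1 ?(le_trans s2) //.
  by rewrite ler_wpM2l.
have i2 : `|ip (rpoly p xN u) u - ip (rpoly p x u) u| <= C * h * ip u u.
  rewrite -ipBl (le_trans (CS _ _)) // -nm2 expr2 mulrA ler_wpM2r ?nm_ge0 //.
  rewrite nmC; apply: hC; [by case: xN_bop|exact: ltW| |exact: xN_close].
  move=> v; have h1 := nm_tri (x v) (xN v) 0; rewrite !subr0 nmC in h1.
  apply: le_trans h1 _; rewrite addrC mulrDl lerD //.
  by rewrite (le_trans (xN_close v)) // ler_wpM2r ?nm_ge0.
rewrite (le_trans (ler_distD (ip (rpoly p xN u) u) _ _)) //.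
by rewrite mulrDl mulrDl addrC lerD.
Qed.

End Partition.

Lemma poly_integral (p : {poly R}) u :
  ip (rpoly p x u) u = \int[dmu u]_(t in (S : set TR)) p.[t].
Proof.
have [M M0 hM] := bop_bnd bx; have [lx [K K0 hK]] := bx.
have K'0 : 0 <= K + (M - - M) by rewrite addr_ge0 // opprK addr_ge0 // ltW.
have [B [C [_ C0 hC]]] := @rpoly_lip R H p _ K'0.
have [B' [L [_ L0 hL]]] := horner_lip p (ltW M0).
apply/eqP; rewrite eq_sym -subr_eq0 -normr_eq0; apply/eqP/small_eq0 => // e e0.
pose Q := (C + L) * (2 * M) * ip u u.
have Q0 : 0 <= Q by rewrite !mulr_ge0 ?ip_ge0 ?addr_ge0 // ltW.
have [|N hN] := @inv_nat_small R (e / (Q + 1)); first by rewrite divr_gt0 // ltr_wpDl.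
have {hN} hN := hN N (leqnn N); apply: le_trans (@poly_integral_close (- M) M N hM _ p u K C L hK _ _ L0) _.
- by lra.
- move=> y r ly r0 yK xy v; have [] := hC x y r lx ly r0 _ yK xy v => //.
  move=> w; rewrite (le_trans (hK w)) // ler_wpM2r ?nm_ge0 // lerDl; lra.
- move=> s t s1 t1; have [] := hL s t _ _; rewrite // ler_norml //.
have -> : (C + L) * ((M - - M) / N.+1%:R) * ip u u = N.+1%:R^-1 * Q.
  by rewrite opprK /Q; ring.
apply: le_trans (ler_wpM2r Q0 hN) _; rewrite mulrAC ler_pdivrMr ?ltr_wpDl //.
by rewrite ler_wpM2l ?(ltW e0) // lerDl.
Qed.

(** Both sides are within d |u|^2 of the corresponding value for one polynomial. *)
Lemma calc_integral f y u : calc x f y -> measurable_fun (S : set TR) (f : TR -> R) ->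
  ip (y u) u = \int[dmu u]_(t in (S : set TR)) f t.
Proof.
move=> [[ly _] sy hy] mf; have [M M0 hM] := bop_bnd bx.
apply/eqP; rewrite eq_sym -subr_eq0 -normr_eq0; apply/eqP/small_eq0 => // e e0.
pose d := e / (2 * (ip u u + 1)).
have u1 : 0 < ip u u + 1 by rewrite ltr_wpDl ?ip_ge0.
have d0 : 0 < d by rewrite divr_gt0 // mulr_gt0.
have [p hp1 hp2] := hy _ d0.
have [B [L [_ _ hB]]] := horner_lip p (ltW M0).
have mp : measurable_fun (S : set TR) (fun t : TR => p.[t]).
  apply: (@measurable_funTS _ _ TR); apply: continuous_measurable_fun.
  exact: continuous_horner.
have pB t : S t -> `|p.[t]| <= B.
  move=> /(bnd_spectrum bx sx hM); rewrite -ler_norml => tM.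
  by case: (hB t t tM tM).
have ip_ : (dmu u).-integrable (S : set TR) (EFin \o (fun t : TR => p.[t])).
  exact: (@bounded_integrable R (dmu u) S mS (dmu_fin u) _ B).
have if_ : (dmu u).-integrable (S : set TR) (EFin \o (f : TR -> R)).
  apply: (@bounded_integrable R (dmu u) S mS (dmu_fin u) _ (d + B)) => // t St.
  have := hp1 t St; have := pB t St; have := ler_normD (f t - p.[t]) p.[t].
  rewrite subrK; lra.
have i1 : `|\int[dmu u]_(t in (S : set TR)) f t - \int[dmu u]_(t in (S : set TR)) p.[t]|
    <= d * ip u u.
  have := @integral_step_approx R (dmu u) S mS (dmu_fin u) 0 (fun=> 0) (fun=> setT)
    (fun t => f t - p.[t]) d (fun=> measurableT) _ _.
  rewrite big_ord0 subr0 dmuSS RintegralB //; apply; first exact: measurable_funB.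
  by move=> t St; rewrite /stepf big_ord0 subr0 hp1.
have i2 : `|ip (rpoly p x u) u - ip (y u) u| <= d * ip u u.
  rewrite -ipBl (le_trans (CS _ _)) // -nm2 expr2 mulrA ler_wpM2r ?nm_ge0 //.
  by rewrite nmC.
have dd : 2 * (d * ip u u) <= e.
  have -> : 2 * (d * ip u u) = e * (ip u u / (ip u u + 1)).
    by rewrite /d; field; rewrite gt_eqF.
  by rewrite ler_piMr ?(ltW e0) // ler_pdivrMr // mul1r lerDl.
rewrite (le_trans (ler_distD (ip (rpoly p x u) u) _ _)) //.
move: i1; rewrite -poly_integral => i1; lra.
Qed.

End AnySpectralMeasure.

Section FunCalc.
Context (R : realType) (H : hilbertType R).
Local Notation TR := (measurableTypeR R).

(** Spectral measures exist, so the chosen one is a spectral measure, and the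
    operator of the calculus is an integral of f against it.  Diagonal
    coefficients determine an operator, so it is the chosen integral. *)
Lemma fun_calc_calc (x : H -> H) (f : R -> R) (a b : R) : bop x -> sym x -> a <= b ->
  bnd a b x -> {within `[a, b]%classic, continuous f} -> calc x f (fun_calc f x).
Proof.
move=> bx sx ab xab cf; have hx := conj bx sx.
have [y hy] := calc_exists bx sx ab xab cf; have [by_ sy _] := hy.
have hE : is_spectral_measure x (spectral_measure x).
  exact: (@xgetPex _ (fun=> 0) [set E | is_spectral_measure x E]
    (ex_intro _ _ (sproj_spectral hx))).
have mS := real_spectrum_measurable hx.
have mf : measurable_fun (real_spectrum x : set TR) (f : TR -> R).
  apply: subspace_continuous_measurable_fun => //.
  apply: continuous_subspaceW cf => t /(bnd_spectrum bx sx xab) /=.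
  by rewrite in_itv.
have ly : linear y by case: by_.
have iy : is_spectral_integral (spectral_measure x) (real_spectrum x) f y.
  split; first exact/bopP.
  move=> u; rewrite sym_inner // (calc_integral hx hE u hy mf).
  by rewrite dmu_integral.
have [/bopP[lz _] hz] : is_spectral_integral (spectral_measure x) (real_spectrum x) f
    (fun_calc f x).
  exact: (@xgetPex _ 0 [set y | is_spectral_integral (spectral_measure x) (real_spectrum x) f y]
   (ex_intro _ _ iy)).
have -> : fun_calc f x = y by apply: inner_diag_inj => // u; rewrite hz (proj2 iy).
exact: hy.
Qed.

End FunCalc.

(** * The Hilbert space of square summable sequences *)
Section SquareSummable.
Context (R : realType) (H : hilbertType R).
Local Notation C := R[i].

Definition square_summable (u : nat -> H) : Prop :=
  exists M : R, forall n, \sum_(k < n) ip (u k) (u k) <= M.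

Definition l2_pred : {pred nat -> H} := fun u => `[< square_summable u >].

Lemma l2_closed : subsemimod_closed l2_pred.
Proof.
split; first split.
- apply/asboolP; exists 0 => n; rewrite big1 // => k _; exact: ip0l.
- move=> u v /asboolP[M hM] /asboolP[N hN]; apply/asboolP.
  exists (2 * M + 2 * N) => n.
  apply: (@le_trans _ _ (\sum_(k < n) (2 * ip (u k) (u k) + 2 * ip (v k) (v k)))).
    apply: ler_sum => k _; have := ip_ge0 (u k - v k).
    by rewrite ?fctE !ipE (ipC (v k)); lra.
  by rewrite big_split /= -!mulr_sumr; have := hM n; have := hN n; lra.
- move=> c u /asboolP[M hM]; apply/asboolP; exists ((complex.Re `|c|) ^+ 2 * M) => n.
  under eq_bigr do rewrite ?fctE -nm2 nmZ exprMn nm2.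
  by rewrite -mulr_sumr ler_wpM2l // sqr_ge0.
Qed.

HB.instance Definition _ := GRing.isSubmodClosed.Build C (nat -> H) l2_pred l2_closed.

Record l2 := L2 { l2v :> nat -> H; _ : l2_pred l2v }.

HB.instance Definition _ := [isSub for l2v].
HB.instance Definition _ := [Choice of l2 by <:].
HB.instance Definition _ := [SubChoice_isSubLmodule of l2 by <:].

Implicit Types (u v w : l2).

Lemma l2P u : square_summable u.
Proof. by case: u => u /= /asboolP. Qed.

Lemma l2_ext u v : (forall k, u k = v k) -> u = v.
Proof. by move=> h; apply: val_inj; apply/funext. Qed.

Lemma l2DE u v k : (u + v) k = u k + v k. Proof. by []. Qed.
Lemma l2ZE c u k : (c *: u) k = c *: u k. Proof. by []. Qed.
Lemma l2NE u k : (- u) k = - u k. Proof. by []. Qed.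
Definition ps (u v : nat -> H) n : R := \sum_(k < n) ip (u k) (v k).

(** Polarization reduces the convergence to monotone partial sums. *)
Lemma ps_cvg u v : cvgn (ps u v).
Proof.
have sq w : cvgn (ps w w).
  have [M hM] := l2P w; apply: nondecreasing_is_cvgn.
    apply/nondecreasing_seqP => n; rewrite /ps big_ord_recr /= lerDl; exact: ip_ge0.
  by exists M => _ [n _ <-]; exact: hM.
have -> : ps u v = (fun n => 2^-1 * (ps (u + v) (u + v) n - ps u u n - ps v v n)).
  apply/funext => n; rewrite /ps -!sumrB mulr_sumr; apply: eq_bigr => k _.
  by rewrite l2DE !ipE (ipC (v k)); field.
apply: cvgP; apply: cvgMr; apply: cvgB; last exact: sq.
by apply: cvgB; exact: sq.
Qed.

Definition lip u v : R := limn (ps u v).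

Lemma lipP u v : ps u v @ \oo --> lip u v.
Proof. exact: ps_cvg. Qed.

Lemma lip_uniq u v l : ps u v @ \oo --> l -> lip u v = l.
Proof. by move=> h; exact: cvg_lim. Qed.

Lemma lipC u v : lip u v = lip v u.
Proof.
apply: lip_uniq; have -> : ps u v = ps v u; last exact: lipP.
by apply/funext => n; apply: eq_bigr => k _; rewrite ipC.
Qed.

Lemma lipDl u v w : lip (u + v) w = lip u w + lip v w.
Proof.
apply: lip_uniq; have -> : ps (u + v) w = ps u w \+ ps v w.
  by apply/funext => n; rewrite /ps /= -big_split /=; apply: eq_bigr => k _; exact: ipDl.
exact: cvgD (@lipP u w) (@lipP v w).
Qed.

Lemma lipZl (t : R) u w : lip (t%:C *: u) w = t * lip u w.
Proof.
apply: lip_uniq; have -> : ps (t%:C *: u) w = (fun n => t * ps u w n).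
  by apply/funext => n; rewrite /ps mulr_sumr; apply: eq_bigr => k _; rewrite l2ZE ipZl.
exact: cvgMr (@lipP u w).
Qed.

Lemma lip_ii u v : lip ('i *: u) ('i *: v) = lip u v.
Proof.
apply: lip_uniq; have -> : ps ('i *: u) ('i *: v) = ps u v; last exact: lipP.
apply/funext => n; apply: eq_bigr => k _; rewrite !l2ZE ip_i.
rewrite innerC (linearZl_LR (inner : {dot H for @Num.conj R[i]})) /= innerC /ip.
by case: (inner (u k) (v k)) => a b /=; rewrite !(mul0r, mul1r, add0r, opprK, sub0r).
Qed.

Lemma ps_le_lip u n : ps u u n <= lip u u.
Proof.
apply: nondecreasing_cvgn_le; last exact: ps_cvg.
apply/nondecreasing_seqP => m; rewrite /ps big_ord_recr /= lerDl; exact: ip_ge0.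
Qed.

Lemma lip_le u (M : R) : (forall n, ps u u n <= M) -> lip u u <= M.
Proof. by move=> h; apply: limr_le; [exact: ps_cvg|exact: nearW]. Qed.

Lemma lip_coord u k : ip (u k) (u k) <= lip u u.
Proof.
apply: le_trans (ps_le_lip u k.+1); rewrite /ps big_ord_recr /= lerDr.
by apply: sumr_ge0 => j _; exact: ip_ge0.
Qed.

(** The complex inner product whose real part is [lip], as in [innerE]. *)
Definition linner u v : C := (lip u v) +i* (- lip ('i *: u) v).

Lemma linnerC u v : linner u v = (linner v u)^*%C.
Proof.
rewrite /linner /= opprK lipC; congr (_ +i* _).
rewrite [in RHS]lipC -[in RHS]lip_ii scalerA -expr2 sqr_i scaleN1r.
have -> : - v = (-1)%:C *: v by rewrite rmorphN /= scaleN1r.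
by rewrite [in RHS]lipC lipZl mulN1r lipC.
Qed.

Lemma linner_linear w c u v : linner (c *: u + v) w = c * linner u w + linner v w.
Proof.
case: c => a b.
have E (z : l2) : (a +i* b) *: z = a%:C *: z + b%:C *: ('i *: z).
  rewrite scalerA -scalerDl; congr (_ *: _).
  by apply/eqP; rewrite eq_complex /= !(mulr0, mul0r, mulr1, addr0, subr0, add0r) !eqxx.
have F : 'i *: ('i *: u) = (-1)%:C *: u by rewrite scalerA -expr2 sqr_i rmorphN.
rewrite /linner scalerDr scalerA mulrC -scalerA !E F !lipDl !lipZl.
apply/eqP; rewrite eq_complex /=; apply/andP; split; apply/eqP; ring.
Qed.

Let linner_zmodl u' : zmod_morphism (linner^~ u').
Proof.
move=> u v; have := linner_linear u' (-1) v u.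
by rewrite scaleN1r mulN1r addrC [RHS]addrC.
Qed.

Let linner_zmodr u : zmod_morphism (linner u).
Proof.
move=> v w; rewrite linnerC linner_zmodl (linnerC u v) (linnerC u w).
exact: rmorphB.
Qed.

Let linner_scalel u' : scalable_for *%R (linner^~ u').
Proof.
move=> c u; have := linner_linear u' c u 0; rewrite addr0 => ->.
have := linner_zmodl u' 0 0; rewrite subr0 subrr => ->.
by rewrite addr0.
Qed.

Let linner_scaler u : scalable_for (@Num.conj C \; *%R) (linner u).
Proof.
move=> c v; rewrite linnerC linner_scalel (linnerC u v) /=.
exact: rmorphM.
Qed.

HB.instance Definition _ := isBilinear.Build C l2 l2 C *%R (@Num.conj C \; *%R)
  linner linner_zmodl linner_zmodr linner_scalel linner_scaler.

Let linner_herm u v : linner u v = (-1) ^+ false * Num.conj (linner v u).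
Proof. by rewrite expr0 mul1r linnerC. Qed.

HB.instance Definition _ := isHermitianSesquilinear.Build C l2 false (@Num.conj C)
  linner linner_herm.

Lemma lip_ge0 u : 0 <= lip u u.
Proof. by apply: le_trans (ps_le_lip u 0); rewrite /ps big_ord0. Qed.

Lemma lip_i0 u : lip ('i *: u) u = 0.
Proof.
have := lip_ii ('i *: u) u; rewrite scalerA -expr2 sqr_i.
have -> : -1 = (-1)%:C :> C by rewrite rmorphN.
rewrite lipZl (lipC u); lra.
Qed.

Lemma linner_self u : linner u u = (lip u u)%:C.
Proof. by rewrite /linner lip_i0 oppr0. Qed.

Lemma lip_eq0 u : lip u u = 0 -> u = 0.
Proof.
move=> h; apply: l2_ext => k; apply: ip_eq0; apply/eqP.
by rewrite eq_le ip_ge0 andbT -h lip_coord.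
Qed.

Let linner_pos u : u != 0 -> 0 < linner u u.
Proof.
move=> u0; rewrite linner_self ltcR lt_def lip_ge0 andbT.
by apply: contra u0 => /eqP/lip_eq0 ->.
Qed.

HB.instance Definition _ := isDotProduct.Build C l2 linner linner_pos.

Definition lnm u : R := Num.sqrt (lip u u).

Lemma lnm_ge0 u : 0 <= lnm u. Proof. exact: sqrtr_ge0. Qed.
Lemma lnm2 u : lnm u ^+ 2 = lip u u. Proof. by rewrite sqr_sqrtr // lip_ge0. Qed.

Lemma lip_CS u v : lip u v <= lnm u * lnm v.
Proof.
have [v0|v0] := eqVneq v 0.
  have -> : v = (0%R)%:C *: v by rewrite v0 scaler0.
  by rewrite lipC lipZl mul0r mulr_ge0 ?lnm_ge0.
have vp : 0 < lip v v.
  by rewrite lt_def lip_ge0 andbT; apply: contra v0 => /eqP/lip_eq0 ->.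
have := lip_ge0 ((lip v v)%:C *: u + (- lip u v)%:C *: v).
rewrite !lipDl !lipZl !(lipC _ (_ + _)) !lipDl !lipZl (lipC v u) -!lnm2 => h.
have vn : 0 < lnm v by rewrite sqrtr_gt0.
have [uv|uv] := leP (lip u v) 0.
  by rewrite (le_trans uv) // mulr_ge0 ?lnm_ge0.
rewrite -(@ler_pXn2r _ 2) ?nnegrE ?mulr_ge0 ?lnm_ge0 ?(ltW uv) // exprMn.
have {}h : 0 <= lnm v ^+ 2 * (lnm v ^+ 2 * lnm u ^+ 2 - lip u v ^+ 2).
  by move: h; congr (0 <= _); ring.
by move: h; rewrite pmulr_rge0 ?exprn_gt0 // subr_ge0 mulrC.
Qed.

Lemma lnmZ c u : lnm (c *: u) = complex.Re `|c| * lnm u.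
Proof.
have c0 : 0 <= complex.Re `|c| by rewrite normc_def /= sqrtr_ge0.
rewrite /lnm -[X in X * _](ger0_norm c0) -sqrtr_sqr -sqrtrM ?sqr_ge0 //; congr Num.sqrt.
apply: lip_uniq; have -> : ps (c *: u) (c *: u) = (fun n => complex.Re `|c| ^+ 2 * ps u u n).
  apply/funext => n; rewrite /ps mulr_sumr; apply: eq_bigr => k _.
  by rewrite l2ZE -nm2 nmZ exprMn nm2.
exact: cvgMr (@lipP u u).
Qed.

Lemma lnmD u v : lnm (u + v) <= lnm u + lnm v.
Proof.
rewrite -(@ler_pXn2r _ 2) ?nnegrE ?addr_ge0 ?lnm_ge0 // lnm2.
rewrite lipDl (lipC u) (lipC v) !lipDl (lipC v u) -!lnm2.
have := lip_CS u v; nra.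
Qed.

Let lnormD u v : (lnm (u + v))%:C <= (lnm u)%:C + (lnm v)%:C.
Proof. by rewrite -rmorphD /= lecR lnmD. Qed.

Let lnormZ (c : C) u : (lnm (c *: u))%:C = `|c| * (lnm u)%:C.
Proof. by rewrite lnmZ rmorphM; congr (_ * _); exact: RRe_real (normr_real c). Qed.

Let lnorm_eq0 u : (lnm u)%:C = 0 -> u = 0.
Proof.
by move=> [] h; apply: lip_eq0; rewrite -lnm2 h expr0n.
Qed.

HB.instance Definition _ := @Lmodule_isNormed.Build C l2 (fun u => (lnm u)%:C)
  lnormD lnormZ lnorm_eq0.

Lemma l2_normE u : `|u| = (lnm u)%:C. Proof. by []. Qed.

Lemma l2_ball u (r : R) v : ball u r%:C v = (lnm (u - v) < r) :> Prop.
Proof.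
rewrite -ball_normE.
change ((`|u - v| < r%:C) = (lnm (u - v) < r) :> Prop).
by rewrite l2_normE ltcR.
Qed.

Lemma lnmC u v : lnm (u - v) = lnm (v - u).
Proof. by apply: complexI; rewrite -!l2_normE distrC. Qed.

Lemma lnm_tri v u w : lnm (u - w) <= lnm (u - v) + lnm (v - w).
Proof. by rewrite (le_trans _ (lnmD _ _)) // addrA subrK. Qed.

Lemma lnm_coord u k : nm (u k) <= lnm u.
Proof. by rewrite /lnm /nm ler_wsqrtr // lip_coord. Qed.

Lemma slim_sqnorm (x : nat -> H) l : slim x l -> (fun n => ip (x n) (x n)) @ \oo --> ip l l.
Proof.
move=> hx; have hn : (fun n => nm (x n)) @ \oo --> nm l.
  apply/cvgrPdist_le => e /hx[N hN]; exists N => // n /= /hN h.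
  apply: le_trans h; rewrite ler_norml; have := nm_tri (x n) l 0; have := nm_tri l (x n) 0.
  rewrite !subr0 (nmC l (x n)) => ? ?; apply/andP; split; lra.
under eq_fun do rewrite -nm2 expr2.
rewrite -nm2 expr2; exact: (cvgM hn hn).
Qed.

(** Coordinates converge; the tails are controlled by passing to the limit in
    finitely many coordinates at a time. *)
Lemma l2_seq_complete (x : nat -> l2) :
  (forall e : R, 0 < e -> exists N, forall n m, (N <= n)%N -> (N <= m)%N ->
     lnm (x n - x m) <= e) ->
  exists l, forall e : R, 0 < e -> exists N, forall n, (N <= n)%N -> lnm (x n - l) <= e.
Proof.
move=> hx.
have /choice[y hy] k : exists l, slim (fun n => x n k) l.
  apply: slim_cauchy => e /hx[N hN]; exists N => n m hn hm.
  exact: le_trans (lnm_coord (x n - x m) k) (hN n m hn hm).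
have tail e N : 0 < e -> (forall n m, (N <= n)%N -> (N <= m)%N -> lnm (x n - x m) <= e) ->
    forall n K, (N <= n)%N -> ps (fun k => x n k - y k) (fun k => x n k - y k) K <= e ^+ 2.
  move=> e0 hN n K Nn.
  have hc : (fun m => ps (x n - x m) (x n - x m) K) @ \oo -->
      ps (fun k => x n k - y k) (fun k => x n k - y k) K.
    elim: K => [|K IH].
      rewrite /ps big_ord0; under eq_fun do rewrite big_ord0; exact: cvg_cst.
    rewrite /ps big_ord_recr /=; under eq_fun do rewrite big_ord_recr /=.
    apply: cvgD; first exact: IH.
    apply: slim_sqnorm; apply: slimD; first exact: slim_cst.
    have := slimZ (-1) (hy K); rewrite scaleN1r.
    by apply: (slim_eventually (N := 0%N)) => m _; rewrite scaleN1r.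
  rewrite -(cvg_lim _ hc) //; apply: limr_le; first exact: cvgP hc.
  exists N => // m /= Nm; apply: le_trans (ps_le_lip (x n - x m) K) _.
  by rewrite -lnm2 ler_pXn2r ?nnegrE ?lnm_ge0 ?(ltW e0) ?hN.
have [N1 hN1] := hx 1 ltr01.
have sq : square_summable (fun k => x N1 k - y k).
  by exists (1 ^+ 2) => n; exact: tail ltr01 hN1 N1 n (leqnn _).
pose z : l2 := L2 (introT (asboolP _) sq).
exists (x N1 - z) => e e0; have [N hN] := hx e e0.
exists N => n Nn; rewrite -(@ler_pXn2r _ 2) ?nnegrE ?lnm_ge0 ?(ltW e0) // lnm2.
apply: lip_le => K; apply: le_trans (tail e N e0 hN n K Nn).
rewrite /ps; apply: ler_sum => k _.
have -> // : (x n - (x N1 - z)) k = x n k - y k.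
change (x n k - (x N1 k - (x N1 k - y k)) = x n k - y k).
by rewrite subKr.
Qed.

(** Pick a point in a set of the filter inside a ball of radius 1 / (n + 1). *)
Let l2_cauchy_cvg (F : set_system l2) : ProperFilter F -> cauchy F -> cvg F.
Proof.
move=> FF /cauchyP cF.
have /choice[x hx] (n : nat) : exists z : l2, F (ball z (n.+1%:R^-1 : R)%:C).
  by apply: cF; rewrite ltcR invr_gt0 ltr0n.
have near_ n m : lnm (x n - x m) <= n.+1%:R^-1 + m.+1%:R^-1.
  have [z [zn zm]] := filter_ex (filterI (hx n) (hx m)).
  rewrite l2_ball in zn; rewrite l2_ball in zm.
  by rewrite (le_trans (lnm_tri z _ _)) // lerD // ltW // lnmC.
have [l hl] : exists l, forall e : R, 0 < e -> exists N, forall n, (N <= n)%N -> lnm (x n - l) <= e.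
  apply: l2_seq_complete => e e0.
  have [|N hN] := @inv_nat_small R (e / 2); first by rewrite divr_gt0.
  exists N => n m /hN hn /hN hm; rewrite (le_trans (near_ n m)) //.
  by rewrite [leRHS]splitr lerD.
apply/cvg_ex; exists l; apply/cvgrPdist_lt => e e0.
have [t t0 te] : exists2 t : R, 0 < t & e = t%:C.
  by move: e0; case: e => a b; rewrite ltcE /= => /andP[/eqP -> ?]; exists a.
have [|N1 hN1] := hl (t / 2); first by rewrite divr_gt0.
have [|N2 hN2] := @inv_nat_small R (t / 2); first by rewrite divr_gt0.
pose n := maxn N1 N2; have h1 := hN1 n (leq_maxl _ _); have h2 := hN2 n (leq_maxr _ _).
apply: filterS (hx n) => z; rewrite l2_ball => hz.
rewrite l2_normE te ltcR.
rewrite (le_lt_trans (lnm_tri (x n) _ _)) // lnmC [ltRHS]splitr.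
by rewrite ler_ltD // (lt_le_trans hz).
Qed.

HB.instance Definition _ := Uniform_isComplete.Build l2 l2_cauchy_cvg.

Let l2_inner_norm u : (linner : {dot l2 for @Num.conj C}) u u = `|u| ^+ 2.
Proof.
change (linner u u = `|u| ^+ 2); rewrite linner_self l2_normE -rmorphXn.
by rewrite -lnm2.
Qed.

HB.instance Definition _ := CompleteNormedModule_isHilbert.Build R l2 l2_inner_norm.


End SquareSummable.

(** * Embeddings and diagonal operators on sequences *)
Section L2Operators.
Context (R : realType) (H : hilbertType R).
Local Notation C := R[i].
Local Notation L := (l2 H).
Implicit Types (u w z : L) (v : H).

(** Total; used on square summable sequences, where [mkl2E] applies. *)
Definition mkl2 (f : nat -> H) : L :=
  if pselect (square_summable f) is left h then L2 (introT (asboolP _) h) else 0.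

Lemma mkl2E f k : square_summable f -> mkl2 f k = f k.
Proof. by rewrite /mkl2; case: pselect. Qed.

Lemma l2_cvg u w : ps u w @ \oo --> ip u w.
Proof. exact: lipP. Qed.

(** Partial sums that agree after a shift of the index: this compares sequences
    when an isometry moves their coordinates. *)
Lemma l2_ip_shift u w u' w' m m' : (forall n, ps u w (n + m) = ps u' w' (n + m')) ->
  ip u w = ip u' w'.
Proof.
move=> h; have := @l2_cvg u w; have := @l2_cvg u' w'.
rewrite -(cvg_shiftn m (ps u w)) -(cvg_shiftn m' (ps u' w')) => h2 h1.
apply: (cvg_unique _ h1) => //.
by have -> : (fun n => ps u w (n + m)) = (fun n => ps u' w' (n + m')) by apply/funext.
Qed.

Lemma l2_ip_le u w u' w' : (forall k, ip (u k) (w k) <= ip (u' k) (w' k)) ->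
  ip u w <= ip u' w'.
Proof.
move=> h; rewrite -(cvg_lim _ (@l2_cvg u w)) // -(cvg_lim _ (@l2_cvg u' w')) //.
apply: ler_lim; [exact: cvgP (@l2_cvg u w)|exact: cvgP (@l2_cvg u' w')|].
by apply: nearW => n; apply: ler_sum => k _.
Qed.

Lemma l2_ip_eq u w u' w' : (forall k, ip (u k) (w k) = ip (u' k) (w' k)) ->
  ip u w = ip u' w'.
Proof. by move=> h; apply/le_anti/andP; split; apply: l2_ip_le => k; rewrite h. Qed.

Definition single k v (j : nat) : H := if j == k then v else 0.

Lemma ps_single k v (w : nat -> H) n :
  ps (single k v) w n = if (k < n)%N then ip v (w k) else 0.
Proof.
rewrite /ps /single; elim: n => [|n IH]; first by rewrite big_ord0.
rewrite big_ord_recr /= IH ltnS; case: (ltngtP k n) => [kn|kn|->].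
- by rewrite ip0l addr0.
- by rewrite ip0l addr0.
- by rewrite add0r.
Qed.

Lemma single_sq k v : square_summable (single k v).
Proof.
exists (ip v v) => n; have := ps_single k v (single k v) n; rewrite /ps => ->.
by rewrite /single eqxx; case: ifP => // _; exact: ip_ge0.
Qed.

Definition emb k v : L := mkl2 (single k v).

Lemma embE k v j : emb k v j = if j == k then v else 0.
Proof. by rewrite /emb mkl2E //; exact: single_sq. Qed.

Lemma emb_self k v : emb k v k = v. Proof. by rewrite embE eqxx. Qed.

Lemma ip_emb k v w : ip (emb k v) w = ip v (w k).
Proof.
apply: (cvg_unique _ (@l2_cvg (emb k v) w)) => //.
apply: cvg_near_cst; exists k.+1 => // n /= kn.
have -> : ps (emb k v) w n = ps (single k v) w n.
  by apply: eq_bigr => j _; rewrite embE.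
by rewrite ps_single kn.
Qed.

Lemma ip_embr k v w : ip w (emb k v) = ip (w k) v.
Proof. by rewrite ipC ip_emb ipC. Qed.

Lemma emb_lin k : linear (emb k).
Proof.
move=> c v v'; apply: ip_inj => w.
rewrite ipDl ipZC !ip_emb l2ZE ipDl; congr (_ + _).
by rewrite ipZC.
Qed.

Lemma nm_emb k v : nm (emb k v) = nm v.
Proof. by rewrite /nm ip_emb emb_self. Qed.

Lemma emb_bop k : bop (emb k).
Proof.
by split; [exact: emb_lin|exists 1 => // v; rewrite nm_emb mul1r].
Qed.

Lemma l2_nm_coord u k : nm (u k) <= nm u.
Proof. exact: lnm_coord. Qed.

Lemma coord_bop k : bop (fun u : L => u k).
Proof. by split=> //; exists 1 => // u; rewrite mul1r l2_nm_coord. Qed.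

Section Diagonal.
Context (x : nat -> H -> H) (a b : R).
Hypothesis bx : forall k, bop (x k).
Hypothesis sx : forall k, sym (x k).
Hypothesis hx : forall k, bnd a b (x k).

Let K := `|a| + `|b|.

Let K0 : 0 <= K. Proof. by rewrite addr_ge0. Qed.

Let xK k v : nm (x k v) <= K * nm v.
Proof.
apply: num_radius; [by case: (bx k)|exact: sx|] => {}v.
have /andP[h1 h2] := hx k v; have v0 := ip_ge0 v.
rewrite ler_norml; apply/andP; split.
  apply: le_trans h1; rewrite -mulNr ler_wpM2r // opprD.
  by have := ler_norm (- a); rewrite normrN; have := normr_ge0 b; lra.
apply: le_trans h2 _; rewrite ler_wpM2r //.
by have := ler_norm b; have := normr_ge0 a; rewrite /K; lra.
Qed.

Let diag_sq u : square_summable (fun k => x k (u k)).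
Proof.
exists (K ^+ 2 * ip u u) => n.
apply: (@le_trans _ _ (\sum_(k < n) K ^+ 2 * ip (u k) (u k))).
  apply: ler_sum => k _; rewrite -!nm2 -exprMn.
  by rewrite ler_pXn2r ?nnegrE ?mulr_ge0 ?nm_ge0.
by rewrite -mulr_sumr ler_wpM2l ?sqr_ge0 //; exact: ps_le_lip.
Qed.

Definition diag u : L := mkl2 (fun k => x k (u k)).

Lemma diagE u k : diag u k = x k (u k).
Proof. by rewrite /diag (mkl2E _ (diag_sq u)). Qed.

Lemma diag_lin : linear diag.
Proof.
move=> c u w; apply: l2_ext => k; rewrite l2DE l2ZE !diagE.
by case: (bx k) => lx _; exact: lx.
Qed.

Lemma diag_bop : bop diag.
Proof.
split; first exact: diag_lin.
exists K => // u; rewrite -(@ler_pXn2r _ 2) ?nnegrE ?mulr_ge0 ?nm_ge0 // exprMn !nm2.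
have -> : K ^+ 2 * ip u u = ip (K%:C *: u) (K%:C *: u) by rewrite ipZl ipZr mulrA expr2.
apply: l2_ip_le => k; rewrite diagE l2ZE -!nm2 nmZr ger0_norm //.
by rewrite ler_pXn2r ?nnegrE ?mulr_ge0 ?nm_ge0.
Qed.

Lemma diag_sym : sym diag.
Proof. by move=> u w; apply: l2_ip_eq => k; rewrite !diagE sx. Qed.

Lemma diag_bnd : bnd a b diag.
Proof.
move=> u; rewrite -!ipZl; apply/andP; split; apply: l2_ip_le => k.
  by rewrite diagE l2ZE ipZl; case/andP: (hx k (u k)).
by rewrite diagE l2ZE ipZl; case/andP: (hx k (u k)).
Qed.

Lemma diag_emb k v : diag (emb k v) = emb k (x k v).
Proof.
apply: l2_ext => j; rewrite diagE !embE; case: eqVneq => [->//|_].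
by case: (bx j) => lx _; exact: lin0.
Qed.

End Diagonal.

(** The n + 1 orthogonal vectors [emb k v0] cannot lie in the span of n vectors:
    n + 1 rows of n coefficients are linearly dependent. *)
Lemma l2_infinite_dimensional (v0 : H) : v0 <> 0 -> infinite_dimensional L.
Proof.
move=> v0n [n [e he]].
have /choice[c hc] (k : 'I_n.+1) := he (emb k v0).
pose A : 'M[C]_(n.+1, n) := \matrix_(k, i) c k i.
have : (kermx A != 0).
  rewrite -mxrank_eq0 mxrank_ker -lt0n subn_gt0 ltnS.
  exact: rank_leq_col.
move=> /rowV0Pn[d /sub_kermxP dA d0].
have z0 : \sum_(k < n.+1) d ord0 k *: emb k v0 = 0.
  under eq_bigr => k _ do rewrite hc scaler_sumr.
  rewrite exchange_big big1 // => i _ /=.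
  under eq_bigr do rewrite scalerA.
  rewrite -scaler_suml; have := congr1 (fun M : 'rV[C]_n => M ord0 i) dA.
  rewrite !mxE; under eq_bigr do rewrite mxE.
  by move=> ->; rewrite scale0r.
move/eqP: d0; apply; apply/rowP => k; rewrite mxE.
apply: contrapT => /eqP dk; apply: v0n.
have : ip (\sum_(j < n.+1) d ord0 j *: emb j v0) (emb k (d ord0 k *: v0)) = 0.
  by rewrite z0 ip0l.
rewrite ip_suml (bigD1 k) //= big1 ?addr0.
  rewrite ip_embr l2ZE emb_self => /ip_eq0 /eqP.
  by rewrite scaler_eq0 (negbTE dk) /= => /eqP.
move=> j jk; rewrite ip_embr l2ZE embE; have -> : (nat_of_ord k == j) = false.
  by rewrite eq_sym; exact: negbTE jk.
by rewrite scaler0 ip0l.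
Qed.

End L2Operators.

(** * Operators over an interval and intertwining *)
Section OperatorsIn.
Context (R : realType) (I : set R) (f : R -> R).
Hypothesis hI : is_interval I.
Hypothesis hf : {within I, continuous f}.
Implicit Types (H L : hilbertType R).

(** For selfadjoint operators on a nonzero space this says that the spectrum is
    in I, see [op_in_of] and [op_in_spectrum]; unlike the spectrum, the form
    <x u, u> is easy to follow through sums and compressions. *)
Definition op_in H (x : H -> H) : Prop :=
  [/\ bop x, sym x & exists a b, [/\ I a, I b, a <= b & bnd a b x]].

Lemma bnd_weaken H (x : H -> H) a b a' b' : a' <= a -> b <= b' -> bnd a b x -> bnd a' b' x.
Proof.
move=> aa bb h u; have /andP[h1 h2] := h u; apply/andP; split.
  by rewrite (le_trans _ h1) // ler_wpM2r ?ip_ge0.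
by rewrite (le_trans h2) // ler_wpM2r ?ip_ge0.
Qed.

Lemma I_segment a b : I a -> I b -> `[a, b]%classic `<=` I.
Proof. by move=> Ia Ib t /=; rewrite in_itv /= => /(hI Ia Ib). Qed.

Lemma op_in_of H (x : H -> H) : (exists u : H, u <> 0) ->
  selfadjoint x -> spectrum_in I x -> op_in x.
Proof.
move=> [u u0] /selfadjointP[bx sx] sI; split=> //.
have [|a [b [Ia Ib ab]]] := spectrum_in_bnd bx sx _ sI; first by exists u.
exists a, b; split=> //; have /andP[h1 h2] := ab u; have := le_trans h1 h2.
by rewrite ler_pM2r // lt_def ip_ge0 andbT; apply/eqP => /ip_eq0.
Qed.

Lemma op_in_selfadjoint H (x : H -> H) : op_in x -> selfadjoint x.
Proof. by move=> [bx sx _]; apply/selfadjointP. Qed.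

Lemma op_in_spectrum H (x : H -> H) : op_in x -> spectrum_in I x.
Proof. by move=> [bx sx [a [b [Ia Ib _ h]]]]; exact: bnd_spectrum_in h. Qed.

Lemma op_in_fun_calc H (x : H -> H) : op_in x -> bop (fun_calc f x) /\ sym (fun_calc f x).
Proof.
move=> [bx sx [a [b [Ia Ib ab h]]]].
have cf : {within `[a, b]%classic, continuous f}.
  exact: continuous_subspaceW (I_segment Ia Ib) hf.
by have [? ? _] := fun_calc_calc bx sx ab h cf.
Qed.

(** True for polynomials.  A polynomial close to f on a segment that contains
    both numerical ranges is close to f(x) and f(y) simultaneously. *)
Lemma fun_calc_intertwine H L (x : H -> H) (y : L -> L) (T : H -> L) :
  op_in x -> op_in y -> bop T -> (forall u, T (x u) = y (T u)) ->
  forall u, T (fun_calc f x u) = fun_calc f y (T u).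
Proof.
move=> [bx sx [a [b [Ia Ib ab hx]]]] [by_ sy [a' [b' [Ia' Ib' ab' hy]]]] bT com u.
pose m := Num.min a a'; pose M := Num.max b b'.
have Im : I m by rewrite /m; case: leP.
have IM : I M by rewrite /M; case: leP.
have mM : m <= M by rewrite (le_trans _ (le_trans ab _)) // ?ge_min ?le_max lexx.
have {}hx : bnd m M x by apply: bnd_weaken hx; rewrite ?ge_min ?le_max lexx.
have {}hy : bnd m M y by apply: bnd_weaken hy; rewrite ?ge_min ?le_max lexx orbT.
have cf : {within `[m, M]%classic, continuous f}.
  exact: continuous_subspaceW (I_segment Im IM) hf.
have cx := fun_calc_calc bx sx mM hx cf; have cy := fun_calc_calc by_ sy mM hy cf.
have [lT [K K0 hK]] := bT.
apply: nm_small_eq => e e0; pose Q := K * nm u + nm (T u).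
have Q0 : 0 <= Q by rewrite addr_ge0 ?mulr_ge0 ?nm_ge0.
pose d := e / (Q + 1); have d0 : 0 < d by rewrite divr_gt0 // ltr_wpDl.
have [p hp] := weierstrass_le mM cf d0.
have ex v : nm (fun_calc f x v - rpoly p x v) <= d * nm v.
  apply: (calc_norm bx sx (calcB cx (calc_poly p bx sx))) => t ht.
  by apply: hp; exact: bnd_spectrum ht.
have ey v : nm (fun_calc f y v - rpoly p y v) <= d * nm v.
  apply: (calc_norm by_ sy (calcB cy (calc_poly p by_ sy))) => t ht.
  by apply: hp; exact: bnd_spectrum ht.
rewrite (le_trans (nm_tri (T (rpoly p x u)) _ _)) //.
rewrite -(linB lT) [X in _ + nm (X - _)](opoly_inter _ _ lT com) [X in _ + X]nmC.
apply: le_trans (lerD (hK _) (ey _)) _.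
apply: (@le_trans _ _ (d * Q)).
  by rewrite /Q mulrDr lerD2r mulrCA ler_wpM2l.
by rewrite /d mulrAC ler_pdivrMr ?ltr_wpDl // ler_wpM2l ?(ltW e0) // lerDl.
Qed.

Lemma op_leP H (y z : H -> H) : bop y -> sym y -> bop z -> sym z ->
  op_le y z <-> forall u, ip (y u) u <= ip (z u) u.
Proof.
move=> by_ sy bz sz.
have [ld _] := bopB bz by_.
have sd : sym (z - y) by move=> u v; rewrite ?fctE /= !ipE sy sz.
have E u : (0 <= inner ((z - y) u) u) = (ip (y u) u <= ip (z u) u).
  by rewrite (sym_inner _ ld sd) ler0c ?fctE ipBl subr_ge0.
by split=> h u; have := h u; rewrite E.
Qed.

Lemma ip_comb H (y z : H -> H) (c d : R) u w :
  ip ((c%:C *: y + d%:C *: z) u) w = c * ip (y u) w + d * ip (z u) w.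
Proof. by rewrite ?fctE ipDl !ipZl. Qed.

Lemma sym_comb H (y z : H -> H) (c d : R) : sym y -> sym z ->
  sym (c%:C *: y + d%:C *: z).
Proof. by move=> sy sz u w; rewrite ip_comb [RHS]ipC ip_comb (sy u) (sz u) !(ipC u). Qed.

Lemma op_le_trivial H (y z : H -> H) : ~ (exists u : H, u <> 0) -> op_le y z.
Proof.
move=> triv u; have -> : u = 0 by apply: contrapT => h; apply: triv; exists u.
by rewrite (linear0r (inner : {dot H for @Num.conj R[i]})).
Qed.

Lemma infinite_nontrivial H : infinite_dimensional H -> exists u : H, u <> 0.
Proof.
move=> inf; apply: contrapT => triv; apply: inf; exists 0%N, (fun=> 0) => u.
exists (fun=> 0); rewrite big_ord0; apply: contrapT => h; apply: triv; by exists u.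
Qed.

Lemma op_in_compress H L (x : L -> L) (V : H -> L) (V' : L -> H) :
  op_in x -> bop V -> bop V' -> (forall u w, ip (V u) w = ip u (V' w)) ->
  (forall u, V' (V u) = u) -> op_in (V' \o x \o V).
Proof.
move=> [bx sx [a [b [Ia Ib ab hx]]]] bV bV' adj iso; split.
- exact: bop_comp (bop_comp bV' bx) bV.
- by move=> u v /=; rewrite ipC -adj ipC sx adj.
exists a, b; split=> // u /=; rewrite ipC -adj ipC.
by have := hx (V u); rewrite adj iso.
Qed.

(** If D* D = 2 then 1 - D D* is a unitary involution, the reflection in the
    orthogonal complement of the range of D.  The adjoint is an explicit map D',
    as H and L differ. *)
Section Reflection.
Context (H L : hilbertType R) (D : H -> L) (D' : L -> H).
Hypothesis bD : bop D.
Hypothesis bD' : bop D'.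
Hypothesis adj : forall u w, ip (D u) w = ip u (D' w).
Hypothesis D2 : forall u, D' (D u) = u + u.

Definition refl (w : L) : L := w - D (D' w).

Lemma refl_bop : bop refl.
Proof. exact: bopB (@bop_id R L) (bop_comp bD bD'). Qed.

Lemma refl_sym : sym refl.
Proof.
by move=> u w; rewrite /refl ipBl ipBr; congr (_ - _); rewrite adj [RHS]ipC adj ipC.
Qed.

Lemma reflK w : refl (refl w) = w.
Proof.
have [lD _] := bD; have [lD' _] := bD'.
rewrite /refl (linB lD') D2 opprD addrA subrr sub0r (linN lD) opprK subrK //.
Qed.

Lemma op_in_refl (x : L -> L) : op_in x -> op_in (refl \o x \o refl).
Proof.
move=> ox; apply: op_in_compress ox refl_bop refl_bop refl_sym _; exact: reflK.
Qed.

Lemma fun_calc_refl (x : L -> L) w : op_in x ->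
  fun_calc f (refl \o x \o refl) (refl w) = refl (fun_calc f x w).
Proof.
move=> ox; apply/esym; apply: fun_calc_intertwine => //.
- exact: op_in_refl.
- exact: refl_bop.
by move=> u /=; rewrite reflK.
Qed.
End Reflection.

Lemma op_in_convex H (x y : H -> H) (l : R) : 0 <= l <= 1 -> op_in x -> op_in y ->
  op_in (l%:C *: x + (1 - l)%:C *: y).
Proof.
move=> /andP[l0 l1] [bx sx [a [b [Ia Ib ab hx]]]] [by_ sy [a' [b' [Ia' Ib' ab' hy]]]].
split.
- exact: bopD (bopZ _ bx) (bopZ _ by_).
- by move=> u v; rewrite ?fctE /= !ipE sx sy.
pose m := Num.min a a'; pose M := Num.max b b'.
have Im : I m by rewrite /m; case: leP.
have IM : I M by rewrite /M; case: leP.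
have mM : m <= M by rewrite (le_trans _ (le_trans ab _)) // ?ge_min ?le_max lexx.
have {}hx : bnd m M x by apply: bnd_weaken hx; rewrite ?ge_min ?le_max lexx.
have {}hy : bnd m M y by apply: bnd_weaken hy; rewrite ?ge_min ?le_max lexx orbT.
exists m, M; split=> // u; rewrite ?fctE !ipE.
have /andP[h1 h2] := hx u; have /andP[h3 h4] := hy u.
have l1' : 0 <= 1 - l by rewrite subr_ge0.
have k1 := ler_wpM2l l0 h1; have k2 := ler_wpM2l l0 h2.
have k3 := ler_wpM2l l1' h3; have k4 := ler_wpM2l l1' h4.
apply/andP; split.
  apply: le_trans (lerD k1 k3); rewrite le_eqVlt; apply/orP; left; apply/eqP; ring.
apply: le_trans (lerD k2 k4) _; rewrite le_eqVlt; apply/orP; left; apply/eqP; ring.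
Qed.

(** The form at u is <x p u, p u> + s |u - p u|^2. *)
Lemma op_in_corner H (p x : H -> H) (s : R) : bop p -> sym p -> (forall u, p (p u) = p u) ->
  op_in x -> I s -> op_in (p \o x \o p + s%:C *: (id - p)).
Proof.
move=> bp sp pp [bx sx [a [b [Ia Ib ab hx]]]] Is; have bid := @bop_id R H.
split.
- exact: bopD (bop_comp (bop_comp bp bx) bp) (bopZ _ (bopB bid bp)).
- by move=> u v; rewrite ?fctE /= !ipE sp sx sp -!(sp u v).
pose m := Num.min a s; pose M := Num.max b s.
have Im : I m by rewrite /m; case: leP.
have IM : I M by rewrite /M; case: leP.
have mM : m <= M by rewrite (le_trans _ (le_trans ab _)) // ?ge_min ?le_max lexx.
have {}hx : bnd m M x by apply: bnd_weaken hx; rewrite ?ge_min ?le_max lexx.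
have ms : m <= s by rewrite ge_min lexx orbT.
have sM : s <= M by rewrite le_max lexx orbT.
exists m, M; split=> // u; rewrite ?fctE /= ipDl sp ipZl ipBl.
have pE : ip (p u) u = ip (p u) (p u) by rewrite -[in LHS]pp sp.
have q0 : 0 <= ip u u - ip (p u) u.
  have := ip_ge0 (u - p u); rewrite !ipE (ipC u (p u)) -pE; lra.
have := hx (p u); rewrite -pE => /andP[h1 h2].
have k1 := ler_wpM2r q0 ms; have k2 := ler_wpM2r q0 sM.
apply/andP; split.
  apply: le_trans (lerD h1 k1); rewrite le_eqVlt; apply/orP; left; apply/eqP; ring.
apply: le_trans (lerD h2 k2) _; rewrite le_eqVlt; apply/orP; left; apply/eqP; ring.
Qed.

Lemma op_in_diag H (x : nat -> H -> H) a b : I a -> I b -> a <= b ->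
  (forall k, [/\ bop (x k), sym (x k) & bnd a b (x k)]) -> op_in (diag x : l2 H -> l2 H).
Proof.
move=> Ia Ib ab h.
have bx k : bop (x k) by case: (h k).
have sx k : sym (x k) by case: (h k).
have hx k : bnd a b (x k) by case: (h k).
split; [exact: diag_bop bx sx hx|exact: diag_sym bx sx hx|].
by exists a, b; split=> //; exact: diag_bnd bx sx hx.
Qed.

Lemma fun_calc_diag H (x : nat -> H -> H) a b k v : I a -> I b -> a <= b ->
  (forall k, [/\ bop (x k), sym (x k) & bnd a b (x k)]) ->
  fun_calc f (diag x : l2 H -> l2 H) (emb k v) = emb k (fun_calc f (x k) v).
Proof.
move=> Ia Ib ab h; apply/esym; apply: fun_calc_intertwine.
- by case: (h k) => ? ? ?; split=> //; exists a, b.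
- exact: op_in_diag h.
- exact: emb_bop.
move=> u; apply/esym; apply: (@diag_emb R H x a b) => j; by case: (h j).
Qed.

Lemma scalar_props H a b s : a <= s <= b ->
  [/\ bop (s%:C *: (id : H -> H)), sym (s%:C *: (id : H -> H)) & bnd a b (s%:C *: (id : H -> H))].
Proof.
move=> /andP[as_ sb]; split.
- exact: bopZ (@bop_id R H).
- by move=> u v; rewrite ?fctE !ipE.
by move=> u; rewrite ?fctE !ipE !ler_wpM2r ?ip_ge0.
Qed.

End OperatorsIn.

(** * The equivalences *)
Section Implications.
Context (R : realType) (I : set R) (f : R -> R).
Hypothesis hI : is_interval I.
Hypothesis hf : {within I, continuous f}.
Implicit Types (H L : hilbertType R).

(** Comparisons of operators end in inequalities between real numbers; these
    lemmas rearrange them with the operators kept abstract. *)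
Let le_eq2 (A B A' B' : R) : A = A' -> B = B' -> A' <= B' -> A <= B.
Proof. by move=> -> ->. Qed.

Let ip_corner H (p y : H -> H) u : sym p -> ip ((p \o y \o p) u) u = ip (y (p u)) (p u).
Proof. by move=> sp; exact: sp. Qed.

(** For c = q ^ 2 and d = r ^ 2 this is the form of diag(A, B) at (q u, r u). *)
Let ip_mix H (A B u : H) (w : l2 H) (q r c d : R) :
  w 0%N = q%:C *: u -> w 1%N = r%:C *: u -> q * q = c -> r * r = d ->
  ip (q%:C *: emb 0 A + r%:C *: emb 1 B) w = c * ip A u + d * ip B u.
Proof. by move=> w0 w1 <- <-; rewrite ipDl !ipZl !ip_emb w0 w1 !ipZr !mulrA. Qed.

Section Jensen.
Context (H : hilbertType R) (n : nat) (x a : 'I_n -> H -> H) (u0 : H).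
Hypothesis u0n : u0 <> 0.
Hypothesis hx : forall i, op_in I (x i).
Hypothesis ba : forall i, bop (a i).
Hypothesis iso : \sum_(k < n) (adjoint (a k) \o a k) = id.

Let jsum (g : 'I_n -> H -> H) : H -> H := \sum_(i < n) (adjoint (a i) \o g i \o a i).

Let adjb i : bop (adjoint (a i)). Proof. by case: (adjointP (ba i)). Qed.
Let adjE i u w : ip (a i u) w = ip u (adjoint (a i) w).
Proof. by case: (adjointP (ba i)) => _ ->. Qed.

Let isoE u : \sum_(i < n) adjoint (a i) (a i u) = u.
Proof. by have := congr1 (fun g => g u) iso; rewrite fun_sumE. Qed.

Lemma jsum_bop_sym (g : 'I_n -> H -> H) : (forall i, bop (g i) /\ sym (g i)) ->
  bop (jsum g) /\ sym (jsum g).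
Proof.
move=> hg; split.
  apply: bop_sum => i _; apply: bop_comp (ba i); apply: bop_comp (adjb i) _.
  by case: (hg i).
move=> u w; rewrite /jsum !fun_sumE ip_suml ip_sumr; apply: eq_bigr => i _ /=.
by rewrite -adjE ipC -adjE ipC; case: (hg i) => _ ->.
Qed.

Lemma ip_jsum (g : 'I_n -> H -> H) u : ip (jsum g u) u = \sum_(i < n) ip (g i (a i u)) (a i u).
Proof.
by rewrite /jsum fun_sumE ip_suml; apply: eq_bigr => i _ /=; rewrite ipC -adjE ipC.
Qed.

Lemma jensen_size_gt0 : (0 < n)%N.
Proof.
case: (posnP n) => // n0; exfalso; apply: u0n; rewrite -(isoE u0) big1 // => i _.
by have := ltn_ord i; rewrite {2}n0.
Qed.

(** A single segment serves all x_i; I may be neither closed nor bounded. *)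
Lemma common_bnd : exists r t, [/\ I r, I t, r <= t & forall i, bnd r t (x i)].
Proof.
have /choice[r hr] i : exists r, exists t, [/\ I r, I t, r <= t & bnd r t (x i)].
  by case: (hx i) => _ _.
have /choice[t ht] i := hr i.
pose i0 := Ordinal jensen_size_gt0.
have [i _ himin] := @Order.TotalTheory.arg_minP _ _ _ i0 xpredT r isT.
have [j _ hjmax] := @Order.TotalTheory.arg_maxP _ _ _ i0 xpredT t isT.
have [Ir _ _ _] := ht i; have [_ It _ _] := ht j.
exists (r i), (t j); split=> //.
  have [_ _ rt _] := ht j; apply: le_trans rt; exact: himin.
move=> k; have [_ _ _ h] := ht k; apply: bnd_weaken h; [exact: himin|exact: hjmax].
Qed.

Let half_avg (A B C S : R) :
  A <= 2^-1 * B + (1 - 2^-1) * C -> C = B -> B = S -> A <= S.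
Proof. by move=> h CB BS; rewrite CB BS -mulrDl addrC subrK mul1r in h. Qed.

(** The dilation X of the x_i is moved to Z and Z' so that the average of the
    two is block diagonal with entry (0, 0) equal to the sum [jsum x]. *)
Lemma jensen : operator_convex I f ->
  op_le (fun_calc f (jsum x)) (jsum (fun i => fun_calc f (x i))).
Proof.
move=> conv; have [r [t [Ir It rt hrt]]] := common_bnd.
(* Coordinate i + 1 carries x_i; the scalar r, a point of I, fills the others. *)
pose xs (k : nat) : H -> H := if k is k'.+1 then
    (if insub k' is Some i then x i else r%:C *: id) else r%:C *: id.
have xsP k : [/\ bop (xs k), sym (xs k) & bnd r t (xs k)].
  have sr := @scalar_props R H r t r.
  case: k => [|k] /=; first by apply: sr; rewrite lexx.
  case: insubP => [i _ _|_]; last by apply: sr; rewrite lexx.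
  by case: (hx i) => ? ? _; split.
have xsE (i : 'I_n) : xs i.+1 = x i by rewrite /xs valK.
pose X : l2 H -> l2 H := diag xs.
have oX : op_in I X by exact: op_in_diag xsP.
have XE w k : X w k = xs k (w k).
  by rewrite /X (@diagE R H xs r t) // => j; case: (xsP j).
pose V (u : H) : l2 H := \sum_(i < n) emb i.+1 (a i u).
pose V' (w : l2 H) : H := \sum_(i < n) adjoint (a i) (w i.+1).
have bV : bop V.
  have -> : V = \sum_(i < n) (@emb R H i.+1 \o a i) by apply/funext => u; rewrite fun_sumE.
  by apply: bop_sum => i _; apply: bop_comp (ba i); exact: emb_bop.
have bV' : bop V'.
  have -> : V' = \sum_(i < n) (adjoint (a i) \o (fun w : l2 H => w i.+1)).
    by apply/funext => u; rewrite fun_sumE.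
  by apply: bop_sum => i _; apply: bop_comp (adjb i) _; exact: coord_bop.
have adjV u w : ip (V u) w = ip u (V' w).
  by rewrite /V ip_suml ip_sumr; apply: eq_bigr => i _; rewrite ip_emb adjE.
have l2_sumE m (F : 'I_m -> l2 H) k : (\sum_(i < m) F i) k = \sum_(i < m) F i k.
  exact: (big_morph (fun w : l2 H => w k)).
have VS u (i : 'I_n) : V u i.+1 = a i u.
  rewrite /V l2_sumE (bigD1 i) //= embE eqxx big1 ?addr0 // => j ji.
  by rewrite embE eqSS eq_sym (negbTE (_ : val j != val i)).
have V0 u : V u 0%N = 0 by rewrite /V l2_sumE big1 // => i _; rewrite embE.
have V'V u : V' (V u) = u.
  by rewrite -[RHS]isoE; apply: eq_bigr => i _; rewrite VS.
have V'0 u : V' (emb 0 u) = 0.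
  rewrite /V' big1 // => i _; rewrite embE /=.
  by case: (adjb i) => la _; exact: lin0 la.
(* emb 0 and V are isometries with orthogonal ranges, so D* D = 2, and the
   reflection along the range of emb 0 - V exchanges emb 0 u and V u. *)
pose D (u : H) : l2 H := emb 0 u - V u.
pose D' (w : l2 H) : H := w 0%N - V' w.
have bD : bop D by have := bopB (@emb_bop R H 0%N) bV; exact.
have bD' : bop D' by have := bopB (@coord_bop R H 0%N) bV'; exact.
have adjD u w : ip (D u) w = ip u (D' w) by rewrite /D /D' ipBl ipBr ip_emb adjV.
have D2 u : D' (D u) = u + u.
  rewrite /D /D'; have [lV' _] := bV'; rewrite (linB lV') V'0 V'V sub0r opprK.
  by rewrite l2DE l2NE V0 subr0 emb_self.
pose U := refl D D'.
have Ue u : U (emb 0 u) = V u.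
  rewrite /U /refl /D' emb_self V'0 subr0 /D opprB addrC subrK //.
have UV u : U (V u) = emb 0 u by rewrite -Ue /U (reflK bD bD' D2).
(* The sign change of coordinate 0 is 1 - T T* for T = sqrt 2 emb 0. *)
pose q : R := Num.sqrt 2.
have q2 : q * q = 2 by rewrite -expr2 sqr_sqrtr.
pose T (u : H) : l2 H := q%:C *: emb 0 u.
pose T' (w : l2 H) : H := q%:C *: w 0%N.
have bT : bop T by exact: (bopZ _ (@emb_bop R H 0%N)).
have bT' : bop T' by have := bopZ q%:C (@coord_bop R H 0%N); exact.
have adjT u w : ip (T u) w = ip u (T' w) by rewrite /T /T' ipZl ipZr ip_emb.
have T2 u : T' (T u) = u + u.
  by rewrite /T /T' l2ZE emb_self scalerA -rmorphM /= q2 rmorphMn /= scaler_nat mulr2n.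
pose S := refl T T'.
have SE w : S w = w - 2%:C *: emb 0 (w 0%N).
  rewrite /S /refl /T /T'; have [le _] := @emb_bop R H 0.
  by rewrite (linZ le) scalerA -rmorphM /= q2.
have Se u : S (emb 0 u) = - emb 0 u.
  by rewrite SE emb_self rmorphMn /= scaler_nat mulr2n opprD addrA subrr sub0r.
have [lS _] : bop S := refl_bop bT bT'.
(* Z is kept opaque: only these three properties are used. *)
have [Z [oZ Ze fZ]] : exists Z : l2 H -> l2 H, [/\ op_in I Z,
    forall u, Z (emb 0 u) 0%N = jsum x u &
    forall u, ip (fun_calc f Z (emb 0 u)) (emb 0 u) =
      \sum_(i < n) ip (fun_calc f (x i) (a i u)) (a i u)].
  exists (U \o X \o U); split; first exact: op_in_refl.
    move=> u; apply: ip_inj => v; rewrite -ip_embr /= Ue.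
    rewrite (refl_sym adjD) -/U Ue ipC adjV ipC.
    congr (ip _ _); rewrite /jsum fun_sumE; apply: eq_bigr => i _ /=.
    by congr (adjoint _ _); rewrite XE VS xsE.
  move=> u; rewrite -UV (fun_calc_refl hI hf bD bD' adjD D2 _ oX).
  rewrite (refl_sym adjD) -/U UV Ue.
  have [[lfX _] _] := op_in_fun_calc hI hf oX.
  rewrite {1}/V (lin_sum lfX) ip_suml; apply: eq_bigr => i _.
  by rewrite (fun_calc_diag hI hf _ _ Ir It rt xsP) ip_emb VS xsE.
have [lZ _] : bop Z by case: oZ.
have [bZ sZ] := op_in_fun_calc hI hf oZ.
have [Z' [oZ' Ze' fZ']] : exists Z' : l2 H -> l2 H, [/\ op_in I Z',
    forall u, Z' (emb 0 u) = - S (Z (emb 0 u)) &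
    forall u, ip (fun_calc f Z' (emb 0 u)) (emb 0 u) =
      ip (fun_calc f Z (emb 0 u)) (emb 0 u)].
  exists (S \o Z \o S); split; first exact: op_in_refl.
    by move=> u /=; rewrite Se (linN lZ) (linN lS).
  move=> u; have e0 : emb 0 u = S (- emb 0 u) by rewrite (linN lS) Se opprK.
  rewrite {1}e0 (fun_calc_refl hI hf bT bT' adjT T2 _ oZ).
  rewrite (refl_sym adjT) -/S Se ipNr.
  by have [lfZ _] := bZ; rewrite (linN lfZ) ipNl opprK.
have [bZ' sZ'] := op_in_fun_calc hI hf oZ'.
have half : 0 <= (2^-1 : R) <= 1 by rewrite invr_ge0 ler0n invf_le1 ?ler1n ?ltr0n.
have half2 : 1 - 2^-1 = 2^-1 :> R by field.
pose W := (2^-1)%:C *: Z + (1 - 2^-1)%:C *: Z'.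
have oW : op_in I W by exact: op_in_convex.
(* Z' (emb 0 u) agrees with Z (emb 0 u) at coordinate 0 and is opposite to it
   elsewhere. *)
have We u : W (emb 0 u) = emb 0 (jsum x u).
  rewrite /W half2 !fctE -scalerDr Ze' SE Ze.
  rewrite opprB addrCA subrr addr0 scalerA -rmorphM /= mulVf ?pnatr_eq0 //.
  by rewrite scale1r.
have oc : op_in I (jsum x).
  have -> : jsum x = V' \o X \o V.
    apply/funext => u; rewrite /jsum fun_sumE; apply: eq_bigr => i _ /=.
    by congr (adjoint _ _); rewrite XE VS xsE.
  exact: op_in_compress adjV V'V.
have [bc sc] := op_in_fun_calc hI hf oc.
have [bj sj] : bop (jsum (fun i => fun_calc f (x i))) /\ sym (jsum (fun i => fun_calc f (x i))).
  by apply: jsum_bop_sym => i; exact: op_in_fun_calc (hx i).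
apply/(op_leP bc sc bj sj) => u; rewrite ip_jsum.
have inf := l2_infinite_dimensional u0n.
have := conv _ inf _ half Z Z' (op_in_selfadjoint oZ) (op_in_selfadjoint oZ')
  (op_in_spectrum hI oZ) (op_in_spectrum hI oZ').
have [bW sW] := op_in_fun_calc hI hf oW.
have bR : bop ((2^-1)%:C *: fun_calc f Z + (1 - 2^-1)%:C *: fun_calc f Z').
  exact: bopD (bopZ _ bZ) (bopZ _ bZ').
have sR : sym ((2^-1)%:C *: fun_calc f Z + (1 - 2^-1)%:C *: fun_calc f Z').
  exact: sym_comb.
move=> /(op_leP bW sW bR sR)/(_ (emb 0 u)).
rewrite -(fun_calc_intertwine hI hf oc oW (emb_bop H 0%N)); last by move=> v; rewrite We.
rewrite ip_emb emb_self ip_comb => h.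
exact: half_avg h (fZ' u) (fZ u).
Qed.

End Jensen.

(** The isometry v below compresses diag(x, s, s, ...) to the corner in (iv),
    completed by s. *)
Lemma isometry_corner : (forall H, infinite_dimensional H ->
    forall v x : H -> H, isometric v -> selfadjoint x -> spectrum_in I x ->
      op_le (fun_calc f (adjoint v \o x \o v)) (adjoint v \o fun_calc f x \o v)) ->
  forall H, infinite_dimensional H ->
    forall p x : H -> H, projection p -> selfadjoint x -> spectrum_in I x ->
    forall s : R, I s ->
      op_le (p \o fun_calc f (p \o x \o p + s%:C *: (id - p)) \o p)
            (p \o fun_calc f x \o p).
Proof.
move=> iii H inf p x [/selfadjointP[bp sp] pp0] sx sIx s Is.
have pp u : p (p u) = p u by have := congr1 (fun g => g u) pp0.
have [u0 u0n] := infinite_nontrivial inf.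
have ox : op_in I x by apply: op_in_of sIx => //; exists u0.
pose c := p \o x \o p + s%:C *: (id - p); rewrite -/c.
have oc : op_in I c by exact: op_in_corner.
have [lp _] := bp.
have [a [b [[Ia Ib] ab hs hxab hcab]]] : exists a b, [/\ I a /\ I b, a <= b, a <= s <= b,
    bnd a b x & bnd a b c].
  have [_ _ [a1 [b1 [Ia1 Ib1 ab1 h1]]]] := ox; have [_ _ [a2 [b2 [Ia2 Ib2 ab2 h2]]]] := oc.
  exists (Num.min s (Num.min a1 a2)), (Num.max s (Num.max b1 b2)).
  have le1 : Num.min s (Num.min a1 a2) <= s by rewrite ge_min lexx.
  have le2 : s <= Num.max s (Num.max b1 b2) by rewrite le_max lexx.
  split.
  - by split; case: leP => // _; case: leP.
  - exact: le_trans le2.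
  - by rewrite le1.
  - by apply: bnd_weaken h1; rewrite !(ge_min, le_max) lexx !orbT.
  - by apply: bnd_weaken h2; rewrite !(ge_min, le_max) lexx !orbT.
pose xs (k : nat) : H -> H := if k is 0%N then x else s%:C *: id.
pose ys (k : nat) : H -> H := if k is 0%N then c else s%:C *: id.
have xsP k : [/\ bop (xs k), sym (xs k) & bnd a b (xs k)].
  by case: k => [|k]; [case: ox|exact: scalar_props].
have ysP k : [/\ bop (ys k), sym (ys k) & bnd a b (ys k)].
  by case: k => [|k]; [case: oc|exact: scalar_props].
pose X : l2 H -> l2 H := diag xs; pose Y : l2 H -> l2 H := diag ys.
have oX : op_in I X by exact: op_in_diag xsP.
have oY : op_in I Y by exact: op_in_diag ysP.
have XE w k : X w k = xs k (w k).
  by rewrite /X (@diagE R H xs a b) // => j; case: (xsP j).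
have YE w k : Y w k = ys k (w k).
  by rewrite /Y (@diagE R H ys a b) // => j; case: (ysP j).
(* Coordinate 0 is split along p into coordinates 0 and 1, the others move up:
   hence partial sums of length m + 2 against m + 1 below. *)
pose vf (w : l2 H) (k : nat) : H :=
  match k with 0%N => p (w 0%N) | 1%N => w 0%N - p (w 0%N) | k'.+2 => w k'.+1 end.
have psE (g h : nat -> H) m : ps g h (m + 2) =
    ip (g 0%N) (h 0%N) + (ip (g 1%N) (h 1%N) + \sum_(k < m) ip (g k.+2) (h k.+2)).
  by rewrite addn2 /ps !big_ord_recl.
have psE1 (g h : nat -> H) m : ps g h (m + 1) =
    ip (g 0%N) (h 0%N) + \sum_(k < m) ip (g k.+1) (h k.+1).
  by rewrite addn1 /ps big_ord_recl.
have split_p u w : ip (p u) (p w) + ip (u - p u) (w - p w) = ip u w.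
  rewrite !ipE !sp pp; ring.
have vf_sq w : square_summable (vf w).
  exists (ip w w) => m; apply: (@le_trans _ _ (ps (vf w) (vf w) (m + 2))).
    by rewrite addn2 /ps !big_ord_recr /= -addrA lerDl addr_ge0 ?ip_ge0.
  have -> : ps (vf w) (vf w) (m + 2) = ps w w (m + 1).
    by rewrite psE psE1 /= addrA split_p.
  exact: ps_le_lip.
pose v (w : l2 H) : l2 H := mkl2 (vf w).
have vE w k : v w k = vf w k by rewrite /v mkl2E.
have v_ip u w : ip (v u) (v w) = ip u w.
  apply: (@l2_ip_shift R H _ _ _ _ 2 1) => m; rewrite psE psE1 !vE /= addrA split_p.
  by congr (_ + _); apply: eq_bigr => k _; rewrite !vE.
have lv : linear v.
  move=> k u w; apply: l2_ext => j; rewrite l2DE l2ZE !vE.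
  case: j => [|[|j]] /=; rewrite ?l2DE ?l2ZE //.
    by rewrite (linD lp) (linZ lp).
  by rewrite (linD lp) (linZ lp) scalerBr opprD addrACA.
have bv : bop v by split=> //; exists 1 => // u; rewrite mul1r /nm v_ip.
have [bav adjv] := adjointP bv.
have isov : isometric v.
  split; first exact/bopP.
  by apply/funext => u; apply: ip_inj => w /=; rewrite ipC -adjv v_ip ipC.
have compress : adjoint v \o X \o v = Y.
  apply/funext => u; apply: ip_inj => w /=; rewrite ipC -adjv ipC.
  apply: (@l2_ip_shift R H _ _ _ _ 2 1) => m; rewrite psE psE1 !XE !YE !vE /= addrA.
  congr (_ + _); last by apply: eq_bigr => k _; rewrite XE YE !vE.
  rewrite /c ?fctE /= ipDl sp; congr (_ + _).
  by rewrite ?fctE !ipE -!(sp _ (w 0%N)) pp subrr mulr0 subr0.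
have [bfY sfY] := op_in_fun_calc hI hf oY; have [bfX sfX] := op_in_fun_calc hI hf oX.
have [bfc sfc] := op_in_fun_calc hI hf oc; have [bfx sfx] := op_in_fun_calc hI hf ox.
have b1 : bop (adjoint v \o fun_calc f X \o v) by exact: bop_comp (bop_comp bav bfX) bv.
have s1 : sym (adjoint v \o fun_calc f X \o v).
  by move=> u w /=; rewrite ipC -adjv ipC sfX adjv.
have b2 : bop (p \o fun_calc f c \o p) by exact: bop_comp (bop_comp bp bfc) bp.
have s2 : sym (p \o fun_calc f c \o p) by move=> u w /=; rewrite sp sfc sp.
have b3 : bop (p \o fun_calc f x \o p) by exact: bop_comp (bop_comp bp bfx) bp.
have s3 : sym (p \o fun_calc f x \o p) by move=> u w /=; rewrite sp sfx sp.
apply/(op_leP b2 s2 b3 s3) => u.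
apply: (le_eq2 (ip_corner _ _ sp) (ip_corner _ _ sp)).
have := iii _ (l2_infinite_dimensional u0n) v X isov (op_in_selfadjoint oX) (op_in_spectrum hI oX).
rewrite compress => /(op_leP bfY sfY b1 s1)/(_ (emb 0 (p u))) h.
have ve : v (emb 0 (p u)) = emb 0 (p u).
  by apply: l2_ext => -[|[|k]]; rewrite vE /= !embE //= ?pp // subrr.
have e1 : ip (fun_calc f Y (emb 0 (p u))) (emb 0 (p u)) = ip (fun_calc f c (p u)) (p u).
  by rewrite (fun_calc_diag hI hf _ _ Ia Ib ab ysP) ip_emb emb_self.
have e2 : ip ((adjoint v \o fun_calc f X \o v) (emb 0 (p u))) (emb 0 (p u)) =
    ip (fun_calc f x (p u)) (p u).
  rewrite ipC -[LHS]adjv ipC ve.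
  rewrite (fun_calc_diag hI hf _ _ Ia Ib ab xsP) ip_emb emb_self.
  exact: erefl.
exact: le_eq2 (esym e1) (esym e2) h.
Qed.

(** In (iv) take p onto the range of W u = (sqrt l u, sqrt (1 - l) u, 0, ...). *)
Lemma corner_convex : (forall H, infinite_dimensional H ->
    forall p x : H -> H, projection p -> selfadjoint x -> spectrum_in I x ->
    forall s : R, I s ->
      op_le (p \o fun_calc f (p \o x \o p + s%:C *: (id - p)) \o p)
            (p \o fun_calc f x \o p)) -> operator_convex I f.
Proof.
move=> iv H inf l l01 x y sx sy sIx sIy.
have [u0 u0n] := infinite_nontrivial inf.
have n0 : exists u : H, u <> 0 by exists u0.
have ox := op_in_of n0 sx sIx; have oy := op_in_of n0 sy sIy.
have oc := op_in_convex l01 ox oy; set c := (X in fun_calc f X) in oc *.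
have [a [b [Ia Ib ab hxab hyab]]] : exists a b, [/\ I a, I b, a <= b, bnd a b x & bnd a b y].
  have [_ _ [a1 [b1 [Ia1 Ib1 ab1 h1]]]] := ox; have [_ _ [a2 [b2 [Ia2 Ib2 ab2 h2]]]] := oy.
  exists (Num.min a1 a2), (Num.max b1 b2); split.
  - by case: leP.
  - by case: leP.
  - by rewrite (le_trans _ (le_trans ab1 _)) // ?ge_min ?le_max lexx.
  - by apply: bnd_weaken h1; rewrite !(ge_min, le_max) lexx.
  - by apply: bnd_weaken h2; rewrite !(ge_min, le_max) lexx orbT.
pose xs (k : nat) : H -> H := if k is 0%N then x else y.
have xsP k : [/\ bop (xs k), sym (xs k) & bnd a b (xs k)].
  by case: k => [|k]; [case: ox|case: oy].
pose X : l2 H -> l2 H := diag xs.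
have oX : op_in I X by exact: op_in_diag xsP.
have XE w k : X w k = xs k (w k).
  by rewrite /X (@diagE R H xs a b) // => j; case: (xsP j).
have /andP[l0 l1] := l01.
pose q := Num.sqrt l; pose r := Num.sqrt (1 - l).
have qq : q * q = l by rewrite -expr2 sqr_sqrtr.
have rr : r * r = 1 - l by rewrite -expr2 sqr_sqrtr // subr_ge0.
pose W (u : H) : l2 H := q%:C *: emb 0 u + r%:C *: emb 1 u.
pose W' (w : l2 H) : H := q%:C *: w 0%N + r%:C *: w 1%N.
have bW : bop W.
  by have := bopD (bopZ q%:C (@emb_bop R H 0%N)) (bopZ r%:C (@emb_bop R H 1%N)); exact.
have bW' : bop W'.
  by have := bopD (bopZ q%:C (@coord_bop R H 0%N)) (bopZ r%:C (@coord_bop R H 1%N)); exact.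
have W0 u : W u 0%N = q%:C *: u by rewrite /W l2DE !l2ZE !embE /= scaler0 addr0.
have W1 u : W u 1%N = r%:C *: u by rewrite /W l2DE !l2ZE !embE /= scaler0 add0r.
have adjW u w : ip (W u) w = ip u (W' w) by rewrite /W /W' !ipE !ip_emb.
have W'W u : W' (W u) = u.
  by rewrite /W' W0 W1 !scalerA -!rmorphM /= qq rr -scalerDl -rmorphD /= addrC subrK scale1r.
pose p := W \o W'.
have bp : bop p by exact: bop_comp.
have sp : sym p by move=> u w /=; rewrite adjW -(ipC (W (W' w))) adjW ipC.
have pp u : p (p u) = p u by rewrite /p /= W'W.
have pp_ : projection p by split; [exact/selfadjointP|apply/funext => u; exact: pp].
have pW u : p (W u) = W u by rewrite /p /= W'W.
(* Any s in I would do; a is at hand. *)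
have oZ := op_in_corner bp sp pp oX Ia; set Z := (X in op_in I X) in oZ.
have cE u : W' (X (W u)) = c u.
  rewrite /W' !XE W0 W1 /= /c ?fctE.
  have [[lx _] _ _] := ox; have [[ly _] _ _] := oy.
  by rewrite (linZ lx) (linZ ly) !scalerA -!rmorphM /= qq rr.
have ZW u : Z (W u) = W (c u).
  by rewrite /Z ?fctE /= pW subrr scaler0 addr0 /p /= cE.
have [bfX sfX] := op_in_fun_calc hI hf oX; have [bfZ sfZ] := op_in_fun_calc hI hf oZ.
have [bfc sfc] := op_in_fun_calc hI hf oc.
have [bfx sfx] := op_in_fun_calc hI hf ox; have [bfy sfy] := op_in_fun_calc hI hf oy.
have b1 : bop (p \o fun_calc f Z \o p) by exact: bop_comp (bop_comp bp bfZ) bp.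
have s1 : sym (p \o fun_calc f Z \o p) by move=> u w /=; rewrite !sp sfZ.
have b2 : bop (p \o fun_calc f X \o p) by exact: bop_comp (bop_comp bp bfX) bp.
have s2 : sym (p \o fun_calc f X \o p) by move=> u w /=; rewrite !sp sfX.
have bR : bop (l%:C *: fun_calc f x + (1 - l)%:C *: fun_calc f y).
  exact: bopD (bopZ _ bfx) (bopZ _ bfy).
have sR : sym (l%:C *: fun_calc f x + (1 - l)%:C *: fun_calc f y).
  exact: sym_comb.
apply/(op_leP bfc sfc bR sR) => u.
have := iv _ (l2_infinite_dimensional u0n) p X pp_ (op_in_selfadjoint oX)
  (op_in_spectrum hI oX) a Ia.
rewrite -/Z => /(op_leP b1 s1 b2 s2)/(_ (W u)) h.
have e1 : ip ((p \o fun_calc f Z \o p) (W u)) (W u) = ip (fun_calc f c u) u.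
  rewrite (ip_corner _ _ sp) pW -(fun_calc_intertwine hI hf oc oZ bW).
    by rewrite adjW W'W.
  by move=> v; rewrite ZW.
have e2 : ip ((p \o fun_calc f X \o p) (W u)) (W u) =
    ip ((l%:C *: fun_calc f x + (1 - l)%:C *: fun_calc f y) u) u.
  rewrite (ip_corner _ _ sp) pW ip_comb.
  have [lX _] := bfX.
  have fXe k v : fun_calc f X (emb k v) = emb k (fun_calc f (xs k) v).
    exact: (fun_calc_diag hI hf k v Ia Ib ab xsP).
  have fXW : fun_calc f X (W u) = q%:C *: emb 0 (fun_calc f x u) + r%:C *: emb 1 (fun_calc f y u).
    rewrite {1}/W (linD lX) (linZ lX q%:C) (linZ lX r%:C) (fXe 0%N) (fXe 1%N).
    exact: erefl.
  rewrite fXW; exact: ip_mix (W0 u) (W1 u) qq rr.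
exact: le_eq2 (esym e1) (esym e2) h.
Qed.

End Implications.

Theorem theorem2p1 (R : realType) (I : set R) (f : R -> R)
    (hI : is_interval I) (hf : {within I, continuous f}) :
  [<->
    (* (i) *)
    operator_convex I f;
    (* (ii) *)
    forall (n : nat), (1 <= n)%N ->
    forall (H : hilbertType R) (x a : 'I_n -> H -> H),
      (forall i, selfadjoint (x i) /\ spectrum_in I (x i)) ->
      (forall i, bounded_operator (a i)) ->
      \sum_(k < n) (adjoint (a k) \o a k) = id ->
      op_le (fun_calc f (\sum_(i < n) (adjoint (a i) \o x i \o a i)))
            (\sum_(i < n) (adjoint (a i) \o fun_calc f (x i) \o a i));
    (* (iii) *)
    forall (H : hilbertType R), infinite_dimensional H ->
    forall v x : H -> H, isometric v -> selfadjoint x -> spectrum_in I x ->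
      op_le (fun_calc f (adjoint v \o x \o v))
            (adjoint v \o fun_calc f x \o v);
    (* (iv) *)
    forall (H : hilbertType R), infinite_dimensional H ->
    forall p x : H -> H, projection p -> selfadjoint x -> spectrum_in I x ->
    forall s : R, I s ->
      op_le (p \o fun_calc f (p \o x \o p + s%:C *: (id - p)) \o p)
            (p \o fun_calc f x \o p)].
Proof.
tfae.
- move=> conv n _ H x a hx ba iso.
  have [[u0 u0n]|triv] := pselect (exists u : H, u <> 0); last exact: op_le_trivial.
  apply: jensen conv => //; first exact: u0n.
    by move=> i; have [sx sI] := hx i; apply: op_in_of => //; exists u0.
  by move=> i; apply/bopP.
- move=> ii H _ v x [bv iso] sx sI.
  have := ii 1%N isT H (fun=> x) (fun=> v); rewrite !big_ord1.
  by apply.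
- exact: isometry_corner.
- exact: corner_convex.
Qed.
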